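(* Let $(T(t))_{t\ge 0}$ be a strongly continuous semigroup on a Banach space $X$. (a) $(T(t))_{t\ge 0}$ extends to a holomorphic semigroup if there is a polynomial $f\in\mathbb{C}[z]$ such that $$\limsup_{t\downarrow 0}\|f(T(t))\|<\|f\|_{\mathbb{D}}.$$ (b) Conversely, if $(T(z))_{z\in\Sigma}$ is holomorphic, then for each $f\in\mathbb{C}_1[z]$ there exists $N_0\in\mathbb{N}$ such that for every $N\ge N_0$ there exists $K_0\in\mathbb{R}_+$ with $$\limsup_{t\downarrow 0}\|f^N(T(t))\,T(Kt)\|<\|f^N\|_{\mathbb{D}}\qquad\text{for all } K\ge K_0.$$
   Context: Banach spaces are complex. For $f\in\mathbb{C}[z]$, $\|f\|_{\mathbb{D}}:=\sup_{|z|\le 1}|f(z)|$. For a bounded operator $S$ and $f(z)=\sum_k a_k z^k$, $f(S)=\sum_k a_k S^k$; $f^N$ is the $N$-th power of the polynomial $f$. $\mathbb{C}_1[z]$ denotes the set of all $f\in\mathbb{C}[z]$ with $|f(1)|<\|f\|_{\mathbb{D}}$. A strongly continuous semigroup $(T(t))_{t\ge0}$ is called holomorphic (extends to a holomorphic semigroup, then written $(T(z))_{z\in\Sigma}$) if $T$ has a holomorphic extension to a sector $\Sigma=\{z\in\mathbb{C}\setminus\{0\}:|\arg z|<\delta\}$ for some $\delta\in(0,\frac{\pi}{2}]$.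
   Formalization: ''Holomorphic'' here also requires T(z)x → x as z → 0 in every smaller sector, both concluded in (a) and assumed in (b); with a bare holomorphic extension to a sector, part (b) is false. *)

(* Defs.v *)
From HB Require Import structures.
From mathcomp Require Import all_boot all_order all_algebra.
From mathcomp Require Import complex.
From mathcomp Require Import all_classical all_reals all_analysis.

Set Implicit Arguments.
Unset Strict Implicit.
Unset Printing Implicit Defensive.

Import Order.TTheory GRing.Theory Num.Theory.
Import numFieldNormedType.Exports.

Local Open Scope classical_set_scope.
Local Open Scope complex_scope.
Local Open Scope ring_scope.

(* Norms of R[i]-normed modules take their values in R[i]; we read them in R. *)
Definition rnorm (R : realType) (V : normedZmodType R[i]) (x : V) : R :=
  complex.Re `|x|.

Definition limsup_at0 (R : realType) (u : R -> \bar R) : \bar R :=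
  limf_esup u 0^'+.

Section Operators.
Context {R : realType} {X : completeNormedModType R[i]}.
Implicit Types (S : X -> X) (f : {poly R[i]}).

Definition bounded_operator S : Prop := linear S /\ continuous S.

Definition opnorm S : \bar R :=
  ereal_sup [set (rnorm (S x))%:E | x in [set x | rnorm x <= 1]].

Definition op_poly f S : X -> X :=
  fun x => \sum_(k < size f) f`_k *: iter k S x.

End Operators.

Section Polynomials.
Context {R : realType}.

Definition disc_norm (f : {poly R[i]}) : \bar R :=
  ereal_sup [set (rnorm f.[z])%:E | z in [set z : R[i] | rnorm z <= 1]].

Definition C1poly : set {poly R[i]} :=
  [set f | ((rnorm f.[1%R])%:E < disc_norm f)%E].

End Polynomials.

Section Semigroups.
Context {R : realType} {X : completeNormedModType R[i]}.

(* Only the values T t with 0 <= t are meaningful. *)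
Record C0_semigroup (T : R -> X -> X) : Prop := {
  C0_bounded : forall t, 0 <= t -> bounded_operator (T t) ;
  C0_0 : T 0 = id ;
  C0_D : forall s t, 0 <= s -> 0 <= t -> T (s + t) = T s \o T t ;
  C0_cont : forall x,
    {within [set t : R | 0 <= t], continuous (fun t => T t x)} }.

(* The z != 0 with |arg z| < delta, in polar form; R[i]^o is R[i] with its
   normed topology. *)
Definition sector (delta : R) : set R[i]^o :=
  [set z | exists r theta : R, [/\ 0 < r, `|theta| < delta &
     z = (r * cos theta) +i* (r * sin theta)]].

(* Complex differentiability on A with respect to the operator norm. *)
Definition op_holomorphic (A : set R[i]^o) (S : R[i]^o -> X -> X) : Prop :=
  forall z, A z -> exists D : X -> X, bounded_operator D /\
    opnorm (fun x => h^-1 *: (S (z + h) x - S z x) - D x)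
      @[h --> (0 : R[i]^o)^'] --> 0%E.

(* The strong continuity at 0 in smaller sectors is part of the notion of a
   holomorphic (C0-)semigroup on a sector, and it does not follow from the
   holomorphy on the sector and the strong continuity on [0, +oo[: an extension
   may be unbounded near 0 on every non-real ray. *)
Record holomorphic_semigroup (delta : R) (S : R[i]^o -> X -> X) : Prop := {
  holo_bounded : forall z, sector delta z -> bounded_operator (S z) ;
  holo_D : forall z w, sector delta z -> sector delta w ->
    S (z + w) = S z \o S w ;
  holo_holo : op_holomorphic (sector delta) S ;
  holo_cont0 : forall delta' : R, 0 < delta' -> delta' < delta ->
    forall x, S z x @[z --> within (sector delta') (nbhs (0 : R[i]^o))] --> x }.

Definition extends_holomorphically (T : R -> X -> X) : Prop :=
  exists (delta : R) (S : R[i]^o -> X -> X),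
    [/\ 0 < delta, delta <= pi / 2, holomorphic_semigroup delta S &
        forall t, 0 < t -> S t%:C = T t].

End Semigroups.

(* Main.v *)
(**
  Both parts pass through the real-variable estimate
  [‖T(t + d) - T(t)‖ <= C d / t] for small [t].

  (a) The maximum principle yields [ξ] with [|ξ| = 1] and [|f(ξ)|] larger than
  [‖f(T(t))‖] for all small [t].  As [f(T(t)) x] is close to [f(ξ) x] whenever
  [T(t) x] is close to [ξ x], the operators [ξ - T(t)] are uniformly bounded
  below for small [t] (the Kato–Beurling condition).  Cut an orbit off by a cubic
  B-spline and, for each frequency [η], pick [t] with [e^(iηt) = ξ]: then
  [1 - ξ^-1 T(t)] acts on the [η]-th Fourier coefficient as a difference
  operator on the spline.  Three applications of the lower bound make the
  coefficients decay like [|η|^-3], so by Fejér summation the orbit is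
  Lipschitz, which is the estimate at [t] of order [1] after rescaling time.
  The estimate yields a bounded generator part [A T(t)] with
  [‖A^n T(t)‖ <= G n! (Q / t)^n], and
  [T(t + w) = \sum_n w^n / n! A^n T(t)] is the holomorphic extension.

  (b) Conversely, the difference of a holomorphic semigroup across a vertical
  line is approximately harmonic on a fine grid; a discrete maximum principle
  with a quadratic barrier gives the estimate.  It makes
  [f^N(T(t)) T(Kt) - f(1)^N T(Kt)] of size [O(1/K)], while
  [|f(1)|^N M < ‖f‖^N] for large [N].
*)

Require Import Defs.
From HB Require Import structures.
From mathcomp Require Import all_boot all_order all_algebra.
From mathcomp Require Import complex.
From mathcomp Require Import all_classical all_reals all_analysis.
From mathcomp Require Import ring lra.

Import Order.TTheory GRing.Theory Num.Theory.
Import numFieldNormedType.Exports.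

Local Open Scope classical_set_scope.
Local Open Scope complex_scope.
Local Open Scope ring_scope.


(** * Norms and bounded operators *)

(** No vector-valued integral occurs. Fourier coefficients are Riemann sums of step [2 * pi / L];
    translating such a sum by a time off the grid costs an error that vanishes as [L] grows, and
    each use of the lower bound absorbs one such error. In (b) a grid and a maximum principle
    likewise stand in for Cauchy's formula. The frequencies are half-integers: the time [t] with
    e^(iηt) = ξ is of order 1/|η|, and only frequencies away from 0 keep it in the range where the
    lower bound is known. An increment [d] of time changes the η-th Fourier term by a factor of
    order |η| d, so decay |η|^-3 leaves the summable |η|^-2; no smaller integer power allows
    absolute summation. This is why the spline is cubic: its third difference of step [t] is O(t^3).
    The generator and its domain never appear. A T(t) is the derivative of the orbit at [t], and A^n
    T(t) is a product of operators A T(h) with small [h]; the factor n^n that this costs is e^n n!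
    at most, just what the exponential series can bear. *)

Section RealNorm.
Context {R : realType} {V : normedZmodType R[i]}.
Implicit Types x y z : V.

Lemma rnormE x : `|x| = (rnorm x)%:C.
Proof. by rewrite /rnorm RRe_real// normr_real. Qed.

Lemma rnorm_ge0 x : 0 <= rnorm x.
Proof. by rewrite -ler0c -rnormE. Qed.

Lemma rnorm0 : rnorm (0 : V) = 0.
Proof. by rewrite /rnorm normr0. Qed.

Lemma rnormD x y : rnorm (x + y) <= rnorm x + rnorm y.
Proof. by rewrite -lecR rmorphD/= -!rnormE ler_normD. Qed.

Lemma rnormN x : rnorm (- x) = rnorm x.
Proof. by rewrite /rnorm normrN. Qed.

Lemma rnormBC x y : rnorm (x - y) = rnorm (y - x).
Proof. by rewrite /rnorm distrC. Qed.

Lemma rnormB x y : rnorm (x - y) <= rnorm x + rnorm y.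
Proof. by rewrite -(rnormN y) rnormD. Qed.

Lemma rnorm_eq0 x : rnorm x = 0 -> x = 0.
Proof. by move=> x0; apply/eqP; rewrite -normr_eq0 rnormE x0. Qed.

Lemma rnorm_triangle x y z : rnorm (x - z) <= rnorm (x - y) + rnorm (y - z).
Proof. by have := rnormD (x - y) (y - z); rewrite addrA subrK. Qed.

Lemma rnorm_le_sub x y : rnorm x <= rnorm (x - y) + rnorm y.
Proof. by have := rnormD (x - y) y; rewrite subrK. Qed.

Lemma rnorm_sum (I : Type) (r : seq I) (P : pred I) (F : I -> V) :
  rnorm (\sum_(i <- r | P i) F i) <= \sum_(i <- r | P i) rnorm (F i).
Proof.
elim/big_rec2: _ => [|i y x _ h]; first by rewrite rnorm0.
by rewrite (le_trans (rnormD _ _))// lerD2l.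
Qed.

Lemma rnorm_le0_eps x : (forall e : R, 0 < e -> rnorm x <= e) -> x = 0.
Proof.
move=> h; apply: rnorm_eq0; apply/eqP; rewrite eq_le rnorm_ge0 andbT.
by apply/ler_addgt0Pr => e e0; rewrite add0r h.
Qed.

End RealNorm.

Section ComplexNorm.
Context {R : realType}.
Implicit Types z w : R[i].

Lemma rnormcE z : rnorm z = Num.sqrt (complex.Re z ^+ 2 + complex.Im z ^+ 2).
Proof. by rewrite /rnorm normc_def. Qed.

Lemma rnormM z w : rnorm (z * w) = rnorm z * rnorm w.
Proof. by apply: (@complexI R); rewrite rmorphM/= -!rnormE normrM. Qed.

Lemma rnorm1 : rnorm (1 : R[i]) = 1.
Proof. by rewrite /rnorm normr1. Qed.

Lemma rnormR (r : R) : rnorm (r%:C) = `|r|.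
Proof. by rewrite rnormcE/= expr0n addr0 sqrtr_sqr. Qed.

Lemma rnormi : rnorm ('i : R[i]) = 1.
Proof. by rewrite rnormcE/= expr0n add0r expr1n sqrtr1. Qed.

Lemma rnormX z n : rnorm (z ^+ n) = rnorm z ^+ n.
Proof.
by elim: n => [|n ih]; rewrite ?expr0 ?rnorm1// !exprS rnormM ih.
Qed.

Lemma rnormV z : rnorm z^-1 = (rnorm z)^-1.
Proof.
by apply: (@complexI R); rewrite fmorphV/= -!rnormE normfV.
Qed.

Lemma rnorm_nat n : rnorm (n%:R : R[i]) = n%:R.
Proof. by rewrite /rnorm normr_nat -(rmorph_nat (real_complex R)). Qed.

Lemma Re_le_rnorm z : `|complex.Re z| <= rnorm z.
Proof. by rewrite -lecR -rnormE normc_ge_Re. Qed.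

Lemma Im_le_rnorm z : `|complex.Im z| <= rnorm z.
Proof.
by have := Re_le_rnorm (z * 'i); rewrite ReiNIm normrN rnormM rnormi mulr1.
Qed.

Lemma rnorm_le_ReIm z : rnorm z <= `|complex.Re z| + `|complex.Im z|.
Proof.
rewrite {1}[z]complexE (le_trans (rnormD _ _))// rnormM rnormi mul1r.
by rewrite !rnormR.
Qed.

End ComplexNorm.

Section Linear.
Context {R : realType} {V : normedModType R[i]}.
Implicit Types (x y : V) (S : V -> V).

Lemma rnormZ (k : R[i]) x : rnorm (k *: x) = rnorm k * rnorm x.
Proof. by apply: (@complexI R); rewrite rmorphM/= -!rnormE normrZ. Qed.

Lemma linear_add {S} (lS : linear S) x y : S (x + y) = S x + S y.
Proof. by have := lS 1 x y; rewrite !scale1r. Qed.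

Lemma linear_zero {S} (lS : linear S) : S 0 = 0.
Proof. by have /eqP := linear_add lS 0 0; rewrite addr0 -subr_eq subrr => /eqP. Qed.

Lemma linear_scale {S} (lS : linear S) k x : S (k *: x) = k *: S x.
Proof. by have := lS k x 0; rewrite (linear_zero lS) !addr0. Qed.

Lemma linear_opp {S} (lS : linear S) x : S (- x) = - S x.
Proof. by rewrite -scaleN1r (linear_scale lS) scaleN1r. Qed.

Lemma linear_subr {S} (lS : linear S) x y : S (x - y) = S x - S y.
Proof. by rewrite (linear_add lS) (linear_opp lS). Qed.

Lemma linear_bigsum {S} (lS : linear S) (I : Type) (r : seq I) (P : pred I)
    (F : I -> V) :
  S (\sum_(i <- r | P i) F i) = \sum_(i <- r | P i) S (F i).
Proof. exact: (big_morph S (linear_add lS) (linear_zero lS)). Qed.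

Lemma linear_comp S S' : linear S -> linear S' -> linear (S \o S').
Proof. by move=> lS lS' k x y /=; rewrite lS' lS. Qed.

Definition op_bound S (c : R) := forall x, rnorm (S x) <= c * rnorm x.

Lemma op_bound_comp S S' c c' : 0 <= c -> op_bound S c -> op_bound S' c' ->
  op_bound (S \o S') (c * c').
Proof.
move=> c0 bS bS' x /=; rewrite (le_trans (bS _))// -mulrA ler_wpM2l//.
Qed.

Lemma op_bound_le S c c' : c <= c' -> op_bound S c -> op_bound S c'.
Proof. by move=> cc' bS x; rewrite (le_trans (bS _))// ler_wpM2r// rnorm_ge0. Qed.

Lemma op_bound_iter S c n : 0 <= c -> op_bound S c ->
  op_bound (iter n S) (c ^+ n).
Proof.
move=> c0 bS; elim: n => [|n ih] x /=; first by rewrite expr0 mul1r.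
by rewrite exprS (le_trans (bS _))// -mulrA ler_wpM2l.
Qed.

Lemma linear_iter S n : linear S -> linear (iter n S).
Proof. by move=> lS; elim: n => [//|n ih]; exact: (linear_comp _ _ lS ih). Qed.

End Linear.

Section Topology.
Context {R : realType} {V : normedModType R[i]}.

Lemma gt0_real (e : R[i]) : 0 < e -> exists2 r : R, 0 < r & e = r%:C.
Proof.
move=> e0; exists (complex.Re e); last by rewrite RRe_real// gtr0_real.
by move: e0; rewrite ltcE => /andP[].
Qed.

Lemma cvg_rnorm {T : Type} (F : set_system T) {FF : Filter F} (f : T -> V) (l : V) :
  f @ F --> l <->
  (forall e : R, 0 < e -> \forall t \near F, rnorm (f t - l) <= e).
Proof.
split.
  move=> /cvgrPdist_le h e e0; have e0' : (0 : R[i]) < e%:C by rewrite ltcR.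
  apply: filterS (h _ e0') => t; rewrite rnormE lecR rnormBC//.
move=> h; apply/cvgrPdist_le => _ /gt0_real[e e0 ->].
by apply: filterS (h _ e0) => t; rewrite rnormE lecR rnormBC.
Qed.

Lemma nbhs_rnorm (x : V) (P : set V) :
  nbhs x P <-> exists2 e : R, 0 < e & forall y, rnorm (y - x) < e -> P y.
Proof.
split.
  move=> /nbhs_ballP[e /= /gt0_real[r r0 ->]] h; exists r => // y yr.
  by apply: h; rewrite -ball_normE/= rnormE ltcR rnormBC.
move=> [e e0 h]; apply/nbhs_ballP; exists e%:C => /=; first by rewrite ltcR.
by move=> y; rewrite -ball_normE/= rnormE ltcR => ye; apply: h; rewrite rnormBC.
Qed.

Lemma op_bound_continuous (S : V -> V) c : linear S -> op_bound S c ->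
  continuous S.
Proof.
move=> lS bS x; apply/cvg_rnorm => e e0; apply/nbhs_rnorm.
have c0 : 0 < `|c| + 1 by rewrite ltr_wpDl.
exists (e / (`|c| + 1)); first by rewrite divr_gt0.
move=> y; rewrite ltr_pdivlMr// => h.
rewrite -(linear_subr lS) (le_trans (bS _))// (le_trans _ (ltW h))// mulrC.
by rewrite ler_wpM2l ?rnorm_ge0// (le_trans (ler_norm _))// lerDl.
Qed.

Lemma continuous_op_bound (S : V -> V) : linear S -> continuous S ->
  exists2 c : R, 0 <= c & op_bound S c.
Proof.
move=> lS /(_ 0) /cvg_rnorm /(_ 1 ltr01) /nbhs_rnorm[e e0 h].
exists (2 / e); first by rewrite divr_ge0// ltW.
move=> x; have [->|x0] := eqVneq x 0.
  by rewrite (linear_zero lS) !rnorm0 mulr0.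
have nx : 0 < rnorm x.
  by rewrite lt_neqAle rnorm_ge0 andbT eq_sym; apply: contra x0 => /eqP/rnorm_eq0/eqP.
have := h ((e / 2 / rnorm x)%:C *: x).
rewrite !subr0 (linear_zero lS) subr0 (linear_scale lS) !rnormZ rnormR.
rewrite ger0_norm; last by rewrite divr_ge0 ?rnorm_ge0// divr_ge0// ltW.
rewrite divfK ?gt_eqF// ltr_pdivrMr// mulr2n mulrDr mulr1 ltrDl e0 => /(_ isT).
rewrite -mulrA -ler_pdivlMl; last by rewrite divr_gt0.
rewrite mulr1 mulrC ler_pdivrMr// => /le_trans; apply.
by rewrite invf_div.
Qed.

End Topology.

(** * Completeness with geometric rates *)

Section Complete.
Context {R : realType} {X : completeNormedModType R[i]}.

Lemma sum_geom_half (n : nat) : \sum_(i < n) (2^-1 : R) ^+ i = 2 - 2 * 2^-1 ^+ n.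
Proof.
elim: n => [|n ih]; first by rewrite big_ord0 expr0 mulr1 subrr.
by rewrite big_ord_recr/= ih exprS; field.
Qed.

Lemma half_expr_lt (G e : R) : 0 < e -> exists N, forall n, (N <= n)%N ->
  G * 2^-1 ^+ n < e.
Proof.
move=> e0; have [N hN] : exists N : nat, `|G| / e < N%:R.
  by exists (Num.bound (`|G| / e)); rewrite archi_boundP// divr_ge0// ltW.
exists N => n Nn.
have n2 : (N%:R : R) <= 2 ^+ n.
  by rewrite -natrX ler_nat (leq_trans Nn)// ltnW// ltn_expl.
rewrite exprVn ltr_pdivrMr ?exprn_gt0// (le_lt_trans (ler_norm _))//.
by rewrite mulrC -ltr_pdivrMr// (lt_le_trans hN).
Qed.

Lemma geometric_step_dist (u : nat -> X) (G : R) :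
  (forall n, rnorm (u n.+1 - u n) <= G * 2^-1 ^+ n) ->
  forall n k, rnorm (u (n + k)%N - u n) <= 2 * G * 2^-1 ^+ n.
Proof.
move=> h n k.
have G0 : 0 <= G.
  by have := h 0%N; rewrite expr0 mulr1; apply: le_trans; rewrite rnorm_ge0.
(* The exact partial sum of the geometric series is what the induction on [k] can carry. *)
suff : rnorm (u (n + k)%N - u n) <= G * 2^-1 ^+ n * (2 - 2 * 2^-1 ^+ k).
  move=> /le_trans; apply; rewrite [leRHS](_ : _ = G * 2^-1 ^+ n * 2); last by ring.
  by rewrite ler_wpM2l ?mulr_ge0// ?exprn_ge0// gerBl mulr_ge0// exprn_ge0.
elim: k => [|k ih]; first by rewrite addn0 subrr rnorm0 expr0 mulr1 subrr mulr0.
rewrite (le_trans (rnorm_triangle _ (u (n + k)%N) _))// addnS.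
apply: le_trans (lerD (h _) ih) _.
rewrite exprD exprS le_eqVlt; apply/orP; left; apply/eqP; by field.
Qed.

(** Limits are kept together with their geometric rate: it bounds the limit by the data and, for the
    exponential series, identifies two limits. *)
Lemma geometric_step_cvg (u : nat -> X) (G : R) :
  (forall n, rnorm (u n.+1 - u n) <= G * 2^-1 ^+ n) ->
  exists l, forall n, rnorm (l - u n) <= 2 * G * 2^-1 ^+ n.
Proof.
move=> h; have hd := geometric_step_dist _ _ h.
have : cauchy (u @ \oo).
  apply: cauchy_exP => _ /gt0_real[e e0 ->].
  have [N hN] := half_expr_lt (2 * G) _ e0.
  exists (u N); exists N => // n /= Nn; rewrite -ball_normE/= rnormE ltcR.
  by rewrite rnormBC -(subnKC Nn) (le_lt_trans (hd _ _))// hN.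
move=> /cauchy_cvg/cvg_ex[l /cvg_rnorm hl]; exists l => n.
apply/ler_addgt0Pr => e e0.
have [N _ /(_ (N + n)%N)] := hl _ e0.
rewrite /= leq_addr => /(_ isT) hN.
rewrite (le_trans (rnorm_triangle _ (u (N + n)%N) _))// addrC lerD//.
  by rewrite addnC hd.
by rewrite rnormBC.
Qed.

End Complete.

(** * The uniform boundedness principle *)

Section UniformBoundedness.
Context {R : realType} {X : completeNormedModType R[i]}.

(* Sokal's gliding hump: of [T (x + z)] and [T (x - z)] one has norm at least
   that of [T z], so every ball contains a point where [T] is large. *)
Lemma uniform_boundedness (S : nat -> X -> X) :
  (forall n, linear (S n)) -> (forall n, continuous (S n)) ->
  (forall x, exists c : R, forall n, rnorm (S n x) <= c) ->
  exists c : R, forall n, op_bound (S n) c.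
Proof.
move=> lS cS pb; apply: contrapT => nb.
have unb (c : R) : exists n x, c * rnorm x < rnorm (S n x).
  apply: contrapT => h; apply: nb; exists c => n x; rewrite leNgt.
  by apply/negP => hx; apply: h; exists n, x.
(* A state is a centre, a radius and an index. Guarding by a positive radius makes the relation
   total, as [choice] requires. *)
have step (s : X * R * nat) : exists t : nat * (X * R), 0 < s.1.2 ->
    [/\ rnorm (t.2.1 - s.1.1) <= s.1.2 / 2, 0 < t.2.2, t.2.2 <= s.1.2 / 2,
        s.2.+1%:R <= rnorm (S t.1 t.2.1) &
        forall z, rnorm z <= t.2.2 -> rnorm (S t.1 z) <= 1].
  case: s => [[x r] k] /=; have [r0|] := ltP 0 r; last first.
    by move=> r0; exists (0%N, (x, r)); rewrite ltNge r0.
  have [n [z hz]] := unb (k.+1%:R * (2 / r)).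
  have z0 : 0 < rnorm z.
    rewrite lt_neqAle rnorm_ge0 andbT eq_sym; apply/negP => /eqP /[dup] z0.
    move=> /rnorm_eq0 zz; move: hz; rewrite z0 zz (linear_zero (lS n)) rnorm0.
    by rewrite mulr0 ltxx.
  pose w := (r / 2 / rnorm z)%:C *: z.
  have nw : rnorm w = r / 2.
    rewrite rnormZ rnormR ger0_norm ?divfK ?gt_eqF//.
    by rewrite divr_ge0 ?rnorm_ge0// divr_ge0// ltW.
  have Sw : k.+1%:R <= rnorm (S n w).
    rewrite (linear_scale (lS n)) rnormZ rnormR ger0_norm; last first.
      by rewrite divr_ge0 ?rnorm_ge0// divr_ge0// ltW.
    rewrite -ler_pdivrMl ?divr_gt0//; apply: le_trans (ltW hz).
    by rewrite le_eqVlt; apply/orP; left; apply/eqP; field; rewrite !gt_eqF.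
  have [x' x'x Sx'] : exists2 x', rnorm (x' - x) <= r / 2 &
      k.+1%:R <= rnorm (S n x').
    have [h|h] := leP (k.+1%:R) (rnorm (S n (x + w))).
      by exists (x + w) => //; rewrite addrC addKr nw.
    exists (x - w); first by rewrite addrC addKr rnormN nw.
    have : 2 * k.+1%:R <= rnorm (S n (x + w)) + rnorm (S n (x - w)).
      apply: (@le_trans _ _ (rnorm (S n (x + w) - S n (x - w)))); last exact: rnormB.
      rewrite -(linear_subr (lS n)).
      have -> : x + w - (x - w) = 2%:R *: w.
        by rewrite opprB addrC -addrA addKr scaler_nat mulr2n.
      by rewrite (linear_scale (lS n)) rnormZ rnorm_nat ler_wpM2l.
    lra.
  have [c c0 bc] := continuous_op_bound _ (lS n) (cS n).
  have c1 : 0 < c + 1 by rewrite ltr_wpDl.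
  (* The bound [(c + 1)^-1] makes [S n] at most 1 on the new ball around 0, so at every point of the
     ball around [x'] its norm is still at least [k]. *)
  exists (n, (x', Num.min (r / 2) (c + 1)^-1)) => /= _; split => //.
  - by rewrite lt_min divr_gt0//= invr_gt0.
  - by rewrite ge_min lexx.
  move=> y; rewrite le_min => /andP[_ hy].
  rewrite (le_trans (bc y))//; apply: (@le_trans _ _ ((c + 1) * rnorm y)).
    by rewrite ler_wpM2r ?rnorm_ge0// lerDl.
  by rewrite mulrC -ler_pdivlMr// mul1r.
have [f hf] := choice step.
pose st := fix st k := if k is k'.+1 then (f (st k', k')).2 else ((0 : X), (1 : R)).
have stS k : st k.+1 = (f (st k, k)).2 by [].
have rpos k : 0 < (st k).2.
  elim: k => [|k ih]; first by rewrite /= ltr01.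
  by rewrite stS; have [] := hf (st k, k) ih.
have h k := hf (st k, k) (rpos k).
have rdec k j : (st (k + j)%N).2 <= (st k).2 * 2^-1 ^+ j.
  elim: j => [|j ih]; first by rewrite addn0 expr0 mulr1.
  rewrite addnS stS exprSr mulrA; have [_ _ + _ _] := h (k + j)%N => /le_trans; apply.
  by rewrite ler_wpM2r.
have stepk k j : rnorm ((st (k + j.+1)%N).1 - (st (k + j)%N).1) <=
    (st k).2 / 2 * 2^-1 ^+ j.
  rewrite addnS stS; have [+ _ _ _ _] := h (k + j)%N => /le_trans; apply.
  by rewrite mulrAC ler_wpM2r//= rdec.
have [l hl] := geometric_step_cvg (fun n => (st n).1) _ (stepk 0%N).
(* Each move is at most half the current radius and the radii halve, so all moves after stage [k]
   add up to at most the radius at [k]. *)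
have lk k : rnorm (l - (st k).1) <= (st k).2.
  apply/ler_addgt0Pr => e e0.
  have [N hN] := half_expr_lt (2 * ((st 0%N).2 / 2)) _ e0.
  rewrite (le_trans (rnorm_triangle _ (st (k + N)%N).1 _))// addrC lerD//.
    have := geometric_step_dist (fun n => (st (k + n)%N).1) _ (stepk k) 0%N N.
    by rewrite addn0 add0n expr0 mulr1 mulrC divfK.
  by rewrite (le_trans (hl _))// ltW// hN// leq_addl.
have [c hc] := pb l.
have [k kc] : exists k : nat, c < k%:R.
  exists (Num.bound `|c|); rewrite (le_lt_trans (ler_norm c))//.
  by rewrite archi_boundP.
have [_ _ _ big small] := h k.
have := rnorm_le_sub (S (f (st k, k)).1 (f (st k, k)).2.1)
   (S (f (st k, k)).1 l).
rewrite -(linear_subr (lS _)).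
have := small ((f (st k, k)).2.1 - l).
rewrite rnormBC -stS (lk k.+1) => /(_ isT).
have := hc (f (st k, k)).1; move: big; rewrite /= -stS -natr1/=.
lra.
Qed.

End UniformBoundedness.

(** * Bounds for strongly continuous semigroups *)

Section C0.
Context {R : realType} {X : completeNormedModType R[i]} {T : R -> X -> X}
  (hT : C0_semigroup T).

Lemma C0_linear t : 0 <= t -> linear (T t).
Proof. by move=> t0; have [] := C0_bounded hT t0. Qed.

Lemma C0_op_bound t : 0 <= t -> exists2 c : R, 0 <= c & op_bound (T t) c.
Proof. by move=> t0; have [] := C0_bounded hT t0; exact: continuous_op_bound. Qed.

Lemma C0_add s t x : 0 <= s -> 0 <= t -> T (s + t) x = T s (T t x).
Proof. by move=> s0 t0; rewrite (C0_D hT). Qed.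

Lemma C0_at0 x (e : R) : 0 < e ->
  exists2 d : R, 0 < d & forall r, 0 <= r <= d -> rnorm (T r x - x) <= e.
Proof.
move=> e0; have : {within [set t : R | 0 <= t], continuous (fun t => T t x)} by exact: C0_cont.
move=> /subspace_continuousP /(_ 0 (lexx _)).
move=> /cvg_rnorm /(_ e e0); rewrite /from_subspace/= (C0_0 hT)/= near_withinE.
move=> /nbhs_ballP[d /= d0 h]; exists (d / 2); first by rewrite divr_gt0.
move=> r /andP[r0 rd]; apply: h => //; rewrite /ball/= sub0r normrN ger0_norm//.
lra.
Qed.

(** Otherwise there are times [t n] tending to 0 with unbounded norms of [T (t n)]; each orbit
    [T (t n) x] is bounded because it tends to [x], against uniform boundedness. *)
Lemma C0_bounded_near0 : exists t0 M : R, [/\ 0 < t0, 1 <= M &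
  forall t, 0 <= t <= t0 -> op_bound (T t) M].
Proof.
apply: contrapT => h.
have unb (n : nat) : exists t, 0 <= t <= n.+1%:R^-1 /\ ~ op_bound (T t) n.+1%:R.
  apply: contrapT => h'; apply: h; exists n.+1%:R^-1, n.+1%:R.
  rewrite invr_gt0 ltr0n ler1n; split => // t ht.
  by apply: contrapT => h''; apply: h'; exists t.
have [t ht] := choice unb.
have t_ge0 n : 0 <= t n by have [/andP[]] := ht n.
have [|||c hc] := uniform_boundedness (fun n => T (t n)).
- by move=> n; exact: C0_linear.
- by move=> n; have [] := C0_bounded hT (t_ge0 n).
- move=> x; have [d d0 hd] := C0_at0 x 1 ltr01.
  have [N hN] : exists N : nat, d^-1 < N%:R.
    by exists (Num.bound d^-1); rewrite archi_boundP// invr_ge0 ltW.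
  have [c hc] : exists c : R, forall n, (n < N)%N -> rnorm (T (t n) x) <= c.
    exists (\sum_(i < N) rnorm (T (t i) x)) => n nN.
    rewrite (bigD1 (Ordinal nN))//= lerDl sumr_ge0// => i _; exact: rnorm_ge0.
  exists (Num.max c (1 + rnorm x)) => n; rewrite le_max.
  have [nN|Nn] := ltnP n N; first by rewrite hc.
  apply/orP; right; apply: le_trans (rnorm_le_sub _ x) _; rewrite lerD2r hd//.
  have [/andP[-> tn] _] := ht n; rewrite (le_trans tn)//.
  rewrite invf_ple ?posrE//; apply: le_trans (ltW hN) _.
  by rewrite ler_nat leqW.
have [n cn] : exists n : nat, c < n%:R.
  exists (Num.bound `|c|); rewrite (le_lt_trans (ler_norm c))//.
  by rewrite archi_boundP.
have [_] := ht n; apply; apply: op_bound_le (hc n).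
by rewrite (le_trans (ltW cn))// ler_nat.
Qed.

Lemma C0_bounded_on (B : R) : exists2 M : R, 1 <= M &
  forall t, 0 <= t <= B -> op_bound (T t) M.
Proof.
have [t0 [M [t00 M1 hM]]] := C0_bounded_near0.
have M0 : 0 <= M by lra.
have [N hN] : exists N : nat, `|B| / t0 < N%:R.
  by exists (Num.bound (`|B| / t0)); rewrite archi_boundP// divr_ge0// ltW.
suff hn n : forall t, 0 <= t <= n.+1%:R * t0 -> op_bound (T t) (M ^+ n.+1).
  exists (M ^+ N.+1); first by rewrite exprn_ege1.
  move=> t /andP[t_ge0 tB]; apply: hn; rewrite t_ge0 (le_trans tB)//.
  rewrite (le_trans (ler_norm B))// -ler_pdivrMr// (le_trans (ltW hN))//.
  by rewrite ler_nat.
elim: n => [|n ih] t; first by rewrite mul1r expr1; exact: hM.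
move=> /andP[t_ge0 tn]; have [tt0|t0t] := leP t t0.
  apply: op_bound_le (hM _ _); last by rewrite t_ge0.
  by rewrite exprS ler_peMr// exprn_ege1.
have -> : T t = T t0 \o T (t - t0).
  by rewrite -(C0_D hT) ?(ltW t00)// ?subr_ge0 ?ltW// addrC subrK.
rewrite exprS; apply: op_bound_comp => //; first by apply: hM; rewrite lexx ltW.
by apply: ih; rewrite subr_ge0 ltW//= lerBlDr -{2}[t0]mul1r -mulrDl natr1.
Qed.

End C0.

(** * Polynomials on the unit circle *)

Section Cis.
Context {R : realType}.
Implicit Types a b : R.

Definition cis a : R[i] := cos a +i* sin a.

Lemma cis0 : cis 0 = 1.
Proof. by rewrite /cis cos0 sin0. Qed.

Lemma cisD a b : cis (a + b) = cis a * cis b.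
Proof.
rewrite /cis cosD sinD; apply/eqP; rewrite eq_complex/= eqxx/=.
by rewrite addrC.
Qed.

Lemma rnorm_cis a : rnorm (cis a) = 1.
Proof. by rewrite rnormcE/= cos2Dsin2 sqrtr1. Qed.

Lemma cis_mulN a : cis a * cis (- a) = 1.
Proof. by rewrite -cisD subrr cis0. Qed.

Lemma cis_neq0 a : cis a != 0.
Proof.
by apply/eqP => h; have := rnorm_cis a; rewrite h rnorm0 => /esym/eqP; rewrite oner_eq0.
Qed.

Lemma cisN a : cis (- a) = (cis a)^-1.
Proof. by rewrite -[RHS]mulr1 -(cis_mulN a) mulKf// cis_neq0. Qed.

Lemma cisMn a n : cis (n%:R * a) = cis a ^+ n.
Proof.
elim: n => [|n ih]; first by rewrite mul0r cis0.
by rewrite -natr1 mulrDl mul1r cisD ih exprSr.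
Qed.

Lemma cis2pi : cis (2 * pi) = 1.
Proof. by rewrite /cis mulr_natl cos2pi sin2pi. Qed.

Lemma cis_lipschitz a b : rnorm (cis a - cis b) <= 2 * `|a - b|.
Proof.
wlog ab : a b / b <= a.
  move=> h; have [|/ltW ab] := leP b a; first exact: h.
  by rewrite rnormBC distrC h.
rewrite (le_trans (rnorm_le_ReIm _))//= mulr2n mulrDl mul1r.
move: ab; rewrite le_eqVlt => /orP[/eqP->|ab]; first by rewrite !subrr normr0 addr0.
apply: lerD.
  have [c _ ->] := @MVT R cos (fun x => - sin x) b a ab
    (fun x _ => is_derive_cos x) (continuous_subspaceT (@continuous_cos R)).
  by rewrite normrM ler_piMl// normrN sin_max.
have [c _ ->] := @MVT R sin cos b a ab (fun x _ => is_derive_sin x)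
  (continuous_subspaceT (@continuous_sin R)).
by rewrite normrM ler_piMl// cos_max.
Qed.

(** The angle 0 is excluded in favour of [2 * pi] because the angle is later divided by a frequency
    to give a positive time. *)
Lemma cis_surj (z : R[i]) : rnorm z = 1 ->
  exists2 a, 0 < a <= 2 * pi & z = cis a.
Proof.
case: z => x y; rewrite rnormcE/= => /(congr1 (fun u => u ^+ 2)).
rewrite sqr_sqrtr ?addr_ge0 ?sqr_ge0// expr1n => h.
have x1 : -1 <= x <= 1.
  have y2 := sqr_ge0 y; have x2 := sqr_ge0 x; apply/andP; split; nra.
have y2 : y ^+ 2 = 1 - x ^+ 2 by rewrite -h addrC addKr.
have pi0 := @pi_gt0 R.
have [y0|y0] := leP 0 y.
  have ac : cis (acos x) = x +i* y.
    by rewrite /cis acosK ?in_itv//= sin_acos// -y2 sqrtr_sqr ger0_norm.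
  have := acos_ge0 x1; rewrite le_eqVlt => /orP[/eqP a0|a0].
    exists (2 * pi); first by rewrite lexx andbT mulr_gt0.
    by rewrite cis2pi -ac -a0 cis0.
  exists (acos x) => //; rewrite a0/= (le_trans (acos_lepi x1))// ler_peMl//.
    exact: ltW.
  by rewrite ler1n.
exists (2 * pi - acos x).
  by apply/andP; split; have := acos_lepi x1; have := acos_ge0 x1; lra.
rewrite cisD cis2pi mul1r /cis cosN sinN acosK ?in_itv//= sin_acos// -y2.
by rewrite sqrtr_sqr ltr0_norm// opprK.
Qed.

Lemma rnorm_1Bcis a : rnorm (1 - cis a) = 2 * `|sin (a / 2)|.
Proof.
rewrite rnormcE/= sub0r sqrrN.
have -> : (1 - cos a) ^+ 2 + sin a ^+ 2 = (2 * sin (a / 2)) ^+ 2.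
  rewrite (sin2cos2 a).
  have -> : cos a = 1 - 2 * sin (a / 2) ^+ 2.
    by rewrite {1}(splitr a) cosD -!expr2 cos2sin2; ring.
  by ring.
by rewrite sqrtr_sqr normrM ger0_norm.
Qed.

Lemma cis_neq1 a : 0 < `|a| < 2 * pi -> cis a != 1.
Proof.
move=> /andP[a0 a2]; apply/eqP => h; have := rnorm_1Bcis a.
rewrite h subrr rnorm0 => /esym/eqP; rewrite mulf_eq0 pnatr_eq0/= normr_eq0.
have : 0 < sin (`|a| / 2).
  by rewrite sin_gt0_pi// divr_gt0//= ltr_pdivrMr// mulrC.
have [a_ge0|a_lt0] := leP 0 a; first by rewrite (ger0_norm a_ge0) => /gt_eqF ->.
by rewrite (ltr0_norm a_lt0) mulNr sinN oppr_gt0 => /lt_eqF ->.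
Qed.

(** Orthogonality of the characters of the cyclic group of order [L]: for distinct [m] and [k] the
    sum is geometric, its ratio being an [L]-th root of unity other than 1. *)
Lemma sum_cis (L m k : nat) : (m < L)%N -> (k < L)%N ->
  \sum_(j < L) cis (2 * pi / L%:R * (m%:R - k%:R) * j%:R) =
  (if m == k then L%:R else 0).
Proof.
move=> mL kL; have L0 : (0 < L%:R :> R) by rewrite ltr0n (leq_ltn_trans _ mL).
have [->|mk] := eqVneq m k.
  rewrite (eq_bigr (fun=> 1)) ?sumr_const ?card_ord// => j _.
  by rewrite subrr mulr0 mul0r cis0.
set w := 2 * pi / L%:R * (m%:R - k%:R).
rewrite (eq_bigr (fun j : 'I_L => cis w ^+ j)); last first.
  by move=> j _; rewrite mulrC cisMn.
have w1 : cis w != 1.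
  apply: cis_neq1; have mk0 : 0 < `|m%:R - k%:R : R|.
    by rewrite normr_gt0 subr_eq0 eqr_nat.
  have mkL : `|m%:R - k%:R : R| < L%:R.
    have hm : (m%:R < L%:R :> R) by rewrite ltr_nat.
    have hk : (k%:R < L%:R :> R) by rewrite ltr_nat.
    have m0 : (0 <= m%:R :> R) by [].
    have k0 : (0 <= k%:R :> R) by [].
    by rewrite ltr_norml; apply/andP; split; lra.
  have p0 := @pi_gt0 R.
  rewrite normrM ger0_norm; last by rewrite divr_ge0 ?mulr_ge0 ?pi_ge0// ltW.
  rewrite mulr_gt0 ?divr_gt0 ?mulr_gt0//=.
  by rewrite mulrAC ltr_pdivrMr// ltr_pM2l// mulr_gt0.
have := subrX1 (cis w) L; rewrite -cisMn.
have -> : cis (L%:R * w) = 1.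
  have -> : L%:R * w = m%:R * (2 * pi) - k%:R * (2 * pi).
    by rewrite /w; field; rewrite gt_eqF.
  by rewrite cisD cisN !(cisMn (2 * pi)) cis2pi !expr1n invr1 mulr1.
rewrite subrr => /esym/eqP; rewrite mulf_eq0 subr_eq0 (negbTE w1)/= => /eqP.
by [].
Qed.

End Cis.

Section PolyMaximum.
Context {R : realType}.
Implicit Types (f g : {poly R[i]}) (q : R).

Lemma expr_lt_eps (r e : R) : 0 <= r < 1 -> 0 < e ->
  exists N, forall n, (N <= n)%N -> r ^+ n < e.
Proof.
move=> /andP[r0 r1] e0.
have /cvgrPdist_lt /(_ e e0) [N _ hN] : (fun n => r ^+ n) @ \oo --> (0 : R).
  by apply: cvg_expr; rewrite ger0_norm.
exists N => n Nn; have := hN n Nn.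
by rewrite /= sub0r normrN ger0_norm// exprn_ge0.
Qed.

(** Cauchy's estimate without an integral: averaging over the [L]-th roots of unity with
    [L = size g] recovers each coefficient exactly. *)
Lemma coef_le_circle g q : (forall a, rnorm g.[cis a] <= q) ->
  forall k, rnorm g`_k <= q.
Proof.
move=> h k; have q0 : 0 <= q by apply: le_trans (h 0); exact: rnorm_ge0.
have [gk|kg] := leqP (size g) k; first by rewrite nth_default// rnorm0.
set L := size g in kg.
have L0 : (0 < L%:R :> R) by rewrite ltr0n (leq_ltn_trans _ kg).
pose h0 : R := 2 * pi / L%:R.
have eqk : \sum_(j < L) g.[cis (h0 * j%:R)] * cis (- (h0 * k%:R * j%:R)) =
    L%:R * g`_k.
  under eq_bigr => j _ do rewrite (@horner_coef_wide _ L)// mulr_suml.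
  rewrite exchange_big/=.
  rewrite (bigD1 (Ordinal kg))//= [X in _ + X]big1 ?addr0.
    rewrite (eq_bigr (fun=> g`_k)) ?sumr_const ?card_ord ?mulr_natl// => j _.
    by rewrite -mulrA -cisMn -cisD [X in cis X](_ : _ = 0) ?cis0 ?mulr1//; ring.
  move=> m mk; rewrite (eq_bigr (fun j : 'I_L =>
    g`_m * cis (h0 * (m%:R - k%:R) * j%:R))); last first.
    by move=> j _; rewrite -mulrA -cisMn -cisD; congr (_ * cis _); ring.
  rewrite -mulr_sumr /h0 sum_cis// ifN ?mulr0//.
have : rnorm (L%:R * g`_k) <= L%:R * q.
  rewrite -eqk (le_trans (rnorm_sum _ _ _ _))//.
  rewrite [leRHS](_ : _ = \sum_(j < L) q); last by rewrite sumr_const card_ord mulr_natl.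
  by apply: ler_sum => j _; rewrite rnormM rnorm_cis mulr1.
by rewrite rnormM rnorm_nat ler_pM2l.
Qed.

(** Inside the disc the coefficient bound loses a factor [(1 - rnorm z)^-1]. Applied to [f ^+ N] it
    loses the same factor, which is negligible after taking [N]-th roots. *)
Lemma poly_max_circle f q : (forall a, rnorm f.[cis a] <= q) ->
  forall z, rnorm z <= 1 -> rnorm f.[z] <= q.
Proof.
move=> h z; rewrite le_eqVlt => /orP[/eqP/cis_surj[a _ ->]//|z1].
have q0 : 0 <= q by apply: le_trans (h 0); exact: rnorm_ge0.
have bound N : rnorm f.[z] ^+ N * (1 - rnorm z) <= q ^+ N.
  rewrite -rnormX -horner_exp; set g := f ^+ N.
  have hg : forall k, rnorm g`_k <= q ^+ N.
    by apply: coef_le_circle => a; rewrite horner_exp rnormX lerXn2r// nnegrE rnorm_ge0.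
  apply: (@le_trans _ _ ((\sum_(i < size g) q ^+ N * rnorm z ^+ i) * (1 - rnorm z))).
    rewrite ler_wpM2r//; first by rewrite subr_ge0 ltW.
    rewrite horner_coef (le_trans (rnorm_sum _ _ _ _))//; apply: ler_sum => i _.
    by rewrite rnormM rnormX ler_wpM2r// exprn_ge0// rnorm_ge0.
  rewrite -mulr_sumr -mulrA mulrC ler_piMl ?exprn_ge0//.
  rewrite mulrC -opprB mulNr -subrX1 opprB gerBl exprn_ge0// rnorm_ge0//.
rewrite leNgt; apply/negP => qf.
have f0 : 0 < rnorm f.[z] by exact: le_lt_trans qf.
have rho : 0 <= q / rnorm f.[z] < 1.
  by rewrite divr_ge0//= ?ltr_pdivrMr ?mul1r// ltW.
have z1' : 0 < 1 - rnorm z by rewrite subr_gt0.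
have [N /(_ N (leqnn N))] := expr_lt_eps _ _ rho z1'.
rewrite expr_div_n ltr_pdivrMr ?exprn_gt0// mulrC ltNge => /negP; apply.
exact: bound.
Qed.

End PolyMaximum.

(** * Fourier coefficients of a truncated orbit *)

Section Bump.
Context {R : realType}.
Implicit Types (u v t b l : R) (psi : R -> R).

Definition bdiff t psi u := psi u - psi (u - t).

Definition cube_pos u : R := Num.max u 0 ^+ 3.

(* The cubic B-spline with knots 0, pi/2, ..., 2 pi. *)
Definition bspline u : R :=
  cube_pos u - 4 * cube_pos (u - pi / 2) + 6 * cube_pos (u - pi)
  - 4 * cube_pos (u - 3 * pi / 2) + cube_pos (u - 2 * pi).

(** Support in [[0, b]] and Lipschitz constant [l] are all that the Riemann sums use, and [bdiff]
    preserves such a control. *)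
Definition bump b l psi : Prop :=
  [/\ forall u, u <= 0 -> psi u = 0, forall u, b <= u -> psi u = 0 &
      forall u v, `|psi u - psi v| <= l * `|u - v|].

Lemma bump_bdiff b l t psi : 0 <= t -> bump b l psi ->
  bump (b + t) (2 * l) (bdiff t psi).
Proof.
move=> t0 [h1 h2 h3]; split => [u u0|u bu|u v]; rewrite /bdiff.
- by rewrite !h1 ?subrr//; lra.
- by rewrite !h2 ?subrr//; lra.
rewrite [X in `|X|](_ : _ = (psi u - psi v) + (psi (v - t) - psi (u - t)));
  last by ring.
apply: (le_trans (ler_normD _ _)); rewrite mulr2n !mulrDl mul1r.
apply: lerD; first by rewrite h3.
by have := h3 (v - t) (u - t); rewrite distrC opprB addrA subrK (distrC v u).
Qed.

Lemma cube_pos_ge0 u : 0 <= u -> cube_pos u = u ^+ 3.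
Proof. by move=> u0; rewrite /cube_pos max_l. Qed.

Lemma cube_pos_le0 u : u <= 0 -> cube_pos u = 0.
Proof. by move=> u0; rewrite /cube_pos max_r// expr0n. Qed.

Lemma cube_pos_bounds u c : u <= c -> 0 <= c -> 0 <= cube_pos u <= c ^+ 3.
Proof.
move=> uc c0; rewrite /cube_pos exprn_ge0 ?le_max ?lexx ?orbT//=.
by rewrite lerXn2r ?nnegrE// ?le_max ?lexx ?orbT// ge_max uc.
Qed.

Lemma cube_pos_lipschitz c u v : u <= c -> v <= c -> 0 <= c ->
  `|cube_pos u - cube_pos v| <= 3 * c ^+ 2 * `|u - v|.
Proof.
move=> uc vc c0.
have aux (x y : R) : 0 <= x <= c -> 0 <= y <= c ->
    `|x ^+ 3 - y ^+ 3| <= 3 * c ^+ 2 * `|x - y|.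
  move=> /andP[x0 xc] /andP[y0 yc].
  have -> : x ^+ 3 - y ^+ 3 = (x ^+ 2 + x * y + y ^+ 2) * (x - y) by ring.
  rewrite normrM ler_wpM2r// ger0_norm; last by rewrite !addr_ge0// ?mulr_ge0// sqr_ge0.
  nra.
apply: (le_trans (aux _ _ _ _)).
- by rewrite le_max lexx orbT ge_max uc c0.
- by rewrite le_max lexx orbT ge_max vc c0.
rewrite ler_wpM2l ?mulr_ge0 ?sqr_ge0//.
rewrite /Num.max; case: ifPn => u0; case: ifPn => v0; rewrite ?subrr ?normr0//.
- by move: v0; rewrite -leNgt => v0; rewrite (distrC 0) (distrC u) !ger0_norm; lra.
- by move: u0; rewrite -leNgt => u0; rewrite subr0 !ger0_norm; lra.
Qed.

Lemma bspline_le0 u : u <= 0 -> bspline u = 0.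
Proof.
have p0 := @pi_gt0 R.
by move=> u0; rewrite /bspline !cube_pos_le0; lra.
Qed.

Lemma bspline_ge2pi u : 2 * pi <= u -> bspline u = 0.
Proof.
have p0 := @pi_gt0 R.
by move=> u0; rewrite /bspline !cube_pos_ge0; lra.
Qed.

(** The truncated cubes are Lipschitz only on half-lines bounded above; clamping at [2 * pi], beyond
    which the spline vanishes, reduces to that case. *)
Lemma bspline_clamp u : bspline u = bspline (Num.min u (2 * pi)).
Proof.
rewrite /Num.min; case: ifPn => //; rewrite -leNgt => h.
by rewrite !bspline_ge2pi.
Qed.

Lemma bspline_pi : bspline pi = pi ^+ 3 / 2.
Proof.
have p0 := @pi_gt0 R.
rewrite /bspline ?(cube_pos_le0 (pi - 2 * pi))
  ?(cube_pos_le0 (pi - 3 * pi / 2)) ?cube_pos_ge0; lra.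
Qed.

(** 48 is 3 * 16: the weights 1, 4, 6, 4, 1 add up to 16, and a cube has slope at most
    [3 * (2 * pi) ^+ 2] up to [2 * pi]. *)
Definition bspline_lip : R := 48 * (2 * pi) ^+ 2.

Lemma bspline_bump : bump (2 * pi) bspline_lip bspline.
Proof.
have p0 := @pi_gt0 R.
split; [exact: bspline_le0|exact: bspline_ge2pi|move=> u v].
rewrite (bspline_clamp u) (bspline_clamp v).
set u' := Num.min u _; set v' := Num.min v _.
have u'2 : u' <= 2 * pi by rewrite ge_min lexx orbT.
have v'2 : v' <= 2 * pi by rewrite ge_min lexx orbT.
have uv : `|u' - v'| <= `|u - v|.
  rewrite /u' /v' /Num.min; case: ifPn => h1; case: ifPn => h2; rewrite -?leNgt in h1 h2.
  - by [].
  - by rewrite distrC (distrC u) !ger0_norm; lra.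
  - by rewrite !ger0_norm; lra.
  - by rewrite subrr normr0.
have p2 : 0 <= 2 * pi :> R by lra.
have h (a : R) : 0 <= a -> `|cube_pos (u' - a) - cube_pos (v' - a)| <=
    3 * (2 * pi) ^+ 2 * `|u - v|.
  move=> a0; apply: le_trans (cube_pos_lipschitz (2 * pi) _ _ _ _ _) _; try lra.
  by rewrite opprB addrA subrK ler_wpM2l// mulr_ge0// sqr_ge0.
have h0 := h 0 (lexx _); rewrite !subr0 in h0.
have h1 := h (pi / 2); have h2 := h pi; have h3 := h (3 * pi / 2).
have h4 := h (2 * pi).
rewrite /bspline_lip.
move: h0 (h1 ltac:(lra)) (h2 ltac:(lra)) (h3 ltac:(lra)) (h4 ltac:(lra)) => {h h1 h2 h3 h4}.
rewrite /bspline !ler_norml.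
set A := (2 * pi) ^+ 2 * `|u - v|.
have -> : 48 * (2 * pi) ^+ 2 * `|u - v| = 48 * A by rewrite /A mulrA.
have -> : 3 * (2 * pi) ^+ 2 * `|u - v| = 3 * A by rewrite /A mulrA.
move=> /andP[? ?] /andP[? ?] /andP[? ?] /andP[? ?] /andP[? ?].
by apply/andP; split; lra.
Qed.

(** From [3 * t] on, the third difference of the cube is exactly [6 * t ^+ 3]. Before that, each
    truncated cube is at most [27 * t ^+ 3] and the weights 1, 3, 3, 1 add up to 8. *)
Lemma bdiff3_cube_pos t u : 0 <= t ->
  `|bdiff t (bdiff t (bdiff t cube_pos)) u| <= 216 * t ^+ 3.
Proof.
move=> t0; rewrite /bdiff.
have t3 : 0 <= t ^+ 3 by rewrite exprn_ge0.
have [u3|u3] := leP (3 * t) u.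
  rewrite !cube_pos_ge0; try lra.
  rewrite [X in `|X|](_ : _ = 6 * t ^+ 3); last by ring.
  by rewrite ger0_norm ?mulr_ge0// ler_wpM2r// ler_nat.
have t30 : 0 <= 3 * t by lra.
have /andP[? h0] := cube_pos_bounds u (3 * t) ltac:(lra) t30.
have /andP[? h1] := cube_pos_bounds (u - t) (3 * t) ltac:(lra) t30.
have /andP[? h2] := cube_pos_bounds (u - t - t) (3 * t) ltac:(lra) t30.
have /andP[? h3] := cube_pos_bounds (u - t - t - t) (3 * t) ltac:(lra) t30.
have e : (3 * t) ^+ 3 = 27 * t ^+ 3 by ring.
rewrite e in h0 h1 h2 h3.
by rewrite ler_norml; apply/andP; split; lra.
Qed.

(** 3456 is 16 * 216: differences commute with the translations that build the spline. *)
Lemma bdiff3_bspline t u : 0 <= t ->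
  `|bdiff t (bdiff t (bdiff t bspline)) u| <= 3456 * t ^+ 3.
Proof.
move=> t0; have h v := bdiff3_cube_pos t v t0.
have h0 := h u; have h1 := h (u - pi / 2); have h2 := h (u - pi).
have h3 := h (u - 3 * pi / 2); have h4 := h (u - 2 * pi).
have sw (a b : R) : u - a - b = u - b - a by lra.
move: h0 h1 h2 h3 h4; rewrite /bdiff /bspline !ler_norml.
rewrite !(fun a => addrAC u (- a) (- t)).
rewrite !(fun a => addrAC (u - t) (- a) (- t)).
rewrite !(fun a => addrAC (u - t - t) (- a) (- t)).
move=> /andP[? ?] /andP[? ?] /andP[? ?] /andP[? ?] /andP[? ?].
by apply/andP; split; lra.
Qed.

End Bump.

(** * Riemann sums under translation *)

Section RiemannSums.
Context {R : realType} {V : normedModType R[i]}.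
Implicit Types (G : R -> V).

Lemma sum_shift (F : nat -> V) (n p : nat) :
  (forall i, (i < p)%N -> F i = 0) -> (forall i, (n <= i)%N -> F i = 0) ->
  \sum_(j < n) F (j + p)%N = \sum_(j < n) F j.
Proof.
move=> hp hn.
have e1 : \sum_(0 <= i < n + p) F i = \sum_(j < n) F (j + p)%N.
  rewrite (big_cat_nat (n := p))//= ?leq_addl//.
  rewrite big_nat_cond big1 ?add0r; last by move=> i /andP[/andP[_ ip] _]; exact: hp.
  by rewrite -{1}[p]add0n big_addn addnK big_mkord.
have e2 : \sum_(0 <= i < n + p) F i = \sum_(j < n) F j.
  rewrite (big_cat_nat (n := n))//= ?leq_addr// big_mkord.
  rewrite [X in _ + X]big_nat_cond [X in _ + X]big1 ?addr0//.
  by move=> i /andP[/andP[ni _] _]; exact: hn.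
by rewrite -e1 e2.
Qed.

(** The shift [t] need not be a multiple of the step [h]. Its [p] full steps only reindex the sum;
    the remainder, less than [h], costs one oscillation of [G] per node. *)
Lemma riemann_sum_shift G (h t B e : R) (n : nat) : 0 < h -> 0 <= t ->
  (forall u, u <= t -> G u = 0) -> (forall u, B <= u -> G u = 0) ->
  B <= n%:R * h ->
  (forall u r, 0 <= u -> 0 <= r <= h -> rnorm (G (u + r) - G u) <= e) ->
  rnorm (h%:C *: \sum_(j < n) G (j%:R * h + t) - h%:C *: \sum_(j < n) G (j%:R * h))
    <= n%:R * h * e.
Proof.
move=> h0 t0 Gt GB Bn osc.
set p := Num.truncn (t / h).
have /andP[pt tp] : p%:R * h <= t < p.+1%:R * h.
  by rewrite -ler_pdivlMr// -ltr_pdivrMr//; apply: truncn_itv; rewrite divr_ge0// ltW.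
rewrite -scalerBr rnormZ rnormR gtr0_norm// mulrAC mulrC ler_wpM2r ?(ltW h0)//.
have <- : \sum_(j < n) G ((j + p)%:R * h) = \sum_(j < n) G (j%:R * h).
  apply: (sum_shift (fun j => G (j%:R * h))) => i hi.
    by apply: Gt; rewrite (le_trans _ pt)// ler_pM2r// ler_nat ltnW.
  by apply: GB; rewrite (le_trans Bn)// ler_pM2r// ler_nat.
rewrite -sumrB (le_trans (rnorm_sum _ _ _ _))//.
rewrite [leRHS](_ : _ = \sum_(j < n) e); last by rewrite sumr_const card_ord mulr_natl.
apply: ler_sum => j _.
have -> : j%:R * h + t = (j + p)%:R * h + (t - p%:R * h) by rewrite natrD; ring.
apply: osc; first by rewrite mulr_ge0// ltW.
rewrite subr_ge0 pt/= lerBlDl; move: tp; rewrite -natr1 mulrDl mul1r.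
exact: ltW.
Qed.

End RiemannSums.

Section FourierCoefficients.
Context {R : realType} {X : completeNormedModType R[i]} (U : R -> X -> X)
  (hU : C0_semigroup U) (M : R) (M1 : 1 <= M)
  (hM : forall s, 0 <= s <= 30 * pi -> op_bound (U s) M).
Implicit Types (psi : R -> R) (eta : R) (x : X).

Let M0 : 0 <= M. Proof. by apply: le_trans M1. Qed.

Definition modulated psi eta x u : X := ((psi u)%:C * cis (- (eta * u))) *: U u x.

(** The [13 * L] nodes fill [[0, 26 * pi]]: the support of the spline, of length [2 * pi], plus
    three shifts by at most [8 * pi]. *)
Definition fourier_sum (L : nat) psi eta x : X :=
  (2 * pi / L%:R)%:C *: \sum_(j < 13 * L) modulated psi eta x (j%:R * (2 * pi / L%:R)).

Lemma bump_lip_ge0 (b l : R) psi : bump b l psi -> 0 <= l.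
Proof.
by case=> _ _ /(_ 1 0); rewrite subr0 normr1 mulr1; apply: le_trans.
Qed.

Lemma bump_bound (b l : R) psi u : 0 <= b -> bump b l psi -> `|psi u| <= l * b.
Proof.
move=> b0 hb; have l0 := bump_lip_ge0 _ _ _ hb; case: hb => h1 h2 h3.
have [u0|u0] := leP u 0; first by rewrite h1// normr0 mulr_ge0.
have [bu|ub] := leP b u; first by rewrite h2// normr0 mulr_ge0.
have := h3 u 0; rewrite (h1 0)// !subr0 => /le_trans; apply.
by rewrite ler_wpM2l// gtr0_norm// ltW.
Qed.

(** Continuity of the orbit at 0 is carried to every [u] by the bound on [U u], so that [d] does not
    depend on [u]. *)
Lemma modulated_osc (b l : R) psi eta x (e : R) :
  0 <= b <= 26 * pi -> bump b l psi -> 0 < e ->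
  exists2 d : R, 0 < d & forall u r, 0 <= u -> 0 <= r <= d ->
    rnorm (modulated psi eta x (u + r) - modulated psi eta x u) <= e.
Proof.
move=> /andP[b0 b26] hb e0; have l0 := bump_lip_ge0 _ _ _ hb.
have psib u := bump_bound _ _ _ u b0 hb.
have p0 := @pi_gt0 R.
set nx := rnorm x; have nx0 : 0 <= nx by exact: rnorm_ge0.
set A := l * M * nx + l * b * (2 * `|eta|) * (M * nx) + 1.
have A0 : 0 < A by rewrite ltr_wpDl// addr_ge0 ?mulr_ge0.
set B := l * b * M + 1; have B0 : 0 < B by rewrite ltr_wpDl ?mulr_ge0.
have [d1 d10 hd1] := C0_at0 hU x (e / 2 / B) ltac:(by rewrite !divr_gt0).
exists (Num.min d1 (Num.min (e / 2 / A) pi)).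
  by rewrite !lt_min d10 p0 !divr_gt0.
move=> u r u0; rewrite !le_min => /andP[r0 /and3P[rd rA rp]].
case: hb => h1 h2 h3.
have [u26|u26] := leP (26 * pi) u.
  by rewrite /modulated !h2 ?mul0r ?scale0r ?subrr ?rnorm0 ?(ltW e0); lra.
set c1 := cis (- (eta * (u + r))); set c0 := cis (- (eta * u)).
(* Three factors change between [u] and [u + r]: the cut-off, the modulation and the orbit. The
   first two changes are linear in [r] and collected in [A]; the third has the weight [B]. *)
have -> : modulated psi eta x (u + r) - modulated psi eta x u =
   ((psi (u + r) - psi u)%:C * c1) *: U (u + r) x +
   ((psi u)%:C * (c1 - c0)) *: U (u + r) x +
   ((psi u)%:C * c0) *: (U u (U r x - x)).
  rewrite (linear_subr (C0_linear hU _ u0)) -C0_add// /modulated -/c0 -/c1.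
  rewrite scalerBr addrA -!scalerDl; congr (_ *: _ - _).
  by rewrite rmorphB/=; ring.
have bU s y : 0 <= s <= 30 * pi -> rnorm (U s y) <= M * rnorm y by move=> hs; exact: hM.
have ur : 0 <= u + r <= 30 * pi by apply/andP; split; lra.
have uu : 0 <= u <= 30 * pi by apply/andP; split; lra.
have t1 : rnorm (((psi (u + r) - psi u)%:C * c1) *: U (u + r) x) <= l * r * (M * nx).
  rewrite rnormZ rnormM rnorm_cis mulr1 rnormR ler_pM ?rnorm_ge0 ?bU//.
  by rewrite (le_trans (h3 _ _))// addrC addKr ger0_norm.
have t2 : rnorm (((psi u)%:C * (c1 - c0)) *: U (u + r) x) <=
    l * b * (2 * `|eta| * r) * (M * nx).
  rewrite rnormZ rnormM rnormR ler_pM ?mulr_ge0 ?rnorm_ge0 ?bU//.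
  rewrite ler_pM ?rnorm_ge0// (le_trans (cis_lipschitz _ _))// -mulrA ler_wpM2l//.
  rewrite [X in `|X|](_ : _ = - eta * r); last by ring.
  by rewrite normrM normrN (ger0_norm r0).
have t3 : rnorm (((psi u)%:C * c0) *: U u (U r x - x)) <= l * b * (M * (e / 2 / B)).
  rewrite rnormZ rnormM rnorm_cis mulr1 rnormR ler_pM ?rnorm_ge0//.
  by rewrite (le_trans (bU _ _ uu))// ler_wpM2l// hd1// r0.
apply: le_trans (rnormD _ _) _.
apply: le_trans (lerD (le_trans (rnormD _ _) (lerD t1 t2)) t3) _.
rewrite [leRHS]splitr; apply: lerD.
  apply: (@le_trans _ _ (A * r)); last by rewrite mulrC -ler_pdivlMr.
  by rewrite /A; lra.
rewrite mulrA -[leRHS](divfK (lt0r_neq0 B0)) mulrC ler_wpM2l//.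
  by rewrite divr_ge0 ?ltW// divr_gt0.
by rewrite /B lerDl.
Qed.

End FourierCoefficients.

Lemma archi_gt {R : realType} (c : R) : exists N : nat, c < N%:R.
Proof.
exists (Num.bound `|c|); rewrite (le_lt_trans (ler_norm c))//.
by rewrite archi_boundP.
Qed.

Section FourierDecay.
Context {R : realType} {X : completeNormedModType R[i]} (U : R -> X -> X)
  (hU : C0_semigroup U) (M : R) (M1 : 1 <= M)
  (hM : forall s, 0 <= s <= 30 * pi -> op_bound (U s) M).
Implicit Types (psi : R -> R) (eta : R) (x : X).

Let M0 : 0 <= M. Proof. by apply: le_trans M1. Qed.

Lemma bump_shift (b l t : R) psi : 0 <= t -> bump b l psi ->
  bump (b + t) l (fun u => psi (u - t)).
Proof.
move=> t0 [h1 h2 h3]; split=> [u ut|u ut|u v].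
- by rewrite h1//; lra.
- by rewrite h2//; lra.
- by rewrite (le_trans (h3 _ _))// opprB addrA subrK.
Qed.

(* Applying [U t] to the Riemann sum shifts its argument by [t], and the factor
   [xi^-1 = cis (- eta * t)] keeps the modulation unchanged. *)
Lemma fourier_sum_step (b l t eta K : R) psi x (xi : R[i]) (e : R) :
  0 <= b -> 0 < t -> b + t <= 26 * pi -> bump b l psi ->
  xi = cis (eta * t) -> 0 <= K ->
  (forall y, rnorm y <= K * rnorm (y - xi^-1 *: U t y)) -> 0 < e ->
  exists L0 : nat, forall L, (L0 <= L)%N -> (0 < L)%N ->
    rnorm (fourier_sum U L psi eta x) <=
    K * (rnorm (fourier_sum U L (bdiff t psi) eta x) + e).
Proof.
move=> b0 t0 bt hb xiE K0 hK e0.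
have p0 := @pi_gt0 R.
have hbs := bump_shift _ _ _ _ (ltW t0) hb.
have bt26 : 0 <= b + t <= 26 * pi by rewrite bt andbT addr_ge0// ltW.
have e0' : 0 < e / (26 * pi) by rewrite divr_gt0// mulr_gt0.
have [d d0 hd] := modulated_osc _ hU _ M1 hM _ _ _ eta x _ bt26 hbs e0'.
have [L0 hL0] := archi_gt (2 * pi / d).
exists L0 => L L0L L_gt0.
have LR : 0 < (L%:R : R) by rewrite ltr0n.
have dL : 2 * pi / L%:R <= d.
  rewrite ler_pdivrMr// -ler_pdivrMl// mulrC (le_trans (ltW hL0))//.
  by rewrite ler_nat.
set h := 2 * pi / L%:R in dL *.
have h0 : 0 < h by rewrite divr_gt0// mulr_gt0.
have nh : (13 * L)%:R * h = 26 * pi by rewrite /h natrM; field; rewrite gt_eqF.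
set G := modulated U (fun u => psi (u - t)) eta x.
case: (hb) => hb1 hb2 hb3.
have := riemann_sum_shift G h t (26 * pi) (e / (26 * pi)) (13 * L) h0 (ltW t0).
rewrite nh lexx [26 * pi * (e / _)]mulrC divfK ?gt_eqF ?mulr_gt0//.
have G0 u : u <= t -> G u = 0.
  by move=> ut; rewrite /G /modulated hb1 ?mul0r ?scale0r//; lra.
have GB u : 26 * pi <= u -> G u = 0.
  by move=> ut; rewrite /G /modulated hb2 ?mul0r ?scale0r//; lra.
move=> /(_ G0 GB isT) hG.
have {}hG := hG ltac:(move=> u r u0 /andP[r0 rh]; apply: hd => //; by rewrite r0 (le_trans rh)).
set y := fourier_sum U L psi eta x.
have shiftE : xi^-1 *: U t y = h%:C *: \sum_(j < 13 * L) G (j%:R * h + t).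
  have lU := C0_linear hU _ (ltW t0).
  rewrite /y /fourier_sum -/h (linear_scale lU) (linear_bigsum lU) scalerA mulrC -scalerA.
  congr (_ *: _); rewrite scaler_sumr; apply: eq_bigr => j _.
  have jh : 0 <= j%:R * h by rewrite mulr_ge0// ltW.
  rewrite /G /modulated (linear_scale lU) scalerA addrK addrC C0_add ?(ltW t0)//.
  congr (_ *: _); rewrite xiE -cisN mulrCA -cisD; congr (_ * cis _); ring.
have diffE : fourier_sum U L (bdiff t psi) eta x =
    y - h%:C *: \sum_(j < 13 * L) G (j%:R * h).
  rewrite /y /fourier_sum -/h -scalerBr -sumrB; congr (_ *: _).
  by apply: eq_bigr => j _; rewrite /modulated /bdiff rmorphB mulrBl scalerBl.
rewrite (le_trans (hK y))// ler_wpM2l// shiftE diffE.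
set A := h%:C *: _ in hG *; set A' := h%:C *: _ in hG *.
have -> : y - A = y - A' - (A - A') by rewrite opprB addrA subrK.
by rewrite (le_trans (rnormB _ _))// lerD2l.
Qed.

Lemma fourier_sum_bound (psi : R -> R) eta x (c : R) (L : nat) :
  (0 < L)%N -> (forall u, `|psi u| <= c) ->
  rnorm (fourier_sum U L psi eta x) <= 26 * pi * (c * (M * rnorm x)).
Proof.
move=> L0 hc; have p0 := @pi_gt0 R.
have LR : 0 < (L%:R : R) by rewrite ltr0n.
rewrite /fourier_sum; set h := 2 * pi / L%:R.
have h0 : 0 < h by rewrite divr_gt0// mulr_gt0.
have nh : (13 * L)%:R * h = 26 * pi by rewrite /h natrM; field; rewrite gt_eqF.
rewrite -nh rnormZ rnormR gtr0_norm//; clearbody h; rewrite (mulrC _%:R) -mulrA.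
rewrite ler_wpM2l ?(ltW h0)// (le_trans (rnorm_sum _ _ _ _))//.
rewrite mulr_natl -[X in _ <= _ *+ X]card_ord -sumr_const.
apply: ler_sum => j _; rewrite rnormZ rnormM rnorm_cis mulr1 rnormR.
rewrite ler_pM ?rnorm_ge0// hM// mulr_ge0 ?(ltW h0)//= (@le_trans _ _ (26 * pi))//.
  by rewrite -nh ler_pM2r// ler_nat ltnW.
by rewrite ler_pM2r// ler_nat.
Qed.

(** The first summand bounds the third difference of the spline when [t * |eta| <= 4 * pi], with one
    factor [K] per step; the others collect the discretisation errors of the three steps. *)
Definition decay_const (K : R) : R :=
  K ^+ 3 * (26 * pi * (3456 * (4 * pi) ^+ 3 * M)) + K + K ^+ 2 + K ^+ 3.

Lemma bspline_fourier_decay (t eta K : R) x (xi : R[i]) :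
  0 < t <= 8 * pi -> t * `|eta| <= 4 * pi -> 0 < `|eta| ->
  xi = cis (eta * t) -> 0 <= K ->
  (forall y, rnorm y <= K * rnorm (y - xi^-1 *: U t y)) ->
  exists L0 : nat, forall L, (L0 <= L)%N -> (0 < L)%N ->
    rnorm (fourier_sum U L bspline eta x) <=
    decay_const K * rnorm x / `|eta| ^+ 3.
Proof.
move=> /andP[t0 t8] teta eta0 xiE K0 hK.
have p0 := @pi_gt0 R.
have [->|x0] := eqVneq x 0.
  exists 0%N => L _ _; rewrite rnorm0 mulr0 mul0r /fourier_sum big1 ?scaler0 ?rnorm0//.
  move=> j _; rewrite /modulated (linear_zero (C0_linear hU _ _)) ?scaler0//.
  by rewrite mulr_ge0// divr_ge0// mulr_ge0// ltW.
have nx : 0 < rnorm x.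
  by rewrite lt_neqAle rnorm_ge0 andbT eq_sym; apply: contra x0 => /eqP/rnorm_eq0/eqP.
(* The error allowed at each step has the order of the bound to be proved. It must be positive,
   hence the separate case [x = 0]. *)
set e := rnorm x / `|eta| ^+ 3.
have e0 : 0 < e by rewrite divr_gt0// exprn_gt0.
have h0 := @bspline_bump R.
have h1 := bump_bdiff _ _ _ _ (ltW t0) h0.
have h2 := bump_bdiff _ _ _ _ (ltW t0) h1.
have b0 : 0 <= 2 * pi :> R by lra.
have b1 : 0 <= 2 * pi + t by lra.
have b2 : 0 <= 2 * pi + t + t by lra.
have c0 : 2 * pi + t <= 26 * pi by lra.
have c1 : 2 * pi + t + t <= 26 * pi by lra.
have c2 : 2 * pi + t + t + t <= 26 * pi by lra.
have [L1 H1] := fourier_sum_step _ _ _ _ _ _ x _ _ b0 t0 c0 h0 xiE K0 hK e0.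
have [L2 H2] := fourier_sum_step _ _ _ _ _ _ x _ _ b1 t0 c1 h1 xiE K0 hK e0.
have [L3 H3] := fourier_sum_step _ _ _ _ _ _ x _ _ b2 t0 c2 h2 xiE K0 hK e0.
exists (maxn L1 (maxn L2 L3)) => L; rewrite !geq_max => /and3P[l1 l2 l3] L0.
have {}H1 := H1 L l1 L0; have {}H2 := H2 L l2 L0; have {}H3 := H3 L l3 L0.
have H4 := fourier_sum_bound _ eta x _ L L0 (fun u => bdiff3_bspline t u (ltW t0)).
apply: (le_trans H1).
apply: (@le_trans _ _ (K * (K * (K * (26 * pi * (3456 * t ^+ 3 * (M * rnorm x)) + e) + e) + e))).
  rewrite ler_wpM2l// lerD2r (le_trans H2)// ler_wpM2l// lerD2r (le_trans H3)//.
  by rewrite ler_wpM2l// lerD2r.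
have : t ^+ 3 <= (4 * pi) ^+ 3 / `|eta| ^+ 3.
  rewrite ler_pdivlMr ?exprn_gt0// -exprMn lerXn2r// nnegrE mulr_ge0//; exact: ltW.
move=> t3.
rewrite [leRHS](_ : _ = K * (K * (K * (26 * pi * (3456 * ((4 * pi) ^+ 3 / `|eta| ^+ 3) * (M * rnorm x)) + e) + e) + e)).
  do 3! (rewrite ler_wpM2l// lerD2r).
  apply: ler_wpM2l; first by rewrite mulr_ge0// ltW.
  apply: ler_wpM2r; first by rewrite mulr_ge0// ltW.
  by rewrite (ler_wpM2l (ler0n _ _) t3).
rewrite /decay_const /e; move: (26 * pi) (3456 : R) ((4 * pi) ^+ 3) => a b c.
by field; rewrite gt_eqF.
Qed.

End FourierDecay.

(** * Fejér summation *)

Section FejerKernel.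
Context {R : realType}.
Implicit Types (u tau : R) (N L : nat).

Lemma sin_ge (r y : R) : 0 <= r <= pi / 2 -> r <= y <= pi - r -> sin r <= sin y.
Proof.
have p0 := @pi_gt0 R.
move=> /andP[r0 r2].
have aux z : r <= z -> z <= pi / 2 -> sin r <= sin z.
  move=> rz z2; rewrite leNgt ltr_sin -?leNgt// in_itv/=; apply/andP; split; lra.
move=> /andP[ry yr]; have [y2|y2] := leP y (pi / 2); first exact: aux.
have -> : sin y = sin (pi - y) by rewrite sinB sinpi cospi mul0r sub0r mulN1r opprK.
by apply: aux; lra.
Qed.

Definition dirichlet N u : R[i] := \sum_(p < N) cis (p%:R * u).

Definition fejer_kernel N u : R := rnorm (dirichlet N u) ^+ 2 / N%:R.

Lemma conj_cis u : (cis u)^*%C = cis (- u).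
Proof. by rewrite /cis cosN sinN. Qed.

Lemma rnorm_sqr (z : R[i]) : (rnorm z ^+ 2)%:C = z * z^*%C.
Proof. by rewrite rmorphXn/= -rnormE sqr_normc. Qed.

Lemma fejer_kernelE N u : (fejer_kernel N u)%:C =
  (N%:R^-1)%:C * \sum_(p < N) \sum_(q < N) cis ((p%:R - q%:R) * u).
Proof.
rewrite /fejer_kernel rmorphM/= rnorm_sqr mulrC; congr (_ * _).
rewrite /dirichlet rmorph_sum big_distrlr; apply: eq_bigr => p _.
apply: eq_bigr => q _; transitivity (cis (p%:R * u) * cis (- (q%:R * u))).
  by congr (_ * _); exact: conj_cis.
by rewrite -cisD; congr cis; ring.
Qed.

Lemma fejer_kernel_ge0 N u : 0 <= fejer_kernel N u.
Proof. by rewrite divr_ge0// exprn_ge0// rnorm_ge0. Qed.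

(** The grid sum equals the integral mean because [N <= L]: two frequencies below [N] that agree
    modulo [L] are equal. *)
Lemma fejer_kernel_sum N L tau : (0 < N)%N -> (N <= L)%N ->
  \sum_(j < L) fejer_kernel N (tau - j%:R * (2 * pi / L%:R)) = L%:R.
Proof.
move=> N0 NL; apply: (@complexI R); rewrite rmorph_sum/=.
under eq_bigr do rewrite fejer_kernelE.
rewrite -mulr_sumr exchange_big/=.
rewrite (eq_bigr (fun=> L%:R)); last first.
  move=> p _; rewrite exchange_big/= (bigD1 p)//= [X in _ + X]big1 ?addr0.
    rewrite (eq_bigr (fun=> 1)) ?sumr_const ?card_ord// => j _.
    by rewrite subrr mul0r cis0.
  move=> q qp; rewrite (eq_bigr (fun j : 'I_L => cis ((p%:R - q%:R) * tau) *
     cis (2 * pi / L%:R * (q%:R - p%:R) * j%:R))).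
    rewrite -mulr_sumr sum_cis ?(leq_trans (ltn_ord _) NL)//.
    by rewrite ifN ?mulr0//.
  by move=> j _; rewrite -cisD; congr cis; ring.
rewrite sumr_const card_ord -(mulr_natl L%:R N) mulrA -(rmorph_nat (real_complex R) N).
rewrite -rmorphM/= mulVf ?pnatr_eq0 -?lt0n// rmorph1 mul1r.
by rewrite rmorph_nat.
Qed.

Lemma fejer_kernel_far N u : (0 < N)%N -> sin (u / 2) != 0 ->
  fejer_kernel N u <= 1 / (N%:R * sin (u / 2) ^+ 2).
Proof.
move=> N0 s0.
have NR : 0 < (N%:R : R) by rewrite ltr0n.
have h : dirichlet N u * (1 - cis u) = 1 - cis (N%:R * u).
  have -> : dirichlet N u = \sum_(p < N) cis u ^+ p.
    by apply: eq_bigr => p _; rewrite cisMn.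
  by rewrite mulrC -(opprB (cis u)) mulNr -subrX1 opprB cisMn.
have hn : rnorm (dirichlet N u) * `|sin (u / 2)| <= 1.
  rewrite -(@ler_pM2l _ 2)// mulr1 mulrCA -rnorm_1Bcis -rnormM h.
  by rewrite (le_trans (rnormB _ _))// rnorm1 rnorm_cis.
have sn : 0 < sin (u / 2) ^+ 2 by rewrite exprn_even_gt0.
rewrite /fejer_kernel ler_pdivrMr// mul1r invfM mulrAC mulVf ?gt_eqF// mul1r.
rewrite -[_^-1]mul1r ler_pdivlMr// -(real_normK (num_real (sin _))) -exprMn.
by rewrite expr_le1// mulr_ge0// rnorm_ge0.
Qed.

End FejerKernel.

Section FejerMeans.
Context {R : realType} {X : normedModType R[i]} (v : R -> X).
Implicit Types (tau : R) (N L p q : nat).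

(** The shift by 1/2 keeps every frequency at distance at least 1/2 from 0. *)
Definition freq p q : R := p%:R - q%:R + 1 / 2.

Definition dft L (eta : R) : X := (L%:R^-1)%:C *:
  \sum_(j < L) cis (- (eta * (j%:R * (2 * pi / L%:R)))) *: v (j%:R * (2 * pi / L%:R)).

Definition fejer_mean N L tau : X := (N%:R^-1)%:C *:
  \sum_(p < N) \sum_(q < N) cis (freq p q * tau) *: dft L (freq p q).

(** Half-integer frequencies leave the Fejér kernel as it is and multiply the values by a phase that
    is 1 at the point [tau] itself. *)
Lemma fejer_meanE N L tau : fejer_mean N L tau = (L%:R^-1)%:C *:
  \sum_(j < L) (fejer_kernel N (tau - j%:R * (2 * pi / L%:R)))%:C *:
     (cis ((tau - j%:R * (2 * pi / L%:R)) / 2) *: v (j%:R * (2 * pi / L%:R))).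
Proof.
rewrite /fejer_mean /dft; set h := 2 * pi / _.
under eq_bigr => p _. 
  under eq_bigr => q _ do rewrite scalerA mulrC -scalerA scaler_sumr.
  rewrite -scaler_sumr exchange_big/=.
  over.
rewrite -scaler_sumr exchange_big/= scalerA mulrC -scalerA; congr (_ *: _).
rewrite scaler_sumr; apply: eq_bigr => j _.
rewrite fejer_kernelE !scalerA -mulrA -scalerA; congr (_ *: _).
rewrite mulr_suml scaler_suml; apply: eq_bigr => p _.
rewrite mulr_suml scaler_suml; apply: eq_bigr => q _.
by rewrite scalerA -!cisD; congr (cis _ *: _); rewrite /freq; field.
Qed.

(** Fejér's theorem at points near the middle of the period: there [tau - u] stays within [pi + 1],
    so the kernel has its only peak at [u = tau] and no peak at the ends. *)
Lemma fejer_mean_cvg tau (B e : R) : pi <= tau <= pi + 1 ->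
  (forall u, 0 <= u <= 2 * pi -> rnorm (v u) <= B) ->
  (forall e : R, 0 < e -> exists2 d : R, 0 < d &
     forall u, 0 <= u -> `|u - tau| <= d -> rnorm (v u - v tau) <= e) ->
  0 < e ->
  exists N0, forall N, (N0 <= N)%N -> (0 < N)%N -> forall L, (N <= L)%N ->
    rnorm (fejer_mean N L tau - v tau) <= e.
Proof.
have p0 := @pi_gt0 R; have p2 := @pi_ge2 R.
move=> /andP[tau1 tau2] hB cv e0.
have vtB : rnorm (v tau) <= B by apply: hB; apply/andP; split; lra.
have B0 : 0 <= B by apply: le_trans vtB; exact: rnorm_ge0.
have e4 : 0 < e / 4 by lra.
have B1 : 0 < B + 1 by lra.
have [d d0 hd] := cv _ e4.
(* The three bounds serve the continuity of [v] at [tau], the phase, and the range in which [sin_ge]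
   applies to the half-angle. *)
set rho := Num.min d (Num.min (e / 4 / (B + 1)) 1).
have rho0 : 0 < rho by rewrite /rho !lt_min d0 ltr01 !divr_gt0.
have rho1 : rho <= 1 by rewrite /rho !ge_min lexx !orbT.
set s := sin (rho / 2).
have s0 : 0 < s by apply: sin_gt0_pi; apply/andP; split; lra.
have [N0 hN0] := archi_gt (4 * B / (e * s ^+ 2)).
exists N0 => N N0N Ngt L NL.
have NR : 0 < (N%:R : R) by rewrite ltr0n.
have Lgt := leq_trans Ngt NL.
have LR : 0 < (L%:R : R) by rewrite ltr0n.
rewrite fejer_meanE; set h := 2 * pi / _.
have h0 : 0 < h by rewrite divr_gt0// mulr_gt0.
have Lh : L%:R * h = 2 * pi by rewrite /h mulrC divfK ?gt_eqF.
have -> : v tau = (L%:R^-1)%:C *: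
    \sum_(j < L) (fejer_kernel N (tau - j%:R * h))%:C *: v tau.
  rewrite -scaler_suml -rmorph_sum/= fejer_kernel_sum// scalerA -rmorphM/=.
  by rewrite mulVf ?gt_eqF// rmorph1 scale1r.
rewrite -scalerBr -sumrB rnormZ rnormR gtr0_norm ?invr_gt0//.
rewrite ler_pdivrMl// (le_trans (rnorm_sum _ _ _ _))//.
(* Nodes near [tau] are paid for by the mass of the kernel, far nodes by the uniform [e / 2]. *)
have -> : L%:R * e = \sum_(j < L) (fejer_kernel N (tau - j%:R * h) * (e / 2) + e / 2).
  rewrite big_split/= -mulr_suml fejer_kernel_sum// sumr_const card_ord -(mulr_natl (e / 2) L).
  by rewrite -mulrDr -splitr.
apply: ler_sum => j _; rewrite -scalerBr rnormZ rnormR ger0_norm ?fejer_kernel_ge0//.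
set u := j%:R * h; set k := fejer_kernel _ _.
have k0 : 0 <= k by exact: fejer_kernel_ge0.
have u0 : 0 <= u by rewrite mulr_ge0// ltW.
have u2 : u < 2 * pi by rewrite -Lh ltr_pM2r// ltr_nat.
have vu : rnorm (v u) <= B by apply: hB; rewrite u0 ltW.
have [near|far] := leP `|u - tau| rho.
  apply: (@le_trans _ _ (k * (e / 2))); last by rewrite lerDl; lra.
  apply: ler_wpM2l => //.
  have -> : cis ((tau - u) / 2) *: v u - v tau =
    (cis ((tau - u) / 2) - cis 0) *: v u + (v u - v tau).
    by rewrite cis0 scalerBl scale1r addrA subrK.
  rewrite (le_trans (rnormD _ _))// [leRHS](_ : _ = e / 4 + e / 4); last by field.
  apply: lerD; last by apply: hd => //; rewrite (le_trans near)// ge_min lexx.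
  rewrite rnormZ; apply: (@le_trans _ _ (rho * (B + 1))); last first.
    by rewrite -ler_pdivlMr// /rho !ge_min lexx orbT.
  rewrite ler_pM ?rnorm_ge0//; last by lra.
  rewrite (le_trans (cis_lipschitz _ _))// subr0 normrM [`|2^-1|]ger0_norm// mulrC.
  by rewrite divfK// distrC.
apply: (@le_trans _ _ (e / 2)); last by rewrite lerDr mulr_ge0//; lra.
have ut : rho <= `|tau - u| <= pi + 1.
  by rewrite distrC (ltW far)/= distrC ler_norml; apply/andP; split; lra.
have ss : s <= `|sin ((tau - u) / 2)|.
  have -> : `|sin ((tau - u) / 2)| = sin (`|tau - u| / 2).
    have hs : 0 <= sin (`|tau - u| / 2).
      move/andP: ut => [ut1 ut2].
      by apply: sin_ge0_pi; apply/andP; split; lra.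
    have [tu|tu] := leP 0 (tau - u).
      by move: hs; rewrite ger0_norm// => /ger0_norm.
    by move: hs; rewrite ltr0_norm// mulNr sinN oppr_ge0 => /ler0_norm.
  move/andP: ut => [ut1 ut2].
  by apply: sin_ge; apply/andP; split; lra.
have sn0 : sin ((tau - u) / 2) != 0.
  by rewrite -normr_eq0 gt_eqF// (lt_le_trans s0).
have kb : k <= 1 / (N%:R * s ^+ 2).
  rewrite (le_trans (fejer_kernel_far _ _ Ngt sn0))// !div1r lef_pV2 ?posrE.
  - rewrite ler_pM2l// -(real_normK (num_real (sin ((tau - u) / 2)))).
    by rewrite lerXn2r// nnegrE// ltW.
  - by rewrite mulr_gt0// exprn_even_gt0.
  - by rewrite mulr_gt0// exprn_gt0.
have Eb : rnorm (cis ((tau - u) / 2) *: v u - v tau) <= 2 * B.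
  rewrite (le_trans (rnormB _ _))// rnormZ rnorm_cis mul1r; lra.
apply: (@le_trans _ _ (1 / (N%:R * s ^+ 2) * (2 * B))).
  by rewrite ler_pM ?rnorm_ge0.
have : 4 * B / (e * s ^+ 2) <= N%:R by rewrite (le_trans (ltW hN0))// ler_nat.
rewrite ler_pdivrMr ?mulr_gt0 ?exprn_gt0// => hB'.
rewrite mul1r ler_pdivrMl ?mulr_gt0 ?exprn_gt0//.
lra.
Qed.

End FejerMeans.

Section FrequencySums.
Context {R : realType}.

(** The first term is 4, and the others telescope to at most 1 since
    [(a + 3 / 2) ^+ 2 >= (a + 1) * (a + 2)]. *)
Lemma inv_sqr_sum n : \sum_(m < n) 1 / (m%:R + 1 / 2 : R) ^+ 2 <= 5.
Proof.
case: n => [|n]; first by rewrite big_ord0.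
suff h : \sum_(m < n.+1) 1 / (m%:R + 1 / 2 : R) ^+ 2 <= 5 - 1 / n.+1%:R.
  by rewrite (le_trans h)// gerBl divr_ge0.
elim: n => [|n ih]; first by rewrite big_ord1/= [leLHS](_ : _ = 4); [lra|field].
rewrite big_ord_recr/= (le_trans (lerD ih (lexx _)))//.
have n0 : (0 : R) <= n%:R by [].
have e1 : n.+1%:R = n%:R + 1 :> R by rewrite natr1.
have e2 : n.+2%:R = n%:R + 1 + 1 :> R by rewrite !natr1.
rewrite e2 e1; set a := (n%:R : R) in n0 *.
have h1 : 0 < (a + 1) * (a + 2) by rewrite mulr_gt0//; lra.
have : 1 / (a + 1 + 1 / 2) ^+ 2 <= 1 / ((a + 1) * (a + 2)).
  rewrite !div1r lef_pV2 ?posrE ?exprn_gt0//; last by lra.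
  by nra.
have -> : 1 / ((a + 1) * (a + 2)) = 1 / (a + 1) - 1 / (a + 1 + 1).
  by field; rewrite !gt_eqF//; lra.
move: (1 / (a + 1 + 1 / 2) ^+ 2) (1 / (a + 1)) (1 / (a + 1 + 1)) => u v w; lra.
Qed.

Lemma freq_row_sum N p : (p < N)%N ->
  \sum_(q < N) 1 / (freq p q : R) ^+ 2 <= 10.
Proof.
move=> pN; rewrite -(big_mkord xpredT (fun q => 1 / (freq p q : R) ^+ 2)).
rewrite (big_cat_nat (n := p.+1))//=.
rewrite [leRHS](_ : _ = 5 + 5 :> R); last by lra.
apply: lerD.
  apply: le_trans (inv_sqr_sum p.+1); rewrite big_mkord.
  rewrite (reindex_inj rev_ord_inj)/=; apply: ler_sum => i _.
  rewrite [leLHS](_ : _ = 1 / (i%:R + 1 / 2) ^+ 2)//.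
  by rewrite /freq subSS natrB ?leq_ord//; congr (_ / _ ^+ 2); ring.
apply: le_trans (inv_sqr_sum (N - p.+1)).
rewrite -{1}[p.+1]add0n big_addn big_mkord; apply: ler_sum => i _.
rewrite [X in X <= _](_ : _ = 1 / (i%:R + 1 / 2) ^+ 2)//.
rewrite /freq natrD -natr1 -sqrrN; congr (_ / _ ^+ 2).
by field.
Qed.

Lemma freq_ge_half p q : 1 / 2 <= `|freq p q : R|.
Proof.
rewrite /freq; have [qp|pq] := leqP q p.
  have : (q%:R : R) <= p%:R by rewrite ler_nat.
  by move=> h; rewrite ger0_norm; lra.
have : (p.+1%:R : R) <= q%:R by rewrite ler_nat.
by rewrite -natr1 => h; rewrite ltr0_norm; lra.
Qed.

(* For every admissible frequency [eta] there is a time at which the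
   one-parameter group [cis (eta * t)] takes the prescribed value [cis th]. *)
Lemma freq_time (eta th : R) : 1 / 2 <= `|eta| -> 0 < th <= 2 * pi ->
  exists t, [/\ 0 < t <= 8 * pi, t * `|eta| <= 4 * pi & cis th = cis (eta * t)].
Proof.
have p0 := @pi_gt0 R.
move=> eta2 /andP[th0 th2].
have eta0 : 0 < `|eta| by lra.
have [e0|e0] := leP 0 eta.
  rewrite (ger0_norm e0) in eta2 eta0 *.
  exists (th / eta); split.
  - by rewrite divr_gt0//= ler_pdivrMr//; nra.
  - by rewrite divfK ?gt_eqF//; lra.
  - by rewrite mulrC divfK ?gt_eqF.
rewrite (ltr0_norm e0) in eta2 eta0 *.
(* For negative [eta] the angle is lowered by [4 * pi], because lowering it by [2 * pi] would give
   time 0 when [th = 2 * pi]. *)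
exists ((th - 4 * pi) / eta).
have -> : (th - 4 * pi) / eta = (4 * pi - th) / (- eta).
  by field; rewrite lt_eqF.
split.
- by rewrite divr_gt0//= ?ler_pdivrMr//; nra.
- by rewrite divfK ?gt_eqF//; lra.
- have -> : eta * ((4 * pi - th) / - eta) = th - 2 * pi - 2 * pi.
    by field; rewrite lt_eqF.
  by rewrite !cisD cisN cis2pi invr1 !mulr1.
Qed.

End FrequencySums.

Lemma decay_const_ge0 {R : realType} (M K : R) : 0 <= M -> 0 <= K ->
  0 <= decay_const M K.
Proof.
move=> M0 K0; rewrite /decay_const; apply: addr_ge0; last exact: exprn_ge0.
apply: addr_ge0; last exact: exprn_ge0.
apply: addr_ge0; last exact: K0.
apply: mulr_ge0; first exact: exprn_ge0.
apply: mulr_ge0; first by rewrite mulr_ge0// pi_ge0.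
apply: mulr_ge0; last exact: M0.
apply: mulr_ge0; first exact: ler0n.
by rewrite exprn_ge0// mulr_ge0// pi_ge0.
Qed.

Section KatoBeurlingNormalized.
Context {R : realType} {X : completeNormedModType R[i]} (U : R -> X -> X)
  (hU : C0_semigroup U) (M K : R) (M1 : 1 <= M)
  (hM : forall s, 0 <= s <= 30 * pi -> op_bound (U s) M)
  (xi : R[i]) (hxi : rnorm xi = 1) (K0 : 0 <= K)
  (hK : forall t y, 0 < t <= 8 * pi ->
    rnorm y <= K * rnorm (y - xi^-1 *: U t y)).
Implicit Types x : X.

Let M0 : 0 <= M. Proof. by apply: le_trans M1. Qed.

Definition bump_orbit x u : X := (bspline u)%:C *: U u x.

(** The nodes beyond one period contribute nothing, as the spline vanishes there; only the
    normalisations differ. *)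
Lemma dft_fourier_sum L x eta : (0 < L)%N ->
  rnorm (dft (bump_orbit x) L eta) = rnorm (fourier_sum U L bspline eta x) / (2 * pi).
Proof.
move=> L0; have p0 := @pi_gt0 R.
have LR : 0 < (L%:R : R) by rewrite ltr0n.
rewrite /dft /fourier_sum !rnormZ !rnormR; set h := 2 * pi / _.
have h0 : 0 < h by rewrite divr_gt0// mulr_gt0.
rewrite -(big_mkord xpredT (fun j => modulated U bspline eta x (j%:R * h))).
rewrite (big_cat_nat (n := L))//=; last by rewrite leq_pmull.
rewrite [X in _ + X]big_nat_cond [X in _ + X]big1 ?addr0; last first.
  move=> i /andP[/andP[Li _] _]; rewrite /modulated bspline_ge2pi ?mul0r ?scale0r//.
  by rewrite /h mulrCA ler_peMr ?mulr_ge0 ?(ltW p0)// ler_pdivlMr// mul1r ler_nat.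
rewrite big_mkord.
rewrite (eq_bigr (fun j : 'I_L => modulated U bspline eta x (j%:R * h))); last first.
  by move=> j _; rewrite /modulated /bump_orbit scalerA mulrC.
rewrite !gtr0_norm ?invr_gt0// mulrAC; congr (_ * _).
by rewrite /h; move: (pi : R) p0 => c c0; field; rewrite !gt_eqF.
Qed.

(** In the difference of the two Fejér means a frequency contributes at most [2 * |eta| * d] times
    its coefficient, hence a multiple of [d / |eta| ^+ 2]. Rows sum to at most 10, and the mean
    averages over the rows: this gives the 20. *)
Lemma bump_orbit_lipschitz x (d : R) : 0 <= d <= 1 ->
  rnorm (bump_orbit x (pi + d) - bump_orbit x pi) <=
  20 * (decay_const M K / (2 * pi)) * d * rnorm x.
Proof.
move=> /andP[d0 d1]; have p0 := @pi_gt0 R; have p2 := @pi_ge2 R.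
have [th th2 xiE] := cis_surj _ hxi.
set D := decay_const M K / (2 * pi).
have coef p q : exists L0 : nat, forall L, (L0 <= L)%N -> (0 < L)%N ->
    rnorm (dft (bump_orbit x) L (freq p q)) <= D * rnorm x / `|freq p q| ^+ 3.
  have [t [t8 t4 te]] := freq_time _ _ (freq_ge_half p q) th2.
  have eta0 : 0 < `|freq p q : R| by rewrite (lt_le_trans _ (freq_ge_half p q)).
  have [L0 hL0] := bspline_fourier_decay _ hU _ M1 hM _ _ _ x _ t8 t4 eta0
    (etrans xiE te) K0 (fun y => hK _ y t8).
  exists L0 => L L0L Lgt; rewrite dft_fourier_sum// ler_pdivrMr ?mulr_gt0//.
  rewrite (le_trans (hL0 L L0L Lgt))// /D le_eqVlt; apply/orP; left; apply/eqP.
  by move: (pi : R) p0 (`|freq p q : R|) eta0 (rnorm x) (decay_const M K) => c c0 f f0 n E; field; rewrite !gt_eqF.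
have [L0 hL0] : exists L0 : nat -> nat -> nat, forall p q L,
    (L0 p q <= L)%N -> (0 < L)%N ->
    rnorm (dft (bump_orbit x) L (freq p q)) <= D * rnorm x / `|freq p q| ^+ 3.
  have [g hg] := choice (fun pq : nat * nat => coef pq.1 pq.2).
  by exists (fun p q => g (p, q)) => p q; exact: (hg (p, q)).
have hB u : 0 <= u <= 2 * pi -> rnorm (bump_orbit x u) <=
    bspline_lip * (2 * pi) * (M * rnorm x).
  move=> /andP[u0 u2]; rewrite rnormZ rnormR ler_pM ?rnorm_ge0//.
    by apply: bump_bound bspline_bump; rewrite mulr_ge0// ltW.
  by apply: hM; rewrite u0 (le_trans u2)// ler_pM2r// ler_nat.
have cont tau : 0 <= tau -> forall e : R, 0 < e -> exists2 d : R, 0 < d &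
     forall u, 0 <= u -> `|u - tau| <= d -> rnorm (bump_orbit x u - bump_orbit x tau) <= e.
  move=> tau0 e e0.
  have b26 : (0 <= 2 * pi :> R) && (2 * pi <= 26 * pi :> R) by rewrite mulr_ge0 ?(ltW p0)// ler_pM2r// ler_nat.
  have [d' d'0 hd'] := modulated_osc _ hU _ M1 hM _ _ _ 0 x _ b26 bspline_bump e0.
  have mE u : modulated U bspline 0 x u = bump_orbit x u.
    by rewrite /modulated mul0r oppr0 cis0 mulr1.
  exists d' => // u u0 ud; have [ut|tu] := leP u tau.
    have := hd' u (tau - u) u0; rewrite [u + _]addrC subrK !mE rnormBC; apply.
    by move: ud; rewrite distrC ger0_norm ?subr_ge0 ut.
  have := hd' tau (u - tau) tau0; rewrite [tau + _]addrC subrK !mE; apply.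
  by move: ud; rewrite ger0_norm ?subr_ge0 ?(ltW tu).
apply/ler_addgt0Pr => e e0; have e2 : 0 < e / 2 by lra.
have [N1 hN1] := fejer_mean_cvg (bump_orbit x) (pi + d) _ _
  ltac:(by apply/andP; split; lra) hB (cont (pi + d) ltac:(lra)) e2.
have [N2 hN2] := fejer_mean_cvg (bump_orbit x) pi _ _
  ltac:(by apply/andP; split; lra) hB (cont pi ltac:(lra)) e2.
set N := (maxn N1 N2).+1.
(* The grid size from which a coefficient decays depends on the frequency. [N] is fixed first, so
   only finitely many frequencies have to be served. *)
set L := maxn N (\max_(p < N) \max_(q < N) L0 p q).
have NL : (N <= L)%N by rewrite leq_maxl.
have Lgt : (0 < L)%N by rewrite (leq_trans _ NL).
have {}hN1 := hN1 N (leq_trans (leq_maxl _ _) (leqnSn _)) (ltn0Sn _) L NL.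
have {}hN2 := hN2 N (leq_trans (leq_maxr _ _) (leqnSn _)) (ltn0Sn _) L NL.
set s1 := fejer_mean _ _ _ _ in hN1; set s2 := fejer_mean _ _ _ _ in hN2.
have hs : rnorm (s1 - s2) <= 20 * D * d * rnorm x.
  rewrite /s1 /s2 /fejer_mean -scalerBr rnormZ rnormR gtr0_norm ?invr_gt0 ?ltr0n//.
  rewrite ler_pdivrMl ?ltr0n//.
  rewrite -sumrB (le_trans (rnorm_sum _ _ _ _))//.
  rewrite [leRHS](_ : _ = \sum_(p < N) (20 * D * d * rnorm x)); last first.
    by rewrite sumr_const card_ord -[RHS]mulr_natl.
  apply: ler_sum => p _; rewrite -sumrB (le_trans (rnorm_sum _ _ _ _))//.
  apply: (@le_trans _ _ (\sum_(q < N) 2 * D * d * rnorm x * (1 / freq p q ^+ 2))).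
    apply: ler_sum => q _; rewrite -scalerBl rnormZ.
    have f0 : 0 < `|freq p q : R| by rewrite (lt_le_trans _ (freq_ge_half p q)).
    have hLpq : (L0 p q <= L)%N.
      rewrite leq_max; apply/orP; right.
      apply: leq_trans (leq_bigmax p); exact: (leq_bigmax q).
    apply: (@le_trans _ _ ((2 * (`|freq p q| * d)) * (D * rnorm x / `|freq p q| ^+ 3))).
      apply: ler_pM; rewrite ?rnorm_ge0 ?hL0//.
      rewrite (le_trans (cis_lipschitz _ _))// -mulrBr [_ - pi]addrC addKr.
      by rewrite normrM (ger0_norm d0).
    rewrite -(real_normK (num_real (freq p q))) le_eqVlt; apply/orP; left; apply/eqP.
    by field; rewrite gt_eqF.
  rewrite -mulr_sumr [leRHS](_ : _ = 2 * D * d * rnorm x * 10); last by ring.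
  apply: ler_wpM2l; last exact: freq_row_sum.
  apply: mulr_ge0; last exact: rnorm_ge0.
  apply: mulr_ge0 => //; apply: mulr_ge0 => //; apply: divr_ge0.
    exact: decay_const_ge0.
  by rewrite mulr_ge0// ltW.
apply: (le_trans (rnorm_triangle _ s1 _)); rewrite addrC.
apply: (le_trans (lerD (rnorm_triangle _ s2 _) (lexx _))).
rewrite -addrA lerD// [leRHS]splitr lerD// rnormBC//.
Qed.

(** The spline is at least 1 at [pi], so it can be divided out; its own increment is charged to the
    Lipschitz constant. *)
Lemma normalized_lipschitz x (d : R) : 0 <= d <= 1 ->
  rnorm (U (pi + d) x - U pi x) <=
  (20 * (decay_const M K / (2 * pi)) + bspline_lip * M) * d * rnorm x.
Proof.
move=> d01; have := bump_orbit_lipschitz x _ d01; move: d01 => /andP[d0 d1].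
have p0 := @pi_gt0 R; have p2 := @pi_ge2 R.
set C := 20 * _ => hC.
have eqn : (bspline pi)%:C *: (U (pi + d) x - U pi x) =
  (bump_orbit x (pi + d) - bump_orbit x pi) -
   (bspline (pi + d) - bspline pi)%:C *: U (pi + d) x.
  by rewrite /bump_orbit rmorphB scalerBl opprB [RHS]addrC addrA subrK scalerBr.
have b1 : 1 <= bspline pi :> R by rewrite bspline_pi ler_pdivlMr//; nra.
apply: (@le_trans _ _ (rnorm ((bspline pi)%:C *: (U (pi + d) x - U pi x)))).
  by rewrite rnormZ rnormR ger0_norm ?ler_peMl ?rnorm_ge0// (le_trans ler01).
rewrite eqn (le_trans (rnormB _ _))// 2!mulrDl lerD//.
have [_ _ hl] := @bspline_bump R.
rewrite rnormZ rnormR [leRHS](_ : _ = (bspline_lip * d) * (M * rnorm x)); last by ring.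
rewrite ler_pM ?rnorm_ge0//.
  by rewrite (le_trans (hl _ _))// [pi + d]addrC addrK ger0_norm.
by rewrite hM//; apply/andP; split; lra.
Qed.

End KatoBeurlingNormalized.

(** * The Kato–Beurling condition *)

(* The real-variable form of holomorphy: in terms of the generator [A] it says
   that [t * |A T(t)|] stays bounded as [t] tends to 0. *)
Definition orbit_lipschitz {R : realType} {X : completeNormedModType R[i]}
    (T : R -> X -> X) : Prop :=
  exists C t1 : R, [/\ 0 < C, 0 < t1 &
    forall t d x, 0 < t <= t1 -> 0 <= d <= t / 4 ->
      rnorm (T (t + d) x - T t x) <= C * (d / t) * rnorm x].

Section KatoBeurling.
Context {R : realType} {X : completeNormedModType R[i]} {T : R -> X -> X}
  (hT : C0_semigroup T).

Lemma C0_scale (a : R) : 0 < a -> C0_semigroup (fun s => T (a * s)).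
Proof.
move=> a0; have a0' := ltW a0; split.
- by move=> t t0; apply: (C0_bounded hT); rewrite mulr_ge0.
- by rewrite mulr0 (C0_0 hT).
- by move=> s t s0 t0; rewrite mulrDr (C0_D hT)// mulr_ge0.
move=> x; have : {within [set t : R | 0 <= t], continuous (fun t => T t x)}.
  exact: C0_cont.
move=> /subspace_continuousP hc; apply/subspace_continuousP => t /= t0.
have /hc /cvg_rnorm h : [set t : R | 0 <= t] (a * t) by rewrite /= mulr_ge0.
apply/cvg_rnorm => e e0; have {}h := h e e0; move: h; rewrite !near_withinE.
move=> /nbhs_ballP[d /= d0 h]; apply/nbhs_ballP; exists (d / a) => /=; first exact: divr_gt0.
move=> s /= hs s0; apply: h; last by rewrite /= mulr_ge0.
rewrite /ball/= -mulrBr normrM gtr0_norm// mulrC -ltr_pdivlMr//.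
Qed.

Lemma orbit_lipschitz_of_lower_bound (t0 K : R) (xi : R[i]) :
  0 < t0 -> rnorm xi = 1 -> 0 <= K ->
  (forall t y, 0 < t <= t0 -> rnorm y <= K * rnorm (y - xi^-1 *: T t y)) ->
  orbit_lipschitz T.
Proof.
move=> t00 hxi K0 hK; have p0 := @pi_gt0 R.
have p4 : pi <= 4 :> R.
  by have := @pihalf_lt2 R; rewrite ltr_pdivrMr// => h; lra.
have [M M1 hM] := C0_bounded_on hT t0.
set C := 20 * (decay_const M K / (2 * pi)) + bspline_lip * M.
have C0 : 0 <= C.
  rewrite /C; apply: addr_ge0.
    apply: mulr_ge0 => //; apply: divr_ge0; last by rewrite mulr_ge0// ltW.
    by apply: decay_const_ge0 => //; apply: le_trans M1.
  apply: mulr_ge0; last by apply: le_trans M1.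
  by apply: mulr_ge0; [exact: ler0n|exact: sqr_ge0].
(* Time is rescaled by [a = t / pi], so that [t] becomes [pi]. The divisor 30 keeps the rescaled
   window [[0, 30 * pi]] inside [[0, t0]], uniformly in [t]. *)
exists (C * pi + 1), (t0 / 30); split.
- by rewrite ltr_wpDl// mulr_ge0// ltW.
- by rewrite divr_gt0.
move=> t d x /andP[tgt tt0] /andP[d0 dt].
pose a := t / pi.
have a0 : 0 < a by rewrite divr_gt0.
have api : a * pi = t by rewrite /a divfK ?gt_eqF.
have hM' s : 0 <= s <= 30 * pi -> op_bound (T (a * s)) M.
  move=> /andP[s0 s30]; apply: hM; rewrite mulr_ge0 ?(ltW a0)//=.
  apply: (@le_trans _ _ (a * (30 * pi))); first by rewrite ler_pM2l.
  by rewrite mulrCA api mulrC -ler_pdivlMr.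
have hK' s y : 0 < s <= 8 * pi -> rnorm y <= K * rnorm (y - xi^-1 *: T (a * s) y).
  move=> /andP[s0 s8]; apply: hK; rewrite mulr_gt0//=.
  apply: (@le_trans _ _ (a * (30 * pi))).
    rewrite ler_pM2l// (le_trans s8)// ler_pM2r// ler_nat//.
  by rewrite mulrCA api mulrC -ler_pdivlMr.
(* Here [d <= t / 4] is used together with [pi <= 4]. *)
have d01 : 0 <= d / a <= 1.
  rewrite divr_ge0 ?(ltW a0)//= ler_pdivrMr// mul1r (le_trans dt)// /a.
  by rewrite ler_pM2l// lef_pV2 ?posrE.
have := normalized_lipschitz _ (C0_scale _ a0) _ _ M1 hM' _ hxi K0 hK' x _ d01.
rewrite mulrDr api [a * _]mulrC divfK ?gt_eqF// -/C => /le_trans; apply.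
rewrite ler_wpM2r ?rnorm_ge0//.
have aux (c p : R) : 0 < p -> c * (d / (t / p)) = c * p * (d / t).
  by move=> ?; field; rewrite !gt_eqF.
rewrite /a aux//.
rewrite ler_wpM2r ?divr_ge0 ?(ltW tgt)// lerDl//.
Qed.

Lemma opnorm_op_bound (S : X -> X) (q : R) : linear S ->
  (opnorm S <= q%:E)%E -> op_bound S q.
Proof.
move=> lS hS x; have [->|x0] := eqVneq x 0.
  by rewrite (linear_zero lS) !rnorm0 mulr0.
have nx : 0 < rnorm x.
  by rewrite lt_neqAle rnorm_ge0 andbT eq_sym; apply: contra x0 => /eqP/rnorm_eq0/eqP.
have : ((rnorm (S ((rnorm x)^-1%:C *: x)))%:E <= q%:E)%E.
  apply: le_trans hS; apply: ereal_sup_ubound => /=; exists ((rnorm x)^-1%:C *: x) => //=.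
  by rewrite rnormZ rnormR gtr0_norm ?invr_gt0// mulVf ?gt_eqF.
rewrite lee_fin (linear_scale lS) rnormZ rnormR gtr0_norm ?invr_gt0//.
by rewrite ler_pdivrMl// mulrC.
Qed.

Lemma op_bound_opnorm (S : X -> X) (q : R) : 0 <= q -> op_bound S q ->
  (opnorm S <= q%:E)%E.
Proof.
move=> q0 hS; apply: ge_ereal_sup => _ /= [x /= x1 <-]; rewrite lee_fin.
by rewrite (le_trans (hS x))// ler_piMr.
Qed.

Lemma op_poly_linear (f : {poly R[i]}) (S : X -> X) : linear S -> linear (op_poly f S).
Proof.
move=> lS k x y; rewrite /op_poly scaler_sumr -big_split/=; apply: eq_bigr => i _.
by rewrite (linear_iter _ i lS) scalerDr !scalerA mulrC.
Qed.

Lemma iter_scale_bound (S : X -> X) (z : R[i]) (M : R) (n : nat) (y : X) :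
  linear S -> rnorm z <= 1 -> 1 <= M -> op_bound S M ->
  rnorm (z ^+ n *: y - iter n S y) <= n%:R * M ^+ n * rnorm (z *: y - S y).
Proof.
move=> lS z1 M1 bS; have M0 : 0 <= M by apply: le_trans M1.
elim: n => [|n ih]; first by rewrite expr0 scale1r subrr rnorm0 !mul0r.
have -> : z ^+ n.+1 *: y - iter n.+1 S y =
    z *: (z ^+ n *: y - iter n S y) + iter n S (z *: y - S y).
  rewrite (linear_subr (linear_iter _ n lS)) (linear_scale (linear_iter _ n lS)).
  by rewrite -iterSr scalerBr scalerA -exprS addrA subrK.
rewrite (le_trans (rnormD _ _))// -natr1 !mulrDl mul1r lerD//.
  rewrite rnormZ (le_trans (ler_piMl (rnorm_ge0 _) z1))// (le_trans ih)//.
  by rewrite ler_wpM2r ?rnorm_ge0// ler_wpM2l// exprS ler_peMl// exprn_ge0.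
rewrite (le_trans (op_bound_iter _ _ n M0 bS _))// ler_wpM2r ?rnorm_ge0//.
by rewrite exprS ler_peMl// exprn_ge0.
Qed.

(** [f(z) - f(S)] has the factor [z - S]; the sum bounds the cofactor. *)
Lemma op_poly_diff_bound (f : {poly R[i]}) (S : X -> X) (z : R[i]) (M : R) :
  linear S -> rnorm z <= 1 -> 1 <= M -> op_bound S M -> forall y,
  rnorm (f.[z] *: y - op_poly f S y) <=
  (\sum_(k < size f) rnorm f`_k * (k%:R * M ^+ k)) * rnorm (z *: y - S y).
Proof.
move=> lS z1 M1 bS y; rewrite horner_coef scaler_suml /op_poly -sumrB.
rewrite (le_trans (rnorm_sum _ _ _ _))// mulr_suml; apply: ler_sum => k _.
rewrite -scalerA -scalerBr rnormZ -!mulrA ler_wpM2l ?rnorm_ge0// mulrA.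
exact: iter_scale_bound.
Qed.

Lemma limsup_at0_lt (u : R -> \bar R) (r : \bar R) :
  (limsup_at0 u < r)%E -> exists (t0 : R) (l : \bar R), [/\ 0 < t0, (l < r)%E &
    forall t, 0 < t <= t0 -> (u t <= l)%E].
Proof.
rewrite /limsup_at0 limf_esupE => /ereal_inf_lt[_ [V V0 <-] h].
move: V0 => /nbhs_ballP[d /= d0 hd].
exists (d / 2), (ereal_sup (u @` V)); split => //; first by rewrite divr_gt0.
move=> t /andP[t0 td]; apply: ereal_sup_ubound; exists t => //; apply: hd => //.
by rewrite /ball/= sub0r normrN gtr0_norm//; lra.
Qed.

Lemma limsup_at0_le (u : R -> \bar R) (t0 : R) (l : \bar R) :
  0 < t0 -> (forall t, 0 < t < t0 -> (u t <= l)%E) -> (limsup_at0 u <= l)%E.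
Proof.
move=> t00 h; rewrite /limsup_at0 limf_esupE.
apply: (@le_trans _ _ (ereal_sup (u @` [set t | 0 < t < t0]))).
  apply: ereal_inf_lbound; exists [set t | 0 < t < t0] => //.
  apply/nbhs_ballP; exists t0 => //= t; rewrite /ball/= sub0r normrN => tt t_gt0.
  by rewrite t_gt0 -(gtr0_norm t_gt0).
by apply: ge_ereal_sup => _ /= [t ht <-]; exact: h.
Qed.

Lemma orbit_lipschitz_of_poly (f : {poly R[i]}) :
  (limsup_at0 (fun t : R => opnorm (op_poly f (T t))) < disc_norm f)%E ->
  orbit_lipschitz T.
Proof.
move=> /limsup_at0_lt[t0 [l [t00 lf hl]]].
have [_ [z /= z1 <-] lz] : exists2 r, [set (rnorm f.[z])%:E | z in [set z : R[i] | rnorm z <= 1]] r & (l < r)%E.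
  by apply/ereal_sup_gtP.
(* Nonnegativity excludes the value -oo of [l], and the strict inequality excludes +oo; so [l] is a
   real [q]. *)
have opge0 : (0 <= opnorm (op_poly f (T t0)))%E.
  apply: ereal_sup_ubound; exists 0; rewrite /= ?rnorm0//; congr (_%:E).
  by rewrite (linear_zero (op_poly_linear f _ (C0_linear hT _ (ltW t00)))) rnorm0.
have l0 : (0 <= l)%E by apply: le_trans opge0 _; apply: hl; rewrite t00 lexx.
have [q lq] : exists q, l = q%:E.
  by case: l lf hl lz l0 => [q _ _ _ _|//|//]; exists q.
move: hl lz l0; rewrite lq lte_fin lee_fin => hl qz q0 {lf lq}.
have [xi xi1 fxi] : exists2 xi, rnorm xi = 1 & q < rnorm f.[xi].
  apply: contrapT => h; move: qz; rewrite ltNge => /negP; apply.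
  apply: poly_max_circle => // a; rewrite leNgt; apply/negP => ha; apply: h.
  by exists (cis a) => //; exact: rnorm_cis.
have [M M1 hM] := C0_bounded_on hT t0.
have M0 : 0 <= M by apply: le_trans M1.
set c := \sum_(k < size f) rnorm f`_k * (k%:R * M ^+ k).
have c0 : 0 <= c.
  by apply: sumr_ge0 => k _; rewrite mulr_ge0 ?rnorm_ge0// mulr_ge0// exprn_ge0.
have fq : 0 < rnorm f.[xi] - q by rewrite subr_gt0.
(* The constant solves [|f(xi)| * |y| <= c * |xi y - T t y| + q * |y|] for [|y|]. *)
apply: (orbit_lipschitz_of_lower_bound t0 (c / (rnorm f.[xi] - q)) xi) => //.
  by rewrite divr_ge0// ltW.
move=> t y /andP[tgt tt0]; have t_ge0 := ltW tgt.
have lT := C0_linear hT _ t_ge0.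
have := op_poly_diff_bound f _ _ _ lT _ M1 (hM t _) y.
move=> /(_ xi); rewrite xi1 lexx t_ge0 tt0 -/c => /(_ isT isT) h1.
have h2 : rnorm (op_poly f (T t) y) <= q * rnorm y.
  apply: opnorm_op_bound; first exact: op_poly_linear.
  by apply: hl; rewrite tgt.
have h3 := rnorm_le_sub (f.[xi] *: y) (op_poly f (T t) y).
have xi0 : xi != 0.
  by apply/eqP => xi0; move: xi1; rewrite xi0 rnorm0 => /esym/eqP; rewrite oner_eq0.
have -> : rnorm (y - xi^-1 *: T t y) = rnorm (xi *: y - T t y).
  rewrite -[RHS]mul1r -(invr1 R) -{1}xi1 -rnormV -rnormZ scalerBr scalerA.
  by rewrite mulVf// scale1r.
rewrite mulrAC ler_pdivlMr// mulrBr mulrC [_ * q]mulrC lerBlDr.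
by rewrite -rnormZ (le_trans h3)// lerD.
Qed.

End KatoBeurling.

(** * Derivatives of orbits *)

Section AlmostAdditive.
Context {R : realType} {X : completeNormedModType R[i]}.

(* Hyers' argument: an almost additive map is close to a linear one, the slope
   being the limit of [E (d / 2 ^ n) / (d / 2 ^ n)]. *)
Lemma almost_additive_slope (E : R -> X) (d c l : R) : 0 < d -> 0 <= c -> 0 <= l ->
  (forall a b, 0 <= a -> 0 <= b -> a + b <= d ->
    rnorm (E (a + b) - E a - E b) <= c * a * b) ->
  (forall a b, 0 <= b -> b <= a -> a <= d -> rnorm (E a - E b) <= l * (a - b)) ->
  exists e, forall a, 0 <= a <= d -> rnorm (E a - a%:C *: e) <= c * a ^+ 2.
Proof.
move=> d0 c0 l0 hadd hlip.
have E00 : E 0 = 0.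
  have := hadd 0 0 (lexx _) (lexx _); rewrite addr0 (ltW d0) mulr0 => /(_ isT) h.
  apply: rnorm_eq0; apply/eqP; rewrite eq_le rnorm_ge0 andbT.
  by move: h; rewrite subrr sub0r rnormN.
pose de n : R := d * 2^-1 ^+ n.
have de0 n : 0 < de n by rewrite mulr_gt0// exprn_gt0.
have half1 : 2^-1 <= 1 :> R by lra.
have ded n : de n <= d by rewrite ler_piMr ?(ltW d0)// exprn_ile1.
have deS n : de n.+1 + de n.+1 = de n by rewrite /de exprS; lra.
have multiple n m : m%:R * de n <= d ->
    rnorm (E (m%:R * de n) - m%:R%:C *: E (de n)) <= c * (m%:R * de n) ^+ 2 / 2.
  elim: m => [|m ih] h.
    by rewrite !mul0r E00 scale0r subrr rnorm0 expr0n mulr0 mul0r.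
  have m1 : m.+1%:R * de n = m%:R * de n + de n by rewrite -natr1 mulrDl mul1r.
  have md0 : 0 <= m%:R * de n by rewrite mulr_ge0// ltW.
  rewrite m1 in h *; have hm : m%:R * de n <= d.
    by apply: le_trans h; rewrite lerDl ltW.
  have := hadd _ _ md0 (ltW (de0 n)) h; have {ih} := ih hm.
  set A := E (m%:R * de n); set B := E (de n); set D := E _.
  have -> : D - m.+1%:R%:C *: B = (A - m%:R%:C *: B) + (D - A - B).
    rewrite -natr1 rmorphD rmorph1 scalerDl scale1r [RHS]addrC opprD addrA.
    by rewrite [X in _ = X]addrA -[D - A - B]addrA [- A - B]addrC addrA subrK addrAC.
  move=> h1 h2; rewrite (le_trans (rnormD _ _))// (le_trans (lerD h1 h2))//.
  have := sqr_ge0 (de n); set x := m%:R * de n; set y := de n; nra.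
pose u n := (de n)^-1%:C *: E (de n).
have ustep n : rnorm (u n.+1 - u n) <= c * d / 4 * 2^-1 ^+ n.
  have := hadd (de n.+1) (de n.+1) (ltW (de0 _)) (ltW (de0 _)).
  rewrite deS => /(_ (ded n)) h.
  have -> : u n.+1 - u n = - (de n)^-1%:C *: (E (de n) - E (de n.+1) - E (de n.+1)).
    have -> : u n.+1 = (de n)^-1%:C *: (E (de n.+1) + E (de n.+1)).
      rewrite /u -mulr2n -scaler_nat scalerA -(rmorph_nat (real_complex R)) -rmorphM/=.
      by congr (_%:C *: _); rewrite -(deS n); field; rewrite !gt_eqF ?addr_gt0.
    by rewrite /u -scalerBr scaleNr -scalerN; congr (_ *: _); rewrite !opprB addrA.
  rewrite rnormZ rnormN rnormR gtr0_norm ?invr_gt0// ler_pdivrMl// (le_trans h)//.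
  by rewrite le_eqVlt; apply/orP; left; apply/eqP; rewrite /de exprS; field.
have [e he] := geometric_step_cvg _ _ ustep; exists e => a /andP[a0 ad].
apply/ler_addgt0Pr => eps eps0.
have [n0 hn0] := half_expr_lt (d * (l + a * (c / 2) + rnorm e)) _ eps0.
have {hn0} := hn0 n0 (leqnn _) => hn.
set m := Num.truncn (a / de n0).
have /andP[ma am] : m%:R * de n0 <= a < m.+1%:R * de n0.
  by rewrite -ler_pdivlMr// -ltr_pdivrMr//; apply: truncn_itv; rewrite divr_ge0// ltW.
have md0 : 0 <= m%:R * de n0 by rewrite mulr_ge0// ltW.
have am' : a - m%:R * de n0 <= de n0.
  by rewrite lerBlDl ltW//; move: am; rewrite -natr1 mulrDl mul1r.
have e1 : rnorm (E a - E (m%:R * de n0)) <= l * de n0.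
  by rewrite (le_trans (hlip _ _ md0 ma ad))// ler_wpM2l.
have e2 := multiple n0 m (le_trans ma ad).
have e3 : rnorm (m%:R%:C *: E (de n0) - (m%:R * de n0)%:C *: e) <=
    a * (c * d / 2 * 2^-1 ^+ n0).
  have -> : m%:R%:C *: E (de n0) - (m%:R * de n0)%:C *: e =
     - (m%:R * de n0)%:C *: (e - u n0).
    rewrite scaleNr -scalerN opprB scalerBr /u scalerA -rmorphM/=.
    by rewrite mulfK ?gt_eqF.
  rewrite rnormZ rnormN rnormR ger0_norm// ler_pM ?rnorm_ge0//.
  by rewrite (le_trans (he n0))// le_eqVlt; apply/orP; left; apply/eqP; field.
have e4 : rnorm ((m%:R * de n0)%:C *: e - a%:C *: e) <= de n0 * rnorm e.
  rewrite -scalerBl -rmorphB rnormZ rnormR distrC ger0_norm ?subr_ge0//.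
  by rewrite ler_wpM2r ?rnorm_ge0.
apply: (le_trans (rnorm_triangle _ (E (m%:R * de n0)) _)).
apply: (le_trans (lerD e1 (rnorm_triangle _ (m%:R%:C *: E (de n0)) _))).
apply: (le_trans (lerD (lexx _) (lerD e2 (le_trans (rnorm_triangle _ _ _) (lerD e3 e4))))).
have ca : c * (m%:R * de n0) ^+ 2 / 2 <= c * a ^+ 2.
  rewrite ler_pdivrMr// -mulrA ler_wpM2l//.
  have : (m%:R * de n0) ^+ 2 <= a ^+ 2 by rewrite lerXn2r// nnegrE.
  by have := sqr_ge0 a; lra.
rewrite addrCA lerD// (le_trans _ (ltW hn))// /de.
by rewrite le_eqVlt; apply/orP; left; apply/eqP; field.
Qed.

End AlmostAdditive.

Ltac lra_side := try match goal with |- is_true _ => lra end.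

Section Derivative.
Context {R : realType} {X : completeNormedModType R[i]} {T : R -> X -> X}
  (hT : C0_semigroup T) (C t1 : R) (C0 : 0 < C) (t10 : 0 < t1)
  (hL : forall t d x, 0 < t <= t1 -> 0 <= d <= t / 4 ->
      rnorm (T (t + d) x - T t x) <= C * (d / t) * rnorm x).

(** The second difference of an orbit is T(t - 2s) applied to the product of the first differences
    T(s + a) - T(s) and T(s + b) - T(s). Both are Lipschitz, so the increments of the orbit are
    almost additive and have a slope. *)
Lemma right_derivative_exists t : 0 < t -> exists c d : R, [/\ 0 <= c, 0 < d &
  forall x, exists e, forall a, 0 <= a <= d ->
    rnorm (T (t + a) x - T t x - a%:C *: e) <= c * a ^+ 2 * rnorm x].
Proof.
(* Two factors of time [s] must fit into [t], and [s] must lie in the range of the Lipschitz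
   estimate. *)
move=> t0; pose s := Num.min t t1 / 2.
have s0 : 0 < s by rewrite divr_gt0// lt_min t0 t10.
have st : 2 * s <= t by rewrite /s mulrC divfK// ge_min lexx.
have s1 : s <= t1.
  have : 2 * s <= t1 by rewrite /s mulrC divfK// ge_min lexx orbT.
  lra.
have r0 : 0 <= t - 2 * s by lra.
have [M M1 hM] := C0_bounded_on hT (2 * t).
have M0 : 0 <= M by apply: le_trans M1.
set k := C / s; have k0 : 0 <= k by rewrite divr_ge0 ?ltW.
have diff a y : 0 <= a <= s / 4 -> rnorm (T (s + a) y - T s y) <= k * a * rnorm y.
  move=> ha; rewrite (le_trans (hL _ _ _ _ ha)) ?s0//.
  by rewrite /k le_eqVlt; apply/orP; left; apply/eqP; ring.
clearbody k.
exists (M * k ^+ 2), (s / 4); split; first by rewrite mulr_ge0// exprn_ge0.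
  by rewrite divr_gt0.
move=> x; have nx := rnorm_ge0 x.
have [|||||e he] := almost_additive_slope (fun a => T (t + a) x - T t x) (s / 4)
  (M * k ^+ 2 * rnorm x) (M * k * rnorm x).
- by rewrite divr_gt0.
- exact: mulr_ge0 (mulr_ge0 M0 (exprn_ge0 2 k0)) nx.
- exact: mulr_ge0 (mulr_ge0 M0 k0) nx.
- move=> a b a0 b0 ab.
  have lr := C0_linear hT _ r0; have lsa := C0_linear hT (s + a) ltac:(lra).
  have ls := C0_linear hT s (ltW s0).
  have -> : T (t + (a + b)) x - T t x - (T (t + a) x - T t x) - (T (t + b) x - T t x) =
     T (t - 2 * s) (T (s + a) (T (s + b) x - T s x) - T s (T (s + b) x - T s x)).
    rewrite (linear_subr lsa) (linear_subr ls) -!C0_add//; lra_side.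
    rewrite !(linear_subr lr) -!C0_add//; lra_side.
    have -> : t - 2 * s + (s + a + (s + b)) = t + (a + b) by ring.
    have -> : t - 2 * s + (s + a + s) = t + a by ring.
    have -> : t - 2 * s + (s + (s + b)) = t + b by ring.
    have -> : t - 2 * s + (s + s) = t by ring.
    by congr (_ - _); rewrite opprB addrA subrK.
  rewrite (le_trans (hM _ _ _))//; first by apply/andP; split; lra.
  rewrite -!mulrA ler_wpM2l// (le_trans (diff _ _ _))//; first by apply/andP; split; lra.
  rewrite [leRHS](_ : _ = k * a * (k * b * rnorm x)); last by ring.
  by rewrite ler_wpM2l ?mulr_ge0// diff//; apply/andP; split; lra.
- move=> a b b0 ba ad.
  have lr := C0_linear hT (t - 2 * s + s + b) ltac:(lra).
  have -> : T (t + a) x - T t x - (T (t + b) x - T t x) =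
    T (t - 2 * s + s + b) (T (s + (a - b)) x - T s x).
    rewrite (linear_subr lr) -!C0_add//; lra_side.
    have -> : t - 2 * s + s + b + (s + (a - b)) = t + a by ring.
    have -> : t - 2 * s + s + b + s = t + b by ring.
    by rewrite opprB addrA subrK.
  rewrite (le_trans (hM _ _ _))//; first by apply/andP; split; lra.
  rewrite -!mulrA ler_wpM2l// (le_trans (diff _ _ _))//; first by apply/andP; split; lra.
  by rewrite le_eqVlt; apply/orP; left; apply/eqP; ring.
exists e => a ha; rewrite (le_trans (he a ha))//.
by rewrite le_eqVlt; apply/orP; left; apply/eqP; ring.
Qed.

Definition right_derivative t x e : Prop := exists c d : R, 0 < d /\
  forall a, 0 <= a <= d -> rnorm (T (t + a) x - T t x - a%:C *: e) <= c * a ^+ 2.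

Lemma right_derivative_unique t x e e' :
  right_derivative t x e -> right_derivative t x e' -> e = e'.
Proof.
move=> [c [d [d0 h]]] [c' [d' [d'0 h']]].
apply/eqP; rewrite -subr_eq0; apply/eqP/rnorm_le0_eps => eps eps0.
have cc : 0 < `|c| + `|c'| + 1 by rewrite ltr_wpDl// addr_ge0.
set a := Num.min d (Num.min d' (eps / (`|c| + `|c'| + 1))).
have a0 : 0 < a by rewrite /a !lt_min d0 d'0 divr_gt0.
have ad : 0 <= a <= d by rewrite (ltW a0) /a ge_min lexx.
have ad' : 0 <= a <= d' by rewrite (ltW a0) /a !ge_min lexx !orbT.
have ae : a * (`|c| + `|c'| + 1) <= eps by rewrite -ler_pdivlMr// /a !ge_min lexx !orbT.
have : rnorm (a%:C *: (e - e')) <= c' * a ^+ 2 + c * a ^+ 2.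
  have := rnormB (T (t + a) x - T t x - a%:C *: e') (T (t + a) x - T t x - a%:C *: e).
  rewrite opprB [X in rnorm X <= _]addrC addrA subrK -scalerBr => /le_trans; apply.
  by rewrite lerD ?h ?h'.
rewrite rnormZ rnormR gtr0_norm// => hh.
rewrite -(ler_pM2l a0) (le_trans hh)//; have := ler_norm c; have := ler_norm c'.
have : a * a * (`|c| + `|c'| + 1) <= a * eps by rewrite -mulrA ler_wpM2l// ltW.
have := sqr_ge0 a; nra.
Qed.

(** This is A T(t) x for the generator A; 0 is the default where no derivative exists. *)
Definition deriv t x : X := xget 0 [set e | right_derivative t x e].

Lemma derivP t : 0 < t -> exists c d : R, [/\ 0 <= c, 0 < d &
  forall x a, 0 <= a <= d ->
    rnorm (T (t + a) x - T t x - a%:C *: deriv t x) <= c * a ^+ 2 * rnorm x].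
Proof.
move=> t0; have [c [d [c0 d0 h]]] := right_derivative_exists _ t0.
exists c, d; split => // x; have [e he] := h x.
have re : right_derivative t x e.
  by exists (c * rnorm x), d; split => // a ha; rewrite (le_trans (he a ha))// mulrAC.
suff -> : deriv t x = e by [].
exact: (right_derivative_unique t x _ _
  (@xgetPex _ 0 [set e | right_derivative t x e] (ex_intro _ e re)) re).
Qed.

Lemma right_derivative_deriv t x : 0 < t -> right_derivative t x (deriv t x).
Proof.
move=> t0; have [c [d [_ d0 h]]] := derivP _ t0.
by exists (c * rnorm x), d; split => // a ha; rewrite (le_trans (h x a ha))// mulrAC.
Qed.

Lemma deriv_unique t x e : 0 < t -> right_derivative t x e -> deriv t x = e.
Proof. by move=> t0; apply: right_derivative_unique; exact: right_derivative_deriv. Qed.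

Lemma deriv_linear t : 0 < t -> linear (deriv t).
Proof.
move=> t0 k x y; apply: deriv_unique => //.
have [c [d [d0 h]]] := right_derivative_deriv _ x t0.
have [c' [d' [d'0 h']]] := right_derivative_deriv _ y t0.
exists (rnorm k * c + c'), (Num.min d d'); rewrite lt_min d0 d'0; split => // a.
rewrite le_min => /and3P[a0 ad ad'].
have lt := C0_linear hT _ (ltW t0).
have lta := C0_linear hT (t + a) ltac:(lra).
have -> : T (t + a) (k *: x + y) - T t (k *: x + y) - a%:C *: (k *: deriv t x + deriv t y) =
  k *: (T (t + a) x - T t x - a%:C *: deriv t x) + (T (t + a) y - T t y - a%:C *: deriv t y).
  have aux (A B A' B' e f : X) :
      A + B - (A' + B') - (e + f) = (A - A' - e) + (B - B' - f).
    by rewrite !opprD (addrACA A B) (addrACA (A - A')).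
  by rewrite lt lta scalerDr aux !scalerBr !scalerA (mulrC k).
rewrite (le_trans (rnormD _ _))// rnormZ mulrDl lerD//.
  by rewrite -mulrA ler_wpM2l ?rnorm_ge0// h// a0.
by rewrite h'// a0.
Qed.

Lemma deriv_shift s t x : 0 <= s -> 0 < t -> T s (deriv t x) = deriv (s + t) x.
Proof.
move=> s0 t0; apply/esym/deriv_unique; first by lra.
have [M M0 hM] := C0_op_bound hT _ s0.
have [c [d [d0 h]]] := right_derivative_deriv _ x t0.
have ls := C0_linear hT _ s0.
exists (M * c), d; split => // a ha; have /andP[a0 _] := ha.
have -> : T (s + t + a) x - T (s + t) x - a%:C *: T s (deriv t x) =
   T s (T (t + a) x - T t x - a%:C *: deriv t x).
  by rewrite !(linear_subr ls) (linear_scale ls) -!C0_add ?addrA//; lra_side.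
by rewrite (le_trans (hM _))// -mulrA ler_wpM2l// h.
Qed.

Lemma deriv_shiftr s t x : 0 <= s -> 0 < t -> deriv t (T s x) = deriv (s + t) x.
Proof.
move=> s0 t0; apply: deriv_unique => //.
have [c [d [d0 h]]] := right_derivative_deriv (s + t) x ltac:(lra).
exists c, d; split => // a ha; have /andP[a0 _] := ha.
rewrite -!C0_add//; lra_side.
by rewrite (_ : t + a + s = s + t + a) ?(addrC t s) ?h//; ring.
Qed.

Lemma deriv_bound_small t : 0 < t <= t1 -> op_bound (deriv t) (C / t).
Proof.
move=> /andP[t0 tt1] x; have [c [d [d0 h]]] := right_derivative_deriv _ x t0.
apply/ler_addgt0Pr => eps eps0.
have c1 : 0 < `|c| + 1 by rewrite ltr_wpDl.
set a := Num.min d (Num.min (t / 4) (eps / (`|c| + 1))).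
have t4 : 0 < t / 4 by rewrite divr_gt0.
have a0 : 0 < a by rewrite /a !lt_min d0 t4 divr_gt0.
have ad : 0 <= a <= d by rewrite (ltW a0) /a ge_min lexx.
have at4 : 0 <= a <= t / 4 by rewrite (ltW a0) /a !ge_min lexx !orbT.
have ae : a * (`|c| + 1) <= eps by rewrite -ler_pdivlMr// /a !ge_min lexx !orbT.
have h1 := h a ad.
have h2 : rnorm (T (t + a) x - T t x) <= C * (a / t) * rnorm x.
  by apply: hL => //; rewrite t0.
have := rnorm_le_sub (a%:C *: deriv t x) (T (t + a) x - T t x).
rewrite rnormBC rnormZ rnormR (gtr0_norm a0) => h3.
rewrite -(ler_pM2l a0).
have e1 : C * (a / t) * rnorm x = a * (C / t * rnorm x) by ring.
rewrite e1 in h2; rewrite mulrDr (le_trans h3)// addrC lerD// (le_trans h1)//.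
have := ler_norm c; have := sqr_ge0 a.
have : a * a * (`|c| + 1) <= a * eps by rewrite -mulrA ler_wpM2l// ltW.
nra.
Qed.

Lemma deriv_bound t : 0 < t -> exists2 c : R, 0 <= c & op_bound (deriv t) c.
Proof.
move=> t0; have [tt|tt] := leP t t1.
  by exists (C / t); [rewrite divr_ge0// ltW|apply: deriv_bound_small; rewrite t0].
have r0 : 0 <= t - t1 by rewrite subr_ge0 ltW.
have [M M0 hM] := C0_op_bound hT _ r0.
exists (M * (C / t1)); first by rewrite mulr_ge0// divr_ge0// ltW.
move=> x; rewrite -[t](subrK t1) -deriv_shift//.
apply: (op_bound_comp _ _ _ _ M0 hM).
by apply: deriv_bound_small; rewrite t10 lexx.
Qed.

(** The expansions at the fixed times [t / 2] and [t / 4] are pushed forward by the semigroup, which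
    makes them uniform over base points near [t]. That uniformity allows negative increments. *)
Lemma deriv_expansion t : 0 < t -> exists c d : R, [/\ 0 <= c, 0 < d, d <= t / 2 &
  forall x a, `|a| <= d ->
    rnorm (T (t + a) x - T t x - a%:C *: deriv t x) <= c * a ^+ 2 * rnorm x /\
    rnorm (deriv (t + a) x - deriv t x) <= c * `|a| * rnorm x].
Proof.
move=> t0.
have t2 : 0 < t / 2 by lra.
have t4 : 0 < t / 4 by lra.
have [c1 [d1 [c10 d10 h1]]] := derivP _ t2.
have [c2 [d2 [c20 d20 h2]]] := derivP _ t4.
have [kb kb0 hkb] := deriv_bound _ t4.
have [M M1 hM] := C0_bounded_on hT (4 * t).
have M0 : 0 <= M by apply: le_trans M1.
pose d := Num.min (Num.min d1 d2) (t / 2).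
have d0 : 0 < d by rewrite /d !lt_min d10 d20.
have dd1 : d <= d1 by rewrite /d !ge_min lexx.
have dd2 : d <= d2 by rewrite /d !ge_min lexx orbT.
have dt : d <= t / 2 by rewrite /d !ge_min lexx !orbT.
clearbody d.
have g1 s a x : t / 2 <= s <= 2 * t -> 0 <= a <= d ->
    rnorm (T (s + a) x - T s x - a%:C *: deriv s x) <= M * c1 * a ^+ 2 * rnorm x.
  move=> /andP[ts st] /andP[a0 ad].
  have r0 : 0 <= s - t / 2 by lra.
  have lr := C0_linear hT _ r0.
  have -> : T (s + a) x - T s x - a%:C *: deriv s x =
    T (s - t / 2) (T (t / 2 + a) x - T (t / 2) x - a%:C *: deriv (t / 2) x).
    rewrite !(linear_subr lr) (linear_scale lr) deriv_shift// -!C0_add//; lra_side.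
    by rewrite subrK addrA subrK.
  rewrite (le_trans (hM _ _ _))//; first by apply/andP; split; lra.
  rewrite [leRHS](_ : _ = M * (c1 * a ^+ 2 * rnorm x)); last by ring.
  by rewrite ler_wpM2l// h1// a0 (le_trans ad).
have g2 s a x : t / 2 <= s <= 2 * t -> 0 <= a <= d ->
    rnorm (deriv (s + a) x - deriv s x) <= M * kb * (kb + c2 * d) * a * rnorm x.
  move=> /andP[ts st] /andP[a0 ad].
  have r0 : 0 <= s - t / 2 by lra.
  have lr := C0_linear hT _ r0.
  have ld := deriv_linear _ t4.
  have -> : deriv (s + a) x - deriv s x =
    T (s - t / 2) (deriv (t / 4) (T (t / 4 + a) x - T (t / 4) x)).
    rewrite (linear_subr ld) (linear_subr lr) !deriv_shiftr; lra_side.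
    rewrite !deriv_shift; lra_side.
    by congr (deriv _ _ - deriv _ _); field.
  rewrite (le_trans (hM _ _ _))//; first by apply/andP; split; lra.
  rewrite [leRHS](_ : _ = M * (kb * ((kb + c2 * d) * a * rnorm x))); last by ring.
  rewrite ler_wpM2l// (le_trans (hkb _))// ler_wpM2l//.
  rewrite (le_trans (rnorm_le_sub _ (a%:C *: deriv (t / 4) x)))//.
  have ha : 0 <= a <= d2 by rewrite a0 (le_trans ad).
  apply: (le_trans (lerD (h2 x a ha) (lexx _))).
  rewrite rnormZ rnormR ger0_norm// !mulrDl addrC lerD//.
    by rewrite (mulrC kb) -mulrA ler_wpM2l.
  rewrite ler_wpM2r ?rnorm_ge0// expr2 mulrA ler_wpM2r// ler_wpM2l//.
exists (M * c1 + M * kb * (kb + c2 * d)), d.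
have cc0 : 0 <= M * c1 by rewrite mulr_ge0.
have cc1 : 0 <= M * kb * (kb + c2 * d).
  by rewrite mulr_ge0 ?mulr_ge0// addr_ge0// mulr_ge0// ltW.
split => //; first by rewrite addr_ge0.
move=> x a; move: cc0 cc1 g1 g2; set k1 := M * c1; set k2 := _ * (kb + _).
move=> k10 k20 g1 g2 had.
have nx := rnorm_ge0 x.
have [a0|a0] := leP 0 a.
  rewrite ger0_norm// in had *.
  have ha : 0 <= a <= d by rewrite a0.
  have ht : t / 2 <= t <= 2 * t by apply/andP; split; lra.
  split.
    rewrite (le_trans (g1 t a x ht ha))// ler_wpM2r// ler_wpM2r ?sqr_ge0//.
    by rewrite lerDl.
  rewrite (le_trans (g2 t a x ht ha))// ler_wpM2r// ler_wpM2r//.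
  by rewrite lerDr.
rewrite ltr0_norm// in had *.
have ha : 0 <= - a <= d by rewrite oppr_ge0 (ltW a0).
have hs : t / 2 <= t + a <= 2 * t by apply/andP; split; lra.
have := g1 _ _ x hs ha; have := g2 _ _ x hs ha; rewrite addrK => e2 e1.
split.
  (* For negative [a] the expansion is taken at [t + a] with increment [- a], and the derivative is
     then moved back to [t]. *)
  have -> : T (t + a) x - T t x - a%:C *: deriv t x =
    (- a)%:C *: (deriv t x - deriv (t + a) x) -
    (T t x - T (t + a) x - (- a)%:C *: deriv (t + a) x).
    have aux (P Q u v : X) : P - Q + u = u - v - (Q - P - v).
      by rewrite !opprB addrA subrK addrC.
    rewrite scalerBr -aux -scaleNr -rmorphN//.
  rewrite (le_trans (rnormB _ _))// rnormZ rnormR ger0_norm ?oppr_ge0 ?(ltW a0)//.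
  rewrite !mulrDl addrC lerD//; first by move: e1; rewrite sqrrN.
  rewrite (le_trans (ler_wpM2l _ e2)) ?oppr_ge0 ?(ltW a0)//.
  by rewrite le_eqVlt; apply/orP; left; apply/eqP; ring.
rewrite rnormBC (le_trans e2)// ler_wpM2r// ler_wpM2r ?oppr_ge0 ?(ltW a0)//.
by rewrite lerDr.
Qed.

End Derivative.

(** * Powers of the generator *)

Section IteratedDerivatives.
Context {R : realType} {X : completeNormedModType R[i]} {T : R -> X -> X}
  (hT : C0_semigroup T) (C t1 : R) (C0 : 0 < C) (t10 : 0 < t1)
  (hL : forall t d x, 0 < t <= t1 -> 0 <= d <= t / 4 ->
      rnorm (T (t + d) x - T t x) <= C * (d / t) * rnorm x).

Let D := @deriv R X T.
Let D_linear t : 0 < t -> linear (D t).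
Proof. exact: (deriv_linear hT C t1 C0 t10 hL). Qed.
Let D_shift s t x : 0 <= s -> 0 < t -> T s (D t x) = D (s + t) x.
Proof. exact: (deriv_shift hT C t1 C0 t10 hL). Qed.
Let D_shiftr s t x : 0 <= s -> 0 < t -> D t (T s x) = D (s + t) x.
Proof. exact: (deriv_shiftr hT C t1 C0 t10 hL). Qed.

(** A^n T(t) as n factors A T(h) and one factor T(h) with [h = t / n.+1%:R]; the extra factor makes
    [n = 0] meaningful. *)
Definition iter_deriv n t x : X :=
  iter n (deriv (T := T) (t / n.+1%:R)) (T (t / n.+1%:R) x).

Lemma C0_iter_deriv_comm n s e x : 0 <= s -> 0 < e ->
  T s (iter n (D e) x) = iter n (D e) (T s x).
Proof.
move=> s0 e0; elim: n => [//|n ih] /=.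
by rewrite D_shift// -ih D_shiftr.
Qed.

(** Shortening each factor A T(e) to A T(h) releases time [e - h], which goes to the semigroup
    factor. Hence only the total time matters, and two splittings are compared through a common
    smaller step. *)
Lemma iter_deriv_split n e h s x : 0 < h <= e -> 0 <= s ->
  iter n (D e) (T s x) = iter n (D h) (T (s + n%:R * (e - h)) x).
Proof.
move=> /andP[h0 he] s0; elim: n => [|n ih]; first by rewrite mul0r addr0.
have eh : 0 <= e - h by rewrite subr_ge0.
have neh : 0 <= s + n%:R * (e - h) by rewrite addr_ge0// mulr_ge0.
rewrite /= ih -{1}[e](subrK h) -D_shiftr// C0_iter_deriv_comm// -C0_add//.
by congr (D h (iter n (D h) (T _ x))); rewrite -natr1; ring.
Qed.

Lemma iter_derivE n t e x : 0 < t -> 0 < e -> n%:R * e <= t ->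
  iter_deriv n t x = iter n (D e) (T (t - n%:R * e) x).
Proof.
move=> t0 e0 net.
have n1 : 0 < n.+1%:R :> R by rewrite ltr0n.
have tn : 0 < t / n.+1%:R by rewrite divr_gt0.
set h := Num.min e (t / n.+1%:R).
have h0 : 0 < h by rewrite /h lt_min e0 tn.
have he : 0 < h <= e by rewrite h0 /h ge_min lexx.
have ht : 0 < h <= t / n.+1%:R by rewrite h0 /h ge_min lexx orbT.
rewrite /iter_deriv -/D (iter_deriv_split _ _ _ _ _ ht (ltW tn)).
rewrite (iter_deriv_split _ _ _ _ _ he) ?subr_ge0//.
congr (iter _ _ (T _ x)); rewrite -natr1; field.
by rewrite natr1 gt_eqF.
Qed.

Lemma iter_deriv0 t x : iter_deriv 0 t x = T t x.
Proof. by rewrite /iter_deriv /= divr1. Qed.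

Lemma iter_deriv1 t x : 0 < t -> iter_deriv 1 t x = D t x.
Proof.
by move=> t0; rewrite (iter_derivE 1 t t)// ?mul1r// subrr (C0_0 hT).
Qed.

Lemma iter_deriv_comp n m t s x : 0 < t -> 0 < s ->
  iter_deriv n t (iter_deriv m s x) = iter_deriv (n + m) (t + s) x.
Proof.
move=> t0 s0; set e := Num.min (t / n.+1%:R) (s / m.+1%:R).
have e0 : 0 < e by rewrite /e lt_min !divr_gt0.
have ent : n%:R * e <= t.
  rewrite (@le_trans _ _ (n.+1%:R * e))//; first by rewrite ler_wpM2r ?(ltW e0)// ler_nat.
  by rewrite mulrC -ler_pdivlMr// /e ge_min lexx.
have ems : m%:R * e <= s.
  rewrite (@le_trans _ _ (m.+1%:R * e))//; first by rewrite ler_wpM2r ?(ltW e0)// ler_nat.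
  by rewrite mulrC -ler_pdivlMr// /e ge_min lexx orbT.
rewrite (iter_derivE n t e)// (iter_derivE m s e)// (iter_derivE (n + m) (t + s) e)//; lra_side.
  rewrite C0_iter_deriv_comm ?subr_ge0// -C0_add ?subr_ge0// -iterD.
  by congr (iter _ _ (T _ x)); rewrite natrD; ring.
Qed.

Lemma iter_deriv_linear n t : 0 < t -> linear (iter_deriv n t).
Proof.
move=> t0; have tn : 0 < t / n.+1%:R by rewrite divr_gt0.
have := linear_comp _ _ (linear_iter _ n (D_linear _ tn)) (C0_linear hT _ (ltW tn)).
by [].
Qed.

(** This is what turns [(n * C / t) ^+ n] into [n!] times a power; the induction uses (1 + 1/n)^n <=
    e. *)
Lemma expn_le_fact n : (n%:R : R) ^+ n <= expR 1 ^+ n * n`!%:R.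
Proof.
elim: n => [|n ih]; first by rewrite !expr0 fact0 mul1r.
have [->|n0] := eqVneq n 0%N.
  by rewrite !expr1 (_ : 1`! = 1%N)// mulr1; have := expR_ge1Dx (1 : R); lra.
have nR : 0 < n%:R :> R by rewrite ltr0n lt0n.
have -> : (n.+1%:R : R) ^+ n.+1 = n.+1%:R * ((1 + n%:R^-1) ^+ n * n%:R ^+ n).
  rewrite exprS -exprMn; congr (_ * _ ^+ _).
  by rewrite mulrDl mul1r mulVf ?gt_eqF// natr1.
have -> : (expR 1 : R) ^+ n.+1 * n.+1`!%:R = n.+1%:R * (expR 1 * (expR 1 ^+ n * n`!%:R)).
  by rewrite factS natrM exprS; ring.
rewrite ler_wpM2l// ler_pM ?exprn_ge0 ?addr_ge0 ?invr_ge0//.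
have h : 1 + n%:R^-1 <= expR (n%:R^-1 : R) by exact: expR_ge1Dx.
apply: (@le_trans _ _ (expR (n%:R^-1 : R) ^+ n)).
  by rewrite lerXn2r ?nnegrE ?addr_ge0 ?invr_ge0// expR_ge0.
by rewrite -expRM_natl divff ?gt_eqF.
Qed.

Let Q := expR 1 * C.
Let Q0 : 0 < Q. Proof. by rewrite mulr_gt0// expR_gt0. Qed.

Lemma iter_deriv_bound_large n t : 0 < t -> (0 < n)%N -> t / n%:R <= t1 ->
  op_bound (iter_deriv n t) (n`!%:R * (Q / t) ^+ n).
Proof.
move=> t0 n0 tn x.
have nR : 0 < n%:R :> R by rewrite ltr0n.
have tn0 : 0 < t / n%:R by rewrite divr_gt0.
have e : n%:R * (t / n%:R) = t by rewrite mulrC divfK ?gt_eqF.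
rewrite (iter_derivE n t (t / n%:R))// ?e// subrr (C0_0 hT)/=.
have Cn : 0 <= C / (t / n%:R) by rewrite divr_ge0 ?ltW.
have := op_bound_iter (D (t / n%:R)) _ n Cn _ x.
move=> /(_ (deriv_bound_small hT C t1 C0 t10 hL _ _)); rewrite tn0 tn.
move=> /(_ isT) /le_trans; apply.
rewrite ler_wpM2r ?rnorm_ge0//.
have -> : C / (t / n%:R) = n%:R * (C / t) by field; rewrite !gt_eqF.
rewrite [leLHS]exprMn [leRHS](_ : _ = n`!%:R * expR 1 ^+ n * (C / t) ^+ n); last first.
  by rewrite /Q -[expR 1 * C / t]mulrA [(expR 1 * _) ^+ _]exprMn mulrA.
rewrite ler_wpM2r//.
  by rewrite exprn_ge0// divr_ge0 ?ltW.
by rewrite [leRHS]mulrC expn_le_fact.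
Qed.

(** Here [G] does not depend on [t], as continuity of the extension at 0 requires. *)
Lemma iter_deriv_bound_small : exists2 G : R, 0 <= G &
  forall t n, 0 < t <= t1 -> op_bound (iter_deriv n t) (G * (n`!%:R * (Q / t) ^+ n)).
Proof.
have [M M1 hM] := C0_bounded_on hT t1.
have M0 : 0 <= M by apply: le_trans M1.
exists M => // t n /andP[t0 tt1].
have w0 : 0 <= n`!%:R * (Q / t) ^+ n.
  by rewrite mulr_ge0// exprn_ge0// divr_ge0 ?ltW.
case: n w0 => [|n] w0.
  by move=> x; rewrite iter_deriv0 fact0 expr0 !mulr1 hM// (ltW t0).
apply: (op_bound_le _ (n.+1`!%:R * (Q / t) ^+ n.+1)); first by rewrite ler_peMl.
apply: iter_deriv_bound_large => //; rewrite ler_pdivrMr// (le_trans tt1)//.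
by rewrite ler_peMr ?(ltW t10)// ler1n.
Qed.

Lemma iter_deriv_bounded n t : 0 < t ->
  exists2 c : R, 0 <= c & op_bound (iter_deriv n t) c.
Proof.
move=> t0; have tn : 0 < t / n.+1%:R by rewrite divr_gt0.
have [a a0 ha] := deriv_bound hT C t1 C0 t10 hL _ tn.
have [b b0 hb] := C0_op_bound hT _ (ltW tn).
exists (a ^+ n * b); first by rewrite mulr_ge0// exprn_ge0.
by apply: op_bound_comp => //; [exact: exprn_ge0|exact: op_bound_iter].
Qed.

Lemma iter_deriv_bound t : 0 < t -> exists2 G : R, 0 <= G &
  forall n, op_bound (iter_deriv n t) (G * (n`!%:R * (Q / t) ^+ n)).
Proof.
move=> t0; have [N hN] := archi_gt (t / t1).
have ex n : exists c : R, 0 <= c /\ op_bound (iter_deriv n t) c.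
  by have [c c0 hc] := iter_deriv_bounded n _ t0; exists c.
have [c hc] := choice ex.
pose w n := n`!%:R * (Q / t) ^+ n.
have w0 n : 0 < w n by rewrite mulr_gt0 ?ltr0n ?fact_gt0// exprn_gt0// divr_gt0.
have s0 : 0 <= \sum_(i < N.+1) c i / w i.
  by apply: sumr_ge0 => i _; rewrite divr_ge0 ?(ltW (w0 i))//; have [] := hc i.
(* Only indices up to [N] can have [t / n] above [t1]; the ratios of their bounds to the expected
   ones enter the constant. *)
exists (1 + \sum_(i < N.+1) c i / w i); first by rewrite addr_ge0.
move=> n; rewrite -/(w n); have [Nn|nN] := ltnP N n.
  have n0 : (0 < n)%N by rewrite (leq_ltn_trans _ Nn).
  apply: (op_bound_le _ (w n)); first by rewrite ler_peMl ?(ltW (w0 n))// lerDl.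
  apply: iter_deriv_bound_large => //.
  rewrite ler_pdivrMr ?ltr0n// -ler_pdivrMl// mulrC (le_trans (ltW hN))//.
  by rewrite ler_nat ltnW.
apply: (op_bound_le _ (c n)); last by have [] := hc n.
rewrite -ler_pdivrMr//; apply: (@le_trans _ _ (\sum_(i < N.+1) c i / w i)); last by rewrite lerDr.
rewrite (bigD1 (Ordinal (nN : (n < N.+1)%N)))//= lerDl sumr_ge0// => i _.
by rewrite divr_ge0 ?(ltW (w0 i))//; have [] := hc i.
Qed.

End IteratedDerivatives.

(** * Holomorphic extension *)

Section ExpSeries.
Context {R : realType} {X : completeNormedModType R[i]} (B : nat -> R -> X -> X)
  (Q : R) (Q0 : 0 < Q)
  (B_linear : forall n t, 0 < t -> linear (B n t))
  (B_comp : forall n m t s x, 0 < t -> 0 < s -> B n t (B m s x) = B (n + m)%N (t + s) x)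
  (B_bound : forall t, 0 < t -> exists2 G : R, 0 <= G &
    forall n, op_bound (B n t) (G * (n`!%:R * (Q / t) ^+ n))).
Implicit Types (w : R[i]) (t : R) (x : X).

(** With [B n t] read as A^n T(t), these are the terms of exp(wA) T(t), that is, of T(t + w). *)
Definition exp_term w t n x : X := (w ^+ n / n`!%:R) *: B n t x.

Definition exp_partial w t N x : X := \sum_(n < N) exp_term w t n x.

Definition exp_series w t x : X := lim ((fun N => exp_partial w t N x) @ \oo).

(** The ratio of the dominating series is at most 1/8 instead of just below 1; the Cauchy product
    spends the surplus on its number of terms. *)
Definition cone w t : Prop := 0 < t /\ rnorm w * Q <= t / 8.

Lemma fact_neq0 n : n`!%:R != 0 :> R[i].
Proof. by rewrite pnatr_eq0 -lt0n fact_gt0. Qed.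

Lemma exp_term_bound w t (G : R) n x : 0 < t -> 0 <= G ->
  op_bound (B n t) (G * (n`!%:R * (Q / t) ^+ n)) ->
  rnorm (exp_term w t n x) <= G * (rnorm w * Q / t) ^+ n * rnorm x.
Proof.
move=> t0 G0 hB; rewrite /exp_term rnormZ rnormM rnormX rnormV rnorm_nat.
have f0 : 0 < n`!%:R :> R by rewrite ltr0n fact_gt0.
rewrite (le_trans (ler_wpM2l _ (hB x)))//.
  by rewrite divr_ge0 ?exprn_ge0 ?rnorm_ge0// ltW.
have -> : (rnorm w * Q / t) ^+ n = rnorm w ^+ n * (Q / t) ^+ n.
  by rewrite -mulrA exprMn.
by rewrite le_eqVlt; apply/orP; left; apply/eqP; field; rewrite gt_eqF.
Qed.

Lemma cone_ratio w t : cone w t -> 0 <= rnorm w * Q / t <= 8^-1.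
Proof.
move=> [t0 h]; rewrite divr_ge0 ?mulr_ge0 ?rnorm_ge0 ?(ltW Q0) ?(ltW t0)//=.
by rewrite ler_pdivrMr// [leRHS]mulrC.
Qed.

Lemma exp_term_cone w t : cone w t -> exists2 G : R, 0 <= G &
  forall n x, rnorm (exp_term w t n x) <= G * 8^-1 ^+ n * rnorm x.
Proof.
move=> hc; have [t0 _] := hc; have [G G0 hG] := B_bound _ t0.
exists G => // n x; rewrite (le_trans (exp_term_bound w _ G n x t0 G0 (hG n)))//.
have /andP[r0 r8] := cone_ratio _ _ hc.
by rewrite ler_wpM2r ?rnorm_ge0// ler_wpM2l// lerXn2r// nnegrE.
Qed.

Lemma eighth_half n : (8^-1 : R) ^+ n <= 2^-1 ^+ n.
Proof.
have h : (8^-1 : R) <= 2^-1 by lra.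
by apply: lerXn2r => //; rewrite nnegrE invr_ge0.
Qed.

Lemma exp_partialS w t N x :
  exp_partial w t N.+1 x - exp_partial w t N x = exp_term w t N x.
Proof. by rewrite /exp_partial big_ord_recr/= [X in X - _]addrC addrK. Qed.

Lemma geometric_step_lim (u : nat -> X) (G : R) :
  (forall n, rnorm (u n.+1 - u n) <= G * 2^-1 ^+ n) ->
  forall n, rnorm (lim (u @ \oo) - u n) <= 2 * G * 2^-1 ^+ n.
Proof.
move=> h; have [l hl] := geometric_step_cvg _ _ h.
suff -> : lim (u @ \oo) = l by [].
apply/cvg_lim; first exact: norm_hausdorff.
apply/cvg_rnorm => e e0; have [N hN] := half_expr_lt (2 * G) _ e0.
by exists N => // n /= Nn; rewrite rnormBC (le_trans (hl n))// ltW// hN.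
Qed.

Lemma exp_series_rate w t : cone w t -> exists2 G : R, 0 <= G &
  forall n x, rnorm (exp_series w t x - exp_partial w t n x) <= G * 2^-1 ^+ n * rnorm x.
Proof.
move=> hc; have [G G0 hG] := exp_term_cone _ _ hc.
exists (2 * G); first by rewrite mulr_ge0.
move=> n x; rewrite (le_trans (geometric_step_lim _ (G * rnorm x) _ n))//.
  move=> k; rewrite exp_partialS (le_trans (hG k x))// mulrAC.
  by rewrite ler_wpM2l ?eighth_half// mulr_ge0// rnorm_ge0.
by rewrite le_eqVlt; apply/orP; left; apply/eqP; ring.
Qed.

Lemma exp_series_bound w t : cone w t -> exists2 c : R, 0 <= c &
  op_bound (exp_series w t) c.
Proof.
move=> hc; have [G G0 hG] := exp_series_rate _ _ hc; exists G => // x.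
by have := hG 0%N x; rewrite /exp_partial big_ord0 subr0 expr0 mulr1.
Qed.

Lemma exp_term_linear w t n : 0 < t -> linear (exp_term w t n).
Proof.
move=> t0 k x y; rewrite /exp_term (B_linear n t t0) scalerDr !scalerA.
by rewrite (mulrC k).
Qed.

Lemma exp_partial_linear w t N : 0 < t -> linear (exp_partial w t N).
Proof.
move=> t0 k x y; rewrite /exp_partial scaler_sumr -big_split/=.
by apply: eq_bigr => n _; rewrite exp_term_linear.
Qed.

Lemma rnorm_rate_unique (l l' : X) (u : nat -> X) (G G' : R) :
  (forall n, rnorm (l - u n) <= G * 2^-1 ^+ n) ->
  (forall n, rnorm (l' - u n) <= G' * 2^-1 ^+ n) -> l = l'.
Proof.
move=> h h'; apply/eqP; rewrite -subr_eq0; apply/eqP/rnorm_le0_eps => e e0.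
have [N /(_ N (leqnn N)) hN] := half_expr_lt (G + G') _ e0.
rewrite (le_trans (rnorm_triangle _ (u N) _))// (le_trans _ (ltW hN))//.
by rewrite mulrDl lerD// rnormBC.
Qed.

Lemma exp_series_linear w t : cone w t -> linear (exp_series w t).
Proof.
move=> hc k x y; have [G G0 hG] := exp_series_rate _ _ hc; have [t0 _] := hc.
apply: (rnorm_rate_unique _ _ (fun n => exp_partial w t n (k *: x + y))
  (G * rnorm (k *: x + y)) (rnorm k * (G * rnorm x) + G * rnorm y)).
  by move=> n; rewrite mulrAC.
move=> n; rewrite exp_partial_linear//.
have -> : k *: exp_series w t x + exp_series w t y -
    (k *: exp_partial w t n x + exp_partial w t n y) =
  k *: (exp_series w t x - exp_partial w t n x) +
  (exp_series w t y - exp_partial w t n y).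
  by rewrite opprD addrACA scalerBr.
rewrite (le_trans (rnormD _ _))// rnormZ mulrDl lerD//.
  by rewrite -mulrA ler_wpM2l ?rnorm_ge0// mulrAC.
by rewrite mulrAC.
Qed.

Lemma exp_partial_bound w t : cone w t -> exists2 c : R, 0 <= c &
  forall N, op_bound (exp_partial w t N) c.
Proof.
move=> hc; have [G G0 hG] := exp_series_rate _ _ hc.
have [c c0 hc'] := exp_series_bound _ _ hc.
exists (G + c); first by rewrite addr_ge0.
move=> N x; rewrite (le_trans (rnorm_le_sub _ (exp_series w t x)))// mulrDl lerD//.
rewrite rnormBC (le_trans (hG N x))// ler_wpM2r ?rnorm_ge0// ler_piMr//.
by rewrite exprn_ile1//; lra.
Qed.

Lemma triangular_sum (F : nat -> nat -> X) N :
  \sum_(k < N) \sum_(j < k.+1) F j (k - j)%N = \sum_(j < N) \sum_(m < N - j) F j m.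
Proof.
elim: N => [|N ih]; first by rewrite !big_ord0.
rewrite big_ord_recr/= ih [RHS]big_ord_recr/= subSn// subnn big_ord1.
rewrite [\sum_(j < N.+1) _]big_ord_recr/= subnn addrA; congr (_ + _).
rewrite -big_split/=; apply: eq_bigr => j _.
by rewrite subSn ?(ltnW (ltn_ord j))// big_ord_recr.
Qed.

Lemma exp_partial_add w w' t s N x : 0 < t -> 0 < s ->
  exp_partial (w + w') (t + s) N x =
  \sum_(j < N) \sum_(m < N - j) exp_term w t j (exp_term w' s m x).
Proof.
move=> t0 s0.
rewrite -(triangular_sum (fun j m => exp_term w t j (exp_term w' s m x))).
apply: eq_bigr => k _; rewrite /exp_term exprDn mulr_suml scaler_suml.
rewrite (reindex_inj rev_ord_inj)/=; apply: eq_bigr => j _.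
have jk : (j <= k)%N by rewrite -ltnS.
rewrite subSS subKn// (linear_scale (B_linear j t t0)) B_comp// scalerA subnKC//.
congr (_ *: _).
rewrite bin_sub// -mulr_natr.
have := bin_fact jk => /(congr1 (fun n => n%:R : R[i])); rewrite !natrM => <-.
have b0 : 'C(k, j)%:R != 0 :> R[i] by rewrite pnatr_eq0 -lt0n bin_gt0.
by field; rewrite !fact_neq0 b0.
Qed.

(** The product of partial sums is a sum over a square, the partial sum of the product one over a
    triangle. The terms in between have [j + m >= N], hence size of order 8^-N; at most N^2 of them
    occur, and N^2 is at most 4^N. *)
Lemma exp_partial_comp w w' t s : cone w t -> cone w' s -> exists2 G : R, 0 <= G &
  forall N x, rnorm (exp_partial w t N (exp_partial w' s N x) -
    exp_partial (w + w') (t + s) N x) <= G * 2^-1 ^+ N * rnorm x.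
Proof.
move=> hc hc'; have [G G0 hG] := exp_term_cone _ _ hc.
have [G' G'0 hG'] := exp_term_cone _ _ hc'.
have [t0 _] := hc; have [s0 _] := hc'.
exists (G * G'); first by rewrite mulr_ge0.
move=> N x; rewrite exp_partial_add//.
have -> : exp_partial w t N (exp_partial w' s N x) =
    \sum_(j < N) \sum_(m < N) exp_term w t j (exp_term w' s m x).
  by apply: eq_bigr => j _; rewrite (linear_bigsum (exp_term_linear w t j t0)).
rewrite -sumrB.
have nx := rnorm_ge0 x.
have c0 : 0 <= G * G' * 8^-1 ^+ N * rnorm x by rewrite !mulr_ge0// exprn_ge0// invr_ge0.
have row (j : 'I_N) : rnorm (\sum_(m < N) exp_term w t j (exp_term w' s m x) -
    \sum_(m < N - j) exp_term w t j (exp_term w' s m x)) <=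
    N%:R * (G * G' * 8^-1 ^+ N * rnorm x).
  rewrite -[X in X - _](big_mkord xpredT (fun m => exp_term w t j (exp_term w' s m x))).
  rewrite (big_cat_nat (n := N - j))//= ?leq_subr// big_mkord [X in rnorm X <= _]addrC addKr.
  rewrite (le_trans (rnorm_sum _ _ _ _))//.
  apply: (@le_trans _ _ (\sum_(N - j <= m < N) (G * G' * 8^-1 ^+ N * rnorm x))).
    rewrite big_nat_cond [leRHS]big_nat_cond; apply: ler_sum => m.
    rewrite andbT => /andP[jm mN].
    rewrite (le_trans (hG _ _))// (le_trans (ler_wpM2l _ (hG' _ _)))//.
      by rewrite mulr_ge0// exprn_ge0// invr_ge0.
    rewrite [leLHS](_ : _ = G * G' * 8^-1 ^+ (j + m) * rnorm x); last first.
      by rewrite exprD; ring.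
    rewrite ler_wpM2r// ler_wpM2l ?mulr_ge0// ler_wiXn2l ?invr_ge0//; first by lra.
    by rewrite -leq_subLR.
  rewrite sumr_const_nat -[leLHS]mulr_natl ler_wpM2r// ler_nat.
  by rewrite leq_subr.
rewrite (le_trans (rnorm_sum _ _ _ _))//.
apply: (@le_trans _ _ (\sum_(j < N) N%:R * (G * G' * 8^-1 ^+ N * rnorm x))).
  by apply: ler_sum => j _; exact: row.
rewrite sumr_const card_ord -[leLHS]mulr_natl.
rewrite [leLHS](_ : _ = G * G' * (N%:R ^+ 2 * 8^-1 ^+ N) * rnorm x); last by ring.
rewrite ler_wpM2r// ler_wpM2l ?mulr_ge0//.
have -> : (8^-1 : R) ^+ N = 4^-1 ^+ N * 2^-1 ^+ N.
  by rewrite -exprMn; congr (_ ^+ _); field.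
rewrite mulrA ler_piMl ?exprn_ge0//.
have N2 : (N%:R : R) <= 2 ^+ N by rewrite -natrX ler_nat ltnW// ltn_expl.
have -> : (4^-1 : R) ^+ N = (2 ^+ N) ^- 2.
  by rewrite exprVn -exprM mulnC exprM; congr ((_ ^+ _)^-1); ring.
rewrite ler_pdivrMr ?exprn_gt0// mul1r lerXn2r// nnegrE// exprn_ge0//.
Qed.

Lemma cone_add w w' t s : cone w t -> cone w' s -> cone (w + w') (t + s).
Proof.
move=> [t0 h] [s0 h']; split; first exact: addr_gt0.
rewrite (@le_trans _ _ ((rnorm w + rnorm w') * Q))//.
  by rewrite ler_wpM2r ?rnormD// ltW.
by rewrite !mulrDl lerD.
Qed.

Lemma exp_series_comp w w' t s x : cone w t -> cone w' s ->
  exp_series w t (exp_series w' s x) = exp_series (w + w') (t + s) x.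
Proof.
move=> hc hc'; have [G G0 hG] := exp_series_rate _ _ hc.
have [G' G'0 hG'] := exp_series_rate _ _ hc'.
have [H H0 hH] := exp_series_rate _ _ (cone_add _ _ _ _ hc hc').
have [K K0 hK] := exp_partial_comp _ _ _ _ hc hc'.
have [c c0 hcc] := exp_partial_bound _ _ hc.
have [t0 _] := hc.
apply: (rnorm_rate_unique _ _ (fun n => exp_partial (w + w') (t + s) n x)
  (G * rnorm (exp_series w' s x) + (c * (G' * rnorm x) + K * rnorm x)) (H * rnorm x)); last first.
  by move=> n; rewrite mulrAC.
move=> n.
apply: (le_trans (rnorm_triangle _ (exp_partial w t n (exp_series w' s x)) _)).
rewrite mulrDl; apply: lerD; first by rewrite mulrAC.
apply: (le_trans (rnorm_triangle _ (exp_partial w t n (exp_partial w' s n x)) _)).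
rewrite mulrDl; apply: lerD; last by rewrite mulrAC.
rewrite -(linear_subr (exp_partial_linear w t n t0)) (le_trans (hcc n _))// -mulrA.
by rewrite ler_wpM2l// mulrAC.
Qed.

Lemma exp_series0 t x : 0 < t -> exp_series 0 t x = B 0 t x.
Proof.
move=> t0; have hc : cone 0 t by split => //; rewrite rnorm0 mul0r divr_ge0// ltW.
have [G G0 hG] := exp_series_rate _ _ hc.
apply/eqP; rewrite -subr_eq0; apply/eqP/rnorm_le0_eps => e e0.
have [N hN] := half_expr_lt (G * rnorm x) _ e0.
have := hG N.+1 x; rewrite /exp_partial big_ord_recl/= big1.
  rewrite addr0 /exp_term expr0 fact0 divr1 scale1r => /le_trans; apply.
  by rewrite mulrAC ltW// hN.
by move=> i _; rewrite /exp_term expr0n/= mul0r scale0r.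
Qed.

Lemma exp_series_bound_unif w t (G : R) : cone w t -> 0 <= G ->
  (forall n, op_bound (B n t) (G * (n`!%:R * (Q / t) ^+ n))) ->
  op_bound (exp_series w t) (2 * G).
Proof.
move=> hc G0 hG x; have [t0 _] := hc.
have := geometric_step_lim (fun N => exp_partial w t N x) (G * rnorm x) _ 0%N.
have -> : exp_partial w t 0 x = 0 by rewrite /exp_partial big_ord0.
rewrite subr0 expr0 mulr1 mulrA; apply => k.
have /andP[r0 r8] := cone_ratio _ _ hc.
rewrite exp_partialS (le_trans (exp_term_bound w _ G k x t0 G0 (hG k)))// mulrAC.
rewrite ler_wpM2l ?mulr_ge0 ?rnorm_ge0//; apply: le_trans (eighth_half k).
by rewrite lerXn2r// nnegrE.
Qed.

Lemma exp_series_tail2 w t (G : R) x : cone w t -> 0 <= G ->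
  (forall n, op_bound (B n t) (G * (n`!%:R * (Q / t) ^+ n))) ->
  rnorm (exp_series w t x - B 0 t x - w *: B 1 t x) <=
  2 * G * (rnorm w * Q / t) ^+ 2 * rnorm x.
Proof.
move=> hc G0 hG; have [t0 _] := hc; have nx := rnorm_ge0 x.
have /andP[] := cone_ratio _ _ hc; set r := rnorm w * Q / t => r0 r8.
have [H H0 hH] := exp_series_rate _ _ hc.
apply/ler_addgt0Pr => e e0; have [N hN] := half_expr_lt (H * rnorm x) _ e0.
rewrite -addrA -opprD [leRHS]addrC.
apply: (le_trans (rnorm_triangle _ (exp_partial w t N.+2 x) _)); apply: lerD.
  by rewrite (le_trans (hH _ _))// mulrAC ltW// hN// leqW.
have -> : exp_partial w t N.+2 x =
    (B 0 t x + w *: B 1 t x) + \sum_(i < N) exp_term w t i.+2 x.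
  rewrite /exp_partial big_ord_recl big_ord_recl/= addrA; congr (_ + _ + _).
  - by rewrite /exp_term expr0 fact0 divr1 scale1r.
  - by rewrite /exp_term expr1 divr1.
rewrite [X in rnorm (X - _)]addrC addrK.
rewrite (le_trans (rnorm_sum _ _ _ _))//.
apply: (@le_trans _ _ (\sum_(i < N) (G * r ^+ 2 * rnorm x) * 2^-1 ^+ i)).
  apply: ler_sum => i _.
  rewrite (le_trans (exp_term_bound w _ G _ x t0 G0 (hG _)))// -/r.
  rewrite [leLHS](_ : _ = G * r ^+ 2 * rnorm x * r ^+ i); last first.
    by rewrite -addn2 exprD; ring.
  apply: ler_wpM2l; first by rewrite mulr_ge0// mulr_ge0// exprn_ge0.
  apply: le_trans (eighth_half i).
  by rewrite lerXn2r// nnegrE.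
rewrite -mulr_sumr sum_geom_half.
have h2 : 0 <= (2^-1 : R) ^+ N by rewrite exprn_ge0.
rewrite [leRHS](_ : _ = G * r ^+ 2 * rnorm x * 2); last by ring.
by apply: ler_wpM2l; [rewrite mulr_ge0// mulr_ge0// exprn_ge0|lra].
Qed.

End ExpSeries.

Section HolomorphicExtension.
Context {R : realType} {X : completeNormedModType R[i]} {T : R -> X -> X}
  (hT : C0_semigroup T) (C t1 : R) (C0 : 0 < C) (t10 : 0 < t1)
  (hL : forall t d x, 0 < t <= t1 -> 0 <= d <= t / 4 ->
      rnorm (T (t + d) x - T t x) <= C * (d / t) * rnorm x).

Let Q := expR 1 * C.
Let Q0 : 0 < Q. Proof. by rewrite mulr_gt0// expR_gt0. Qed.
Let B := iter_deriv (T := T).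
Let B_linear n t : 0 < t -> linear (B n t).
Proof. exact: (iter_deriv_linear hT C t1 C0 t10 hL). Qed.
Let B_comp n m t s x : 0 < t -> 0 < s -> B n t (B m s x) = B (n + m)%N (t + s) x.
Proof. exact: (iter_deriv_comp hT C t1 C0 t10 hL). Qed.
Let B_bound t : 0 < t -> exists2 G : R, 0 <= G &
    forall n, op_bound (B n t) (G * (n`!%:R * (Q / t) ^+ n)).
Proof. exact: (iter_deriv_bound hT C t1 C0 t10 hL). Qed.

(** Taking the real part as base point fixes one formula for all [z], and adding two points adds
    both base points and increments, as [exp_series_comp] expects. *)
Definition extension (z : R[i]) : X -> X :=
  exp_series (iter_deriv (T := T)) ('i * (complex.Im z)%:C) (complex.Re z).

Let zcone (z : R[i]) := cone Q ('i * (complex.Im z)%:C) (complex.Re z).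

Lemma zconeE z : zcone z <-> 0 < complex.Re z /\ `|complex.Im z| * Q <= complex.Re z / 8.
Proof. by rewrite /zcone /cone rnormM rnormi mul1r rnormR. Qed.

Lemma extension_add z w x : zcone z -> zcone w ->
  extension (z + w) x = extension z (extension w x).
Proof.
move=> hz hw; rewrite /extension (exp_series_comp _ _ Q0 B_linear B_comp B_bound)//.
by case: z w {hz hw} => [a b] [c d] /=; rewrite rmorphD mulrDr.
Qed.

Lemma extension_real t x : 0 < t -> extension t%:C x = T t x.
Proof.
move=> t0; rewrite /extension /= mulr0 (exp_series0 _ _ Q0 B_bound)//.
exact: iter_deriv0.
Qed.

(** Complex differentiability is established at real points only. Since the base point moves with
    the real part of [h], the imaginary series is expanded at [t + a] and then compared with [t]. *)
Lemma extension_expansion t : 0 < t -> exists c r : R, [/\ 0 <= c, 0 < r &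
  forall h : R[i], rnorm h <= r -> zcone (t%:C + h) /\ forall x,
    rnorm (extension (t%:C + h) x - T t x - h *: deriv (T := T) t x) <=
    c * rnorm h ^+ 2 * rnorm x].
Proof.
move=> t0; have t2 : 0 < t / 2 by rewrite divr_gt0.
have [c [d [c0 d0 dt hd]]] := deriv_expansion hT C t1 C0 t10 hL _ t0.
have [G G0 hG] := B_bound _ t2.
have [M M1 hM] := C0_bounded_on hT (2 * t).
have M0 : 0 <= M by apply: le_trans M1.
pose r := Num.min d (t / (16 * Q)).
have r0 : 0 < r by rewrite lt_min d0 divr_gt0// mulr_gt0.
exists (2 * (M * G) * (2 * Q / t) ^+ 2 + c + c), r; split => //.
  rewrite addr_ge0// addr_ge0// mulr_ge0 ?exprn_ge0//; first by rewrite !mulr_ge0.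
  by rewrite divr_ge0 ?mulr_ge0// ltW.
move=> h hr; have hd1 : rnorm h <= d by rewrite (le_trans hr)// ge_min lexx.
have hQ : rnorm h * Q <= t / 16.
  have : rnorm h <= t / (16 * Q) by rewrite (le_trans hr)// ge_min lexx orbT.
  rewrite ler_pdivlMr ?mulr_gt0// => hh; lra.
set a := complex.Re h; set b := complex.Im h.
have ah : `|a| <= rnorm h by exact: Re_le_rnorm.
have bh : `|b| <= rnorm h by exact: Im_le_rnorm.
have a2 : t / 2 <= t + a <= 2 * t.
  have := le_trans ah (le_trans hd1 dt); rewrite ler_norml => /andP[? ?].
  by apply/andP; split; lra.
have [a2l a2r] := andP a2.
have bQ : `|b| * Q <= rnorm h * Q by rewrite ler_wpM2r// ltW.
have eRe : complex.Re (t%:C + h) = t + a by rewrite /a; case: (h).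
have eIm : complex.Im (t%:C + h) = b by rewrite /b; case: (h) => ? ?; rewrite /= add0r.
have hcone : zcone (t%:C + h) by apply/zconeE; rewrite eRe eIm; split; lra.
split => // x; have nx := rnorm_ge0 x; have nh := rnorm_ge0 h.
rewrite /extension eRe eIm; set w := 'i * b%:C.
(* The bounds at the moving base point come from those at [t / 2], so that one constant serves every
   [h]. *)
have hB n : op_bound (B n (t + a)) (M * G * (n`!%:R * (Q / (t / 2)) ^+ n)).
  move=> y; have ra : 0 <= t / 2 + a by lra.
  have -> : B n (t + a) y = T (t / 2 + a) (B n (t / 2) y).
    have [ra0|ra0] := eqVneq (t / 2 + a) 0.
      by rewrite ra0 (C0_0 hT); congr (B n _ y); lra.
    have rp : 0 < t / 2 + a by rewrite lt_neqAle eq_sym ra0.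
    rewrite -[T _ (B n _ y)]iter_deriv0 -/B B_comp// add0n.
    by congr (B n _ y); field.
  rewrite (le_trans (hM _ _ _))//; first by apply/andP; split; lra.
  rewrite [leRHS](_ : _ = M * (G * (n`!%:R * (Q / (t / 2)) ^+ n) * rnorm y)); last by ring.
  by rewrite ler_wpM2l// hG.
have ta0 : 0 < t + a by lra.
(* The same bounds in the shape Q' / (t + a) that the series lemmas require, with Q' chosen so that
   this quotient is [2 * Q / t]. *)
have hB' n : op_bound (B n (t + a)) (M * G * (n`!%:R * ((2 * Q * (t + a) / t) / (t + a)) ^+ n)).
  have -> : (2 * Q * (t + a) / t) / (t + a) = Q / (t / 2) by field; rewrite !gt_eqF.
  exact: hB.
have Q'0 : 0 < 2 * Q * (t + a) / t by rewrite divr_gt0 ?mulr_gt0.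
have nw : rnorm w = `|b| by rewrite /w rnormM rnormi mul1r rnormR.
have rE : rnorm w * (2 * Q * (t + a) / t) / (t + a) = `|b| * (2 * Q / t).
  by rewrite nw; field; rewrite !gt_eqF.
have cone' : cone (2 * Q * (t + a) / t) w (t + a).
  split => //; rewrite -ler_pdivrMl// mulrC rE.
  rewrite mulrA ler_pdivrMr//; lra.
have B_bound' s : 0 < s -> exists2 G : R, 0 <= G &
    forall n, op_bound (B n s) (G * (n`!%:R * (2 * Q * (t + a) / t / s) ^+ n)).
  move=> s0; have [H H0 hH] := B_bound _ s0; exists H => // n.
  apply: op_bound_le (hH n); rewrite ler_wpM2l// ler_wpM2l//.
  have Qs : Q / s <= 2 * Q * (t + a) / t / s.
    rewrite ler_wpM2r ?invr_ge0 ?(ltW s0)// ler_pdivlMr//.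
    rewrite [leRHS](_ : _ = Q * (2 * (t + a))); last by ring.
    by rewrite ler_pM2l//; lra.
  have Qs0 : 0 <= Q / s by rewrite divr_ge0// ltW.
  by rewrite lerXn2r// nnegrE (le_trans Qs0).
have := exp_series_tail2 B _ Q'0 B_bound' w (t + a) (M * G) x cone'
  (mulr_ge0 M0 G0) hB'.
have b0 : B 0 (t + a) x = T (t + a) x by exact: iter_deriv0.
have b1 : B 1 (t + a) x = deriv (T := T) (t + a) x.
  exact: (iter_deriv1 hT C t1 C0 t10 hL).
rewrite rE b0 b1.
move=> e1.
have [e2 e3] := hd x a (le_trans ah hd1).
have hE : h = a%:C + w by rewrite /w [h in LHS]complexE.
have -> : exp_series B w (t + a) x - T t x - h *: deriv (T := T) t x =
  (exp_series B w (t + a) x - T (t + a) x - w *: deriv (T := T) (t + a) x) +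
  ((T (t + a) x - T t x - a%:C *: deriv (T := T) t x) +
   w *: (deriv (T := T) (t + a) x - deriv (T := T) t x)).
  have aux (S Ta Tt u v v' : X) : S - Tt - (u + v) = (S - Ta - v') + ((Ta - Tt - u) + (v' - v)).
    rewrite [(Ta - Tt - u) + _]addrC [RHS]addrA [S - Ta - v' + _]addrA subrK.
    rewrite -[Ta - Tt - u]addrA [S - Ta - v]addrAC [RHS]addrA subrK opprD -!addrA.
    by congr (S + _); rewrite [RHS]addrC -addrA.
  by rewrite hE scalerDl scalerBr -aux.
rewrite [leRHS](_ : _ = 2 * (M * G) * (2 * Q / t) ^+ 2 * rnorm h ^+ 2 * rnorm x +
  (c * rnorm h ^+ 2 * rnorm x + c * rnorm h ^+ 2 * rnorm x)); last by ring.
rewrite (le_trans (rnormD _ _))//.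
have h2 : rnorm h ^+ 2 = rnorm h * rnorm h by rewrite expr2.
apply: lerD.
  rewrite (le_trans e1)// ler_wpM2r// -[leRHS]mulrA.
  apply: ler_wpM2l; first by rewrite mulr_ge0// mulr_ge0.
  have Qt0 : 0 <= 2 * Q / t by exact: divr_ge0 (mulr_ge0 (ler0n _ 2) (ltW Q0)) (ltW t0).
  rewrite -exprMn lerXn2r ?nnegrE//; [exact: mulr_ge0|exact: mulr_ge0|].
  by rewrite mulrC ler_wpM2l.
rewrite (le_trans (rnormD _ _))// lerD//.
  rewrite (le_trans e2)// ler_wpM2r// ler_wpM2l//.
  by rewrite -(real_normK (num_real a)) lerXn2r// nnegrE.
rewrite rnormZ nw (le_trans (ler_wpM2l _ e3))//.
rewrite [leLHS](_ : _ = c * (`|b| * `|a|) * rnorm x); last by ring.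
by rewrite ler_wpM2r// ler_wpM2l// h2 ler_pM.
Qed.

Lemma sin_le_abs (y : R) : `|sin y| <= `|y|.
Proof.
wlog y0 : y / 0 <= y.
  move=> h; have [|/ltW y0] := leP 0 y; first exact: h.
  by rewrite -normrN -sinN -[`|y|]normrN h// oppr_ge0.
move: y0; rewrite le_eqVlt => /orP[/eqP<-|y0]; first by rewrite sin0 normr0.
have [c _] := @MVT R sin cos 0 y y0 (fun x _ => is_derive_sin x)
  (continuous_subspaceT (@continuous_sin R)).
by rewrite sin0 !subr0 => ->; rewrite normrM ler_piMl// cos_max.
Qed.

(** The bound 1/4 gives a cosine of at least 1/2; the other makes [|sin th| * Q] less than 1/32,
    below an eighth of the cosine. *)
Definition sector_angle : R := Num.min (1 / 4) (1 / (32 * Q)).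

Lemma sector_zcone z : sector sector_angle z ->
  [/\ zcone z, 0 < complex.Re z & `|complex.Im z| * Q < complex.Re z / 8].
Proof.
move=> [r [th [r0 hth ->]]] /=.
have th4 : `|th| < 1 / 4 by rewrite (lt_le_trans hth)// ge_min lexx.
have thQ : `|th| * (32 * Q) < 1.
  by rewrite -ltr_pdivlMr ?mulr_gt0// (lt_le_trans hth)// ge_min lexx orbT.
have c2 : 1 / 2 <= cos th.
  have := cis_lipschitz 0 th; have := Re_le_rnorm (cis 0 - cis th).
  rewrite cis0 /= sub0r normrN => h1 h2; have := ler_norm (1 - cos th); lra.
have sQ : `|sin th| * Q <= `|th| * Q by rewrite ler_wpM2r ?sin_le_abs// ltW.
have c0 : 0 < r * cos th by rewrite mulr_gt0//; lra.
have hlt : `|r * sin th| * Q < r * cos th / 8.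
  by rewrite normrM gtr0_norm// -mulrA -mulrA ltr_pM2l//; lra.
by split => //; apply/zconeE => /=; split => //; exact: ltW.
Qed.

Lemma extension_bound z : zcone z -> exists2 c : R, 0 <= c & op_bound (extension z) c.
Proof. by move=> hz; exact: (exp_series_bound _ _ Q0 B_bound). Qed.

Lemma extension_linear z : zcone z -> linear (extension z).
Proof. by move=> hz; exact: (exp_series_linear _ _ Q0 B_linear B_bound). Qed.

Lemma zcone_real t : 0 < t -> zcone t%:C.
Proof. by move=> t0; apply/zconeE => /=; rewrite normr0 mul0r divr_ge0// ltW. Qed.

Lemma opnorm_cvg0 (F : R[i]^o -> X -> X) (k r : R) : 0 <= k -> 0 < r ->
  (forall h : R[i], h != 0 -> rnorm h <= r -> op_bound (F h) (k * rnorm h)) ->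
  opnorm (F h) @[h --> (0 : R[i]^o)^'] --> 0%E.
Proof.
move=> k0 r0 hF.
have nearF : \forall h \near (0 : R[i]^o)^', h != 0 /\ rnorm (h : R[i]) <= r.
  rewrite near_withinE; apply/(nbhs_rnorm (V := R[i]^o)); exists r => // h hr h0.
  by split => //; move: hr; rewrite subr0; exact: ltW.
apply: (@squeeze_cvge _ _ _ _ (fun=> 0%E) _ (fun h : R[i]^o => (k * rnorm (h : R[i]))%:E)).
- apply: filterS nearF => h [h0 hr]; apply/andP; split.
    apply: (@le_trans _ _ (rnorm (F h 0))%:E); first by rewrite lee_fin rnorm_ge0.
    by apply: ereal_sup_ubound; exists 0; rewrite /= ?rnorm0.
  apply: op_bound_opnorm; first by rewrite mulr_ge0// rnorm_ge0.
  exact: hF.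
- exact: cvg_cst.
apply: cvg_EFin; first by near=> h.
apply/cvgrPdist_le => e e0.
have k1 : 0 < k + 1 by rewrite ltr_wpDl.
rewrite near_withinE; apply/(nbhs_rnorm (V := R[i]^o)); exists (e / (k + 1)).
  by rewrite divr_gt0.
move=> h; rewrite subr0 ltr_pdivlMr// => hh _.
rewrite sub0r normrN ger0_norm ?mulr_ge0 ?rnorm_ge0//.
rewrite (le_trans _ (ltW hh))// [leLHS]mulrC ler_wpM2l ?rnorm_ge0//.
by rewrite lerDl.
Unshelve. all: by end_near.
Qed.

Lemma extension_holomorphic :
  op_holomorphic (sector sector_angle) (extension : R[i]^o -> X -> X).
Proof.
move=> z /sector_zcone[hz t0 hlt].
set t := complex.Re z in t0 hlt; set y := complex.Im z in hlt.
(* Half of the slack of [z] in the cone: [z - tau] stays in the cone, and S(z + h) = S(z - tau)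
   S(tau + h) reduces differentiability at [z] to the real point [tau]. *)
set tau := (t - 8 * (`|y| * Q)) / 2.
have yQ : 0 <= `|y| * Q by rewrite mulr_ge0// ltW.
have tau0 : 0 < tau by rewrite /tau; lra.
have zE : z = t +i* y by rewrite /t /y; case: (z).
have hzt : zcone (z - tau%:C).
  apply/zconeE; rewrite zE /= subr0; split; rewrite /tau; lra.
have hct := zcone_real _ tau0.
have [c [r [c0 r0 hr]]] := extension_expansion _ tau0.
have [b b0 hb] := extension_bound _ hzt.
have [k k0 hk] := deriv_bound hT C t1 C0 t10 hL _ tau0.
have lext := extension_linear _ hzt.
have ld := deriv_linear hT C t1 C0 t10 hL _ tau0.
exists (extension (z - tau%:C) \o deriv (T := T) tau); split.
  split; first exact: linear_comp.
  apply: (op_bound_continuous _ (b * k)); first exact: linear_comp.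
  exact: op_bound_comp.
apply: (opnorm_cvg0 _ (b * c) r) => //; first by rewrite mulr_ge0.
move=> h h0 hhr x /=; have [hcone hx] := hr h hhr.
have -> : extension (z + h) x = extension (z - tau%:C) (extension (tau%:C + h) x).
  by rewrite -extension_add// addrA subrK.
have -> : extension z x = extension (z - tau%:C) (T tau x).
  by rewrite -extension_real// -extension_add// subrK.
have -> : h^-1 *: (extension (z - tau%:C) (extension (tau%:C + h) x) -
      extension (z - tau%:C) (T tau x)) - extension (z - tau%:C) (deriv (T := T) tau x) =
    h^-1 *: extension (z - tau%:C)
      (extension (tau%:C + h) x - T tau x - h *: deriv (T := T) tau x).
  rewrite !(linear_subr lext) (linear_scale lext) [in RHS]scalerBr scalerA.
  by rewrite mulVf// scale1r.
have nh : 0 < rnorm (h : R[i]).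
  rewrite lt_neqAle rnorm_ge0 andbT eq_sym.
  by apply: contra h0 => /eqP/(@rnorm_eq0 R R[i])/eqP.
rewrite rnormZ rnormV ler_pdivrMl// (le_trans (hb _))//.
rewrite [leRHS](_ : _ = b * (c * rnorm (h : R[i]) ^+ 2 * rnorm x)); last by ring.
by rewrite ler_wpM2l// hx.
Qed.

(** A vector [T s0 x] close to [x] has an extension that is differentiable at [s0], so convergence
    holds on it; the uniform bound [2 * G] passes it on to [x]. *)
Lemma extension_cont0 (delta : R) x : delta < sector_angle ->
  extension z x @[z --> within (sector delta) (nbhs (0 : R[i]^o))] --> x.
Proof.
move=> dd.
have [G G0 hG] := iter_deriv_bound_small hT C t1 C0 t10 hL.
apply/cvg_rnorm => e e0.
have G1 : 0 < 2 * G + 1 by lra.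
have e1 : 0 < e / 3 / (2 * G + 1) by rewrite !divr_gt0.
have [s0 s00 hs] := C0_at0 hT x _ e1.
have s0s : 0 <= s0 <= s0 by rewrite lexx ltW.
have {}hs := hs s0 s0s.
have [c [r [c0 r0 hr]]] := extension_expansion _ s00.
have [k k0 hk] := deriv_bound hT C t1 C0 t10 hL _ s00.
have nx := rnorm_ge0 x.
have K0 : 0 < (k + c * r) * rnorm x + 1.
  by rewrite ltr_wpDl// mulr_ge0// addr_ge0// mulr_ge0// ltW.
rewrite near_withinE; apply/(nbhs_rnorm (V := R[i]^o)).
exists (Num.min t1 (Num.min r (e / 3 / ((k + c * r) * rnorm x + 1)))).
  by rewrite !lt_min t10 r0 !divr_gt0.
move=> z; rewrite subr0 !lt_min => /and3P[zt1 zr zk] hsec.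
have /sector_zcone[hz Rz _] : sector sector_angle z.
  move: hsec => [rho [th [rho0 hth ->]]]; exists rho, th; split => //.
  exact: lt_trans dd.
have bz : op_bound (extension z) (2 * G).
  apply: (exp_series_bound_unif _ _ Q0) => // n; apply: hG; rewrite Rz/=.
  rewrite (le_trans (ler_norm _))// (le_trans (Re_le_rnorm z))// ltW//.
have lz := extension_linear _ hz.
have [_ hzs] := hr z (ltW zr).
have e2 : rnorm (extension z (x - T s0 x)) <= e / 3.
  rewrite (le_trans (bz _))// (@le_trans _ _ ((2 * G + 1) * rnorm (x - T s0 x)))//.
    by rewrite ler_wpM2r ?rnorm_ge0// lerDl.
  by rewrite mulrC -ler_pdivlMr// rnormBC.
have e3 : rnorm (extension z (T s0 x) - T s0 x) <= e / 3.
  have -> : extension z (T s0 x) = extension (s0%:C + z) x.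
    by rewrite addrC extension_add ?extension_real//; exact: zcone_real.
  rewrite (le_trans (rnorm_le_sub _ (z *: deriv (T := T) s0 x)))//.
  rewrite (le_trans (lerD (hzs x) (lexx _)))// rnormZ.
  have nz := rnorm_ge0 (z : R[i]).
  apply: (@le_trans _ _ (rnorm (z : R[i]) * ((k + c * r) * rnorm x + 1))); last first.
    by rewrite -ler_pdivlMr// ltW.
  rewrite [leRHS](_ : _ = rnorm (z : R[i]) * (c * r * rnorm x) +
    rnorm (z : R[i]) * (k * rnorm x) + rnorm (z : R[i])); last by ring.
  rewrite ler_wpDr// lerD//; last by rewrite ler_wpM2l.
  rewrite [leLHS](_ : _ = rnorm (z : R[i]) * (c * rnorm (z : R[i]) * rnorm x)); last by ring.
  by rewrite ler_wpM2l// ler_wpM2r// ler_wpM2l// ltW.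
have e4 : rnorm (T s0 x - x) <= e / 3.
  by rewrite (le_trans hs)// ler_pdivrMr// ler_peMr ?divr_ge0 ?(ltW e0)// lerDr mulr_ge0.
have -> : extension z x - x =
    extension z (x - T s0 x) + ((extension z (T s0 x) - T s0 x) + (T s0 x - x)).
  by rewrite (linear_subr lz) !addrA subrK subrK.
rewrite (le_trans (rnormD _ _))// (@le_trans _ _ (e / 3 + (e / 3 + e / 3)))//.
  by rewrite lerD// (le_trans (rnormD _ _))// lerD.
lra.
Qed.

Lemma extends_of_orbit_lipschitz : extends_holomorphically T.
Proof.
have sa0 : 0 < sector_angle by rewrite lt_min !divr_gt0// mulr_gt0.
exists sector_angle, (extension : R[i]^o -> X -> X); split => //.
- rewrite (le_trans _ (@pihalf_ge1 R))// /sector_angle ge_min; apply/orP; left; lra.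
- split.
  + move=> z /sector_zcone[hz _ _]; have [b b0 hb] := extension_bound _ hz.
    split; first exact: extension_linear.
    exact: (op_bound_continuous _ b (extension_linear _ hz) hb).
  + move=> z w /sector_zcone[hz _ _] /sector_zcone[hw _ _].
    by apply/funext => x /=; exact: extension_add.
  + exact: extension_holomorphic.
  + by move=> delta' _ dd x; exact: extension_cont0.
- by move=> t t0; apply/funext => x; exact: extension_real.
Qed.

End HolomorphicExtension.

(** * Differences of a holomorphic semigroup *)

Section DiscreteMaximum.
Context {R : realType}.

(** Strictness already forbids a maximum at an interior node, so no propagation to the boundary is
    needed. *)
Lemma discrete_maximum_principle (n m : nat) (V : nat -> nat -> R) :
  (forall i j, (0 < i < n)%N -> (0 < j < m)%N ->
    4 * V i j < V i.+1 j + V i.-1 j + V i j.+1 + V i j.-1) ->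
  (forall i j, (i <= n)%N -> (j <= m)%N ->
    (i == 0%N) || (i == n) || (j == 0%N) || (j == m) -> V i j <= 0) ->
  forall i j, (i <= n)%N -> (j <= m)%N -> V i j <= 0.
Proof.
move=> hint hbd i j iN jM.
pose F (p : 'I_n.+1 * 'I_m.+1) := V p.1 p.2.
have [p _ hp] := @arg_maxP _ _ _ (ord0, ord0) xpredT F isT.
have hmax i' j' : (i' <= n)%N -> (j' <= m)%N -> V i' j' <= F p.
  move=> h1 h2; exact: (hp (Ordinal (h1 : (i' < n.+1)%N), Ordinal (h2 : (j' < m.+1)%N))).
apply: le_trans (hmax i j iN jM) _.
case: p hp hmax => [[a an] [b bm]] hp hmax; rewrite /F/= in hmax *.
move: (an) (bm); rewrite !ltnS => an' bm' {hp}.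
have [hb|hb] := boolP ((a == 0%N) || (a == n) || (b == 0%N) || (b == m)).
  exact: hbd.
move: hb; rewrite !negb_or => /andP[/andP[/andP[a0 aN] b0] bM].
have aR : (0 < a < n)%N by rewrite lt0n a0 ltn_neqAle aN an'.
have bR : (0 < b < m)%N by rewrite lt0n b0 ltn_neqAle bM bm'.
have := hint a b aR bR.
move: aR bR => /andP[_ aR] /andP[_ bR].
have h1 := hmax a.+1 b aR bm'; have h2 := hmax a.-1 b (leq_trans (leq_pred a) an') bm'.
have h3 := hmax a b.+1 an' bR; have h4 := hmax a b.-1 an' (leq_trans (leq_pred b) bm').
rewrite /F/= in h1 h2 h3 h4; lra.
Qed.

Lemma sector_of_cart (delta : R) (z : R[i]) : 0 < delta -> delta < pi / 2 ->
  0 < complex.Re z -> `|complex.Im z| < tan delta * complex.Re z -> sector delta z.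
Proof.
case: z => a b /= d0 d2 a0 hb.
have ba : `|b / a| < tan delta by rewrite normrM normfV (gtr0_norm a0) ltr_pdivrMr.
have dI : delta \in `](- (pi / 2)), (pi / 2)[ by rewrite in_itv/= d2 andbT; lra.
set th := atan (b / a).
have c0 : 0 < cos th.
  by rewrite cos_gt0_pihalf// atan_gtNpi2 atan_ltpi2.
exists (a / cos th), th; split.
- by rewrite divr_gt0.
- move: ba; rewrite !ltr_norml => /andP[h1 h2]; apply/andP; split.
    by have := lt_atan h1; rewrite atanN tanK.
  by have := lt_atan h2; rewrite tanK.
- congr (_ +i* _); first by rewrite divfK ?gt_eqF.
  have : tan th = b / a by exact: atanK.
  rewrite /tan => h; have -> : sin th = b / a * cos th by rewrite -h divfK ?gt_eqF.
  by field; rewrite !gt_eqF.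
Qed.

End DiscreteMaximum.

Section HolomorphicSemigroup.
Context {R : realType} {X : completeNormedModType R[i]} {T : R -> X -> X}
  (delta : R) (S : R[i]^o -> X -> X) (delta0 : 0 < delta) (delta2 : delta <= pi / 2)
  (hS : holomorphic_semigroup delta S) (hT : C0_semigroup T)
  (hST : forall t, 0 < t -> S t%:C = T t).


Lemma holo_linear z : sector delta z -> linear (S z).
Proof. by move=> /(holo_bounded hS)[]. Qed.

(** Strong continuity at 0 is available in smaller sectors only, hence the half angle; the argument
    is that of [C0_bounded_near0]. *)
Lemma holo_bounded_near0 : exists rho M : R, [/\ 0 < rho, 1 <= M &
  forall z, sector (delta / 2) z -> rnorm (z : R[i]) < rho -> op_bound (S z) M].
Proof.
have dl0 := delta0.
apply: contrapT => h.
have unb (n : nat) : exists z : R[i], [/\ sector (delta / 2) z, rnorm z < n.+1%:R^-1 &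
    ~ op_bound (S z) n.+1%:R].
  apply: contrapT => h'; apply: h; exists n.+1%:R^-1, n.+1%:R.
  rewrite invr_gt0 ltr0n ler1n; split => // z hz zn.
  by apply: contrapT => h''; apply: h'; exists z.
have [z hz] := choice unb.
have sz n : sector delta (z n).
  have [[r [th [r0 hth ->]]] _ _] := hz n; exists r, th; split => //.
  by rewrite (lt_le_trans hth)// ler_pdivrMr// ler_peMr ?ler1n// ltW.
have [|||c hc] := uniform_boundedness (fun n => S (z n)).
- by move=> n; exact: holo_linear.
- by move=> n; have [] := holo_bounded hS (sz n).
- move=> x; have dd : delta / 2 < delta by lra.
  have d20 : 0 < delta / 2 by lra.
  have : S w x @[w --> within (sector (delta / 2)) (nbhs (0 : R[i]^o))] --> x.
    by apply: (holo_cont0 hS).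
  move=> /cvg_rnorm /(_ 1 ltr01); rewrite near_withinE.
  move=> /(nbhs_rnorm (V := R[i]^o))[d d0 hd].
  have [N hN] := archi_gt d^-1.
  have [c hc] : exists c : R, forall n, (n < N)%N -> rnorm (S (z n) x) <= c.
    exists (\sum_(i < N) rnorm (S (z i) x)) => n nN.
    rewrite (bigD1 (Ordinal nN))//= lerDl sumr_ge0// => i _; exact: rnorm_ge0.
  exists (Num.max c (1 + rnorm x)) => n; rewrite le_max.
  have [nN|Nn] := ltnP n N; first by rewrite hc.
  apply/orP; right; apply: le_trans (rnorm_le_sub _ x) _; rewrite lerD2r.
  have [szn zn _] := hz n; apply: hd => //; rewrite subr0 (lt_le_trans zn)//.
  rewrite invf_ple ?posrE//; apply: le_trans (ltW hN) _.
  by rewrite ler_nat leqW.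
have [n cn] := archi_gt c.
have [_ _] := hz n; apply; apply: op_bound_le (hc n).
by rewrite (le_trans (ltW cn))// ler_nat.
Qed.

Lemma sector_near_real (p : R) : 0 < p -> exists2 r : R, 0 < r &
  forall h : R[i], rnorm h <= r -> sector (delta / 2) (p%:C + h).
Proof.
have dl0 := delta0; have dl2 := delta2.
move=> p0; have d20 : 0 < delta / 2 by lra.
have dp : delta / 2 < pi / 2 by have := @pi_gt0 R; lra.
have tan0 : 0 < tan (delta / 2).
  by rewrite divr_gt0 ?sin_gt0_pihalf ?cos_gt0_pihalf ?d20//; lra.
exists (Num.min (p / 2) (tan (delta / 2) * (p / 4))).
  by rewrite lt_min !divr_gt0//= mulr_gt0// divr_gt0.
move=> h; rewrite le_min => /andP[h1 h2].
have ha := le_trans (Re_le_rnorm h) h1; have hb := le_trans (Im_le_rnorm h) h2.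
have Rep : p / 2 <= p + complex.Re h by move: ha; rewrite ler_norml => /andP[? ?]; lra.
have -> : p%:C + h = (p + complex.Re h) +i* complex.Im h.
  by case: (h) => a b /=; rewrite /real_complex_def; apply/eqP; rewrite eq_complex/= add0r !eqxx.
apply: sector_of_cart => //=; first by lra.
rewrite (le_lt_trans hb)// ltr_pM2l//; lra.
Qed.

Lemma sector_half z : sector (delta / 2) z -> sector delta z.
Proof.
have dl0 := delta0.
move=> [r [th [r0 hth ->]]]; exists r, th; split => //.
by rewrite (lt_le_trans hth)//; lra.
Qed.

Lemma holo_diff (p : R) : 0 < p -> exists (D : X -> X) (k : R),
  [/\ linear D, 0 <= k, op_bound D k & forall e : R, 0 < e -> exists2 r : R, 0 < r &
    forall h : R[i], rnorm h <= r ->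
      op_bound (fun x => S (p%:C + h) x - S p%:C x - h *: D x) (e * rnorm h)].
Proof.
move=> p0; have [r1 r10 hr1] := sector_near_real _ p0.
have hz : sector delta p%:C.
  by apply: sector_half; rewrite -[p%:C]addr0; apply: hr1; rewrite rnorm0 ltW.
have [D [[lD cD] hD]] := holo_holo hS hz.
have [k k0 hk] := continuous_op_bound _ lD cD.
exists D, k; split => // e e0.
have : \forall h \near (0 : R[i]^o)^',
    (opnorm (fun x => (h^-1 *: (S (p%:C + h) x - S p%:C x) - D x)%R) <= e%:E)%E.
  have /fine_cvgP[fin /cvgrPdist_lt /(_ e e0)] := hD.
  apply: filterS2 fin => h fh; rewrite /= sub0r normrN => he.
  by rewrite -(fineK fh) lee_fin (le_trans (ler_norm _))// ltW.
rewrite near_withinE => /(nbhs_rnorm (V := R[i]^o))[d d0 hd].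
exists (Num.min (d / 2) r1); first by rewrite lt_min r10 divr_gt0.
move=> h; rewrite le_min => /andP[hh hhr] x; have [->|h0] := eqVneq h 0.
  by rewrite addr0 subrr scale0r subrr !rnorm0 mulr0 mul0r.
have hlt : rnorm h < d by lra.
have := hd h; rewrite subr0 => /(_ hlt h0) hop.
have l1 := holo_linear _ (sector_half _ (hr1 h hhr)).
have l2 := holo_linear _ hz.
have lF : linear (fun x => h^-1 *: (S (p%:C + h) x - S p%:C x) - D x).
  move=> a u v; rewrite lD l1 l2.
  have -> : a *: S (p%:C + h) u + S (p%:C + h) v - (a *: S p%:C u + S p%:C v) =
     a *: (S (p%:C + h) u - S p%:C u) + (S (p%:C + h) v - S p%:C v).
    by rewrite opprD addrACA scalerBr.
  by rewrite scalerDr opprD addrACA [in RHS]scalerBr !scalerA (mulrC a).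
have := opnorm_op_bound _ _ lF hop x.
have nh : 0 < rnorm h.
  by rewrite lt_neqAle rnorm_ge0 andbT eq_sym; apply: contra h0 => /eqP/rnorm_eq0/eqP.
rewrite -(ler_pM2l nh) -rnormZ scalerBr scalerA divff// scale1r => /le_trans; apply.
by rewrite mulrA [e * _]mulrC.
Qed.

(* The second difference of a semigroup is a product of first differences, so
   first-order differentiability at [p] gives a second-order expansion at
   [2 * p]; the quadratic terms of the directions [h] and ['i * h] cancel. *)
Lemma four_point (p e : R) : 0 < p -> 0 < e -> exists2 r : R, 0 < r &
  forall h : R, 0 < h <= r ->
  [/\ sector (delta / 2) ((2 * p)%:C + h%:C), sector (delta / 2) ((2 * p)%:C - h%:C),
      sector (delta / 2) ((2 * p)%:C + 'i * h%:C),
      sector (delta / 2) ((2 * p)%:C - 'i * h%:C) & forall x,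
    rnorm (S ((2 * p)%:C + h%:C) x + S ((2 * p)%:C - h%:C) x +
      S ((2 * p)%:C + 'i * h%:C) x + S ((2 * p)%:C - 'i * h%:C) x
      - 4%:R *: S (2 * p)%:C x) <= e * h ^+ 2 * rnorm x].
Proof.
move=> p0 e0; have p20 : 0 < 2 * p by lra.
have [r1 r10 hr1] := sector_near_real _ p0.
have [r2 r20 hr2] := sector_near_real _ p20.
have [D [k [lD k0 hk hD]]] := holo_diff _ p0.
(* The two directions together cost [2 * (2 * k * e' + e' ^+ 2)], and [e' <= 1] makes this linear in
   [e']. *)
pose e' := Num.min 1 (e / (4 * (2 * k + 1))).
have k1 : 0 < 4 * (2 * k + 1) by lra.
have e'0 : 0 < e' by rewrite lt_min ltr01 divr_gt0.
have e'1 : e' <= 1 by rewrite ge_min lexx.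
have e'e : e' * (4 * (2 * k + 1)) <= e by rewrite -ler_pdivlMr// ge_min lexx orbT.
have [r3 r30 hr3] := hD _ e'0.
have sp : sector delta p%:C.
  by apply: sector_half; rewrite -[p%:C]addr0; apply: hr1; rewrite rnorm0 ltW.
have lSp := holo_linear _ sp.
have pp : p%:C + p%:C = (2 * p)%:C by rewrite -rmorphD; congr (_%:C); ring.
have second (w : R[i]) x : rnorm w <= r1 -> rnorm w <= r3 ->
    rnorm (S ((2 * p)%:C + w) x + S ((2 * p)%:C - w) x - 2%:R *: S (2 * p)%:C x
      - w ^+ 2 *: D (D x)) <= rnorm w ^+ 2 * (2 * k * e' + e' ^+ 2) * rnorm x.
  move=> w1 w3.
  have w1' : rnorm (- w) <= r1 by rewrite rnormN.
  have w3' : rnorm (- w) <= r3 by rewrite rnormN.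
  have s1 := sector_half _ (hr1 w w1); have s2 := sector_half _ (hr1 _ w1').
  have l1 := holo_linear _ s1; have l2 := holo_linear _ s2.
  pose E1 y := S (p%:C + w) y - S p%:C y - w *: D y.
  pose E2 y := S (p%:C - w) y - S p%:C y - (- w) *: D y.
  have b1 : op_bound E1 (e' * rnorm w) by exact: hr3.
  have b2 : op_bound E2 (e' * rnorm w).
    by have := hr3 _ w3'; rewrite rnormN.
  set y := S (p%:C - w) x - S p%:C x.
  have yE : y = E2 x - w *: D x by rewrite /E2 scaleNr opprK addrK.
  have -> : S ((2 * p)%:C + w) x + S ((2 * p)%:C - w) x - 2%:R *: S (2 * p)%:C x =
     - (S (p%:C + w) y - S p%:C y).
    rewrite /y (linear_subr l1) (linear_subr lSp).
    have e1 : S (p%:C + w) (S (p%:C - w) x) = S (2 * p)%:C x.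
      have := holo_D hS s1 s2; rewrite addrACA subrr addr0 pp => ->//.
    have e2 : S (p%:C + w) (S p%:C x) = S ((2 * p)%:C + w) x.
      have := holo_D hS s1 sp; rewrite addrAC pp => ->//.
    have e3 : S p%:C (S (p%:C - w) x) = S ((2 * p)%:C - w) x.
      have := holo_D hS sp s2; rewrite addrA pp => ->//.
    have e4 : S p%:C (S p%:C x) = S (2 * p)%:C x.
      have := holo_D hS sp sp; rewrite pp => ->//.
    rewrite e1 e2 e3 e4 scaler_nat mulr2n !opprB.
    set A := S (2 * p)%:C x; set B1 := S _ x; set B2 := S _ x.
    by rewrite opprD addrACA addrC.
  have -> : S (p%:C + w) y - S p%:C y = E1 y + w *: D y by rewrite /E1 subrK.
  have -> : - (E1 y + w *: D y) - w ^+ 2 *: D (D x) = - (E1 y + w *: D (E2 x)).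
    rewrite yE (linear_subr lD) (linear_scale lD) scalerBr scalerA -expr2.
    by rewrite -opprD -addrA subrK.
  have ny : rnorm y <= (e' + k) * rnorm w * rnorm x.
    rewrite yE (le_trans (rnormB _ _))// !mulrDl lerD// ?b2//.
    rewrite rnormZ [leRHS](_ : _ = rnorm w * (k * rnorm x)); last by ring.
    by rewrite ler_wpM2l ?rnorm_ge0.
  have nw := rnorm_ge0 w; have nx := rnorm_ge0 x.
  rewrite rnormN (le_trans (rnormD _ _))//.
  rewrite [leRHS](_ : _ = e' * rnorm w * ((e' + k) * rnorm w * rnorm x) +
    rnorm w * (k * (e' * rnorm w * rnorm x))); last by ring.
  apply: lerD.
    by rewrite (le_trans (b1 _))// ler_wpM2l// mulr_ge0// ltW.
  by rewrite rnormZ ler_wpM2l// (le_trans (hk _))// ler_wpM2l.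
exists (Num.min r1 (Num.min r2 r3)); first by rewrite !lt_min r10 r20.
move=> h /andP[h0]; rewrite !le_min => /and3P[h1 h2 h3].
have nh : rnorm (h%:C) = h by rewrite rnormR gtr0_norm.
have nih : rnorm ('i * h%:C) = h by rewrite rnormM rnormi mul1r.
split; try by apply: hr2; rewrite ?rnormN ?nh ?nih.
move=> x; have := second h%:C x; have := second ('i * h%:C) x.
rewrite nh nih => /(_ h1 h3) g1 /(_ h1 h3) g2.
have -> : S ((2 * p)%:C + h%:C) x + S ((2 * p)%:C - h%:C) x +
    S ((2 * p)%:C + 'i * h%:C) x + S ((2 * p)%:C - 'i * h%:C) x - 4%:R *: S (2 * p)%:C x =
  (S ((2 * p)%:C + h%:C) x + S ((2 * p)%:C - h%:C) x - 2%:R *: S (2 * p)%:C x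
      - h%:C ^+ 2 *: D (D x)) +
  (S ((2 * p)%:C + 'i * h%:C) x + S ((2 * p)%:C - 'i * h%:C) x - 2%:R *: S (2 * p)%:C x
      - ('i * h%:C) ^+ 2 *: D (D x)).
  rewrite [('i * _) ^+ 2]exprMn sqr_i mulN1r scaleNr opprK.
  set A := _ *: D (D x); set Y := S (2 * p)%:C x.
  rewrite [RHS]addrACA addNr addr0 [RHS]addrACA -opprD -scalerDl -natrD.
  by rewrite [X in _ = X - _]addrA.
rewrite (le_trans (rnormD _ _))// (le_trans (lerD g2 g1))//.
rewrite -mulrDl ler_wpM2r ?rnorm_ge0// -mulrDr mulrC ler_wpM2r ?sqr_ge0//.
rewrite (le_trans _ e'e)//.
have : e' ^+ 2 <= e' by rewrite expr2 ler_piMl// ltW.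
have := mulr_ge0 k0 (ltW e'0); lra.
Qed.

End HolomorphicSemigroup.

(** The points of the rectangle around [c], and their translates to the left by [c / 4], stay where
    the semigroup is bounded. *)
Lemma rectangle_bounds {R : realType} (c a rho : R) : 0 < c -> 2 * c < rho / 2 ->
  `|a| <= 1 / 4 * c ->
  [/\ 0 < c + a, c <= 2 * (c + a), 3 / 2 * (c + a) < rho &
   [/\ 0 < c + a - 2 * (c / 8), c <= 2 * (c + a - 2 * (c / 8)) &
    3 / 2 * (c + a - 2 * (c / 8)) < rho]].
Proof. by move=> c0 cr; rewrite ler_norml => /andP[? ?]; repeat split; lra. Qed.

Lemma inv_le_aux {R : realType} (m x d : R) : 0 < m -> 0 < d -> d <= 2 * (m * x) ->
  4 * (1 / m) <= 8 * (x / d).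
Proof.
move=> m0 d0 h; rewrite mulrA mulr1 ler_pdivrMr//.
rewrite [leRHS](_ : _ = 8 * x * m / d); last by ring.
by rewrite ler_pdivlMr//; lra.
Qed.

(** Reflection exchanges left and right neighbours, whence the crossed pairs [a1 - b2] and
    [a2 - b1]. *)
Lemma difference_regroup (V : zmodType) (a1 a2 a3 a4 b1 b2 b3 b4 f g : V) :
  f - g = (a1 - b2) + (a2 - b1) + (a3 - b3) + (a4 - b4) -
    ((a1 + a2 + a3 + a4 - f) - (b1 + b2 + b3 + b4 - g)).
Proof.
have -> : (a1 - b2) + (a2 - b1) + (a3 - b3) + (a4 - b4) =
    (a1 + a2 + a3 + a4) - (b1 + b2 + b3 + b4).
  rewrite [X in X + (a3 - b3)]addrACA [X in X + (a4 - b4)]addrACA [LHS]addrACA.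
  by rewrite -!opprD (addrC b2).
set Sa := a1 + a2 + a3 + a4; set Sb := b1 + b2 + b3 + b4.
have -> : Sa - f - (Sb - g) = Sa - Sb - (f - g).
  by rewrite opprB [g - Sb]addrC addrACA opprB [- f + g]addrC.
by rewrite opprB [RHS]addrC subrK.
Qed.

Lemma superharmonic_gap {R : realType} (v v1 v2 v3 v4 b b1 b2 b3 b4 err k : R) :
  4 * v <= v1 + v2 + v3 + v4 + 2 * err -> b1 + b2 + b3 + b4 - 4 * b = - k ->
  2 * err < k -> 4 * (v - b) < (v1 - b1) + (v2 - b2) + (v3 - b3) + (v4 - b4).
Proof. lra. Qed.

Lemma barrier_ge1 {R : realType} (s : R) : 0 <= s -> s <= 1 ->
  1 <= 1 + 4 * s - 2 * s ^+ 2.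
Proof. nra. Qed.

Lemma barrier_end {R : realType} (q : R) : 1 <= q ^+ 2 + 4 * 1 - 2 * 1 ^+ 2.
Proof. have := sqr_ge0 q; rewrite expr1n; lra. Qed.

Lemma abs_sub_le {R : realType} (a b : R) : 0 <= a -> a <= 2 * b -> `|a - b| <= b.
Proof. by move=> ? ?; rewrite ler_norml; apply/andP; split; lra. Qed.

Section SymmetricDifference.
Context {R : realType} {X : completeNormedModType R[i]} {T : R -> X -> X}
  (delta : R) (S : R[i]^o -> X -> X) (delta0 : 0 < delta) (delta2 : delta <= pi / 2)
  (hS : holomorphic_semigroup delta S) (hST : forall t, 0 < t -> S t%:C = T t).

(* [S (c + x + 'i y) - S (c - x + 'i y)] is harmonic, vanishes for [x = 0] and is
   bounded; the quadratic barrier [A * ((y / d) ^ 2 + 4 x / d - 2 (x / d) ^ 2)]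
   is superharmonic and dominates it on the boundary of a rectangle, hence at
   [y = 0], where it is linear in [x]. *)
Lemma symmetric_difference : exists C rho : R, [/\ 0 < C, 0 < rho, C <= 1 &
  exists2 M : R, 1 <= M & (forall t, 0 < t < rho -> op_bound (T t) M) /\
  forall c x y, 0 < c -> 2 * c < rho -> 0 < x -> 2 * x <= C * c ->
    rnorm (T (c + x) y - T (c - x) y) <= 16 * M * (x / (C * c)) * rnorm y].
Proof.
have dl0 := delta0; have dl2 := delta2; have pi0 := @pi_gt0 R.
have [rho [M [rho0 M1 hM]]] := holo_bounded_near0 _ _ delta0 hS.
have M0 : 0 < M by lra.
have d20 : 0 < delta / 2 by lra.
have dp : delta / 2 < pi / 2 by lra.
have [kap kapE] : exists k, tan (delta / 2) = k by exists (tan (delta / 2)).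
have kap0 : 0 < kap.
  by rewrite -kapE divr_gt0 ?sin_gt0_pihalf ?cos_gt0_pihalf ?d20//; lra.
(* Half the side of the rectangle is [eta * c]; the two bounds keep it inside the disc of radius
   [rho] and inside the sector of slope [kap]. *)
pose eta := Num.min (1 / 4) (kap / 4).
have eta0 : 0 < eta by rewrite lt_min !divr_gt0.
have eta4 : eta <= 1 / 4 by rewrite ge_min lexx.
have etak : eta <= kap / 4 by rewrite ge_min lexx orbT.
have region (a b : R) : 0 < a -> `|b| <= eta * (2 * a) -> 3 / 2 * a < rho ->
    sector (delta / 2) (a +i* b) /\ rnorm (a +i* b) < rho.
  move=> a0 hb arho; have b2 : `|b| <= kap / 4 * (2 * a).
    by rewrite (le_trans hb)// ler_wpM2r//; lra.
  have b3 : `|b| <= 1 / 4 * (2 * a) by rewrite (le_trans hb)// ler_wpM2r//; lra.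
  split.
    apply: sector_of_cart => //=; rewrite kapE (le_lt_trans b2)//.
    by have := mulr_gt0 kap0 a0; lra.
  rewrite (le_lt_trans (rnorm_le_ReIm _))//= gtr0_norm//; lra.
clearbody eta; clear kap kapE kap0 etak.
exists eta, (rho / 2); split => //; [by rewrite divr_gt0|by lra|].
have MT t : 0 < t < rho / 2 -> op_bound (T t) M.
  move=> /andP[t0 trho]; rewrite -hST//.
  have [] := region t 0 t0 _ _; rewrite ?normr0 ?mulr_ge0 ?(ltW eta0) ?(ltW t0)//; first by lra.
  by move=> h1 h2; exact: (hM (t%:C) h1 h2).
exists M => //; split => // c x1 y c0 crho x10 x1c.
(* The barrier has height proportional to [rnorm y] and is strictly superharmonic only for nonzero
   [y]. *)
have [->|y0] := eqVneq y 0.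
  have x1c' : x1 < c.
    have := ler_wpM2r (ltW c0) eta4; lra.
  have lz t : 0 < t -> t < rho / 2 -> T t 0 = 0.
    by move=> t0 tr; apply: rnorm_eq0; apply/eqP; rewrite eq_le rnorm_ge0 andbT;
       have := MT t _ 0; rewrite rnorm0 mulr0; apply; rewrite t0.
  by rewrite !lz ?subrr ?rnorm0 ?mulr0//; lra.
have ny : 0 < rnorm y.
  by rewrite lt_neqAle rnorm_ge0 andbT eq_sym; apply: contra y0 => /eqP/rnorm_eq0/eqP.
pose d0 := eta * c.
have d00 : 0 < d0 by rewrite mulr_gt0.
have d04 : d0 <= 1 / 4 * c by rewrite /d0 ler_wpM2r// ltW.
have x1d : 2 * x1 <= d0 by [].
have xc : x1 < c by lra.
(* The rectangle gets half-width [m * x1], between [d0 / 2] and [d0], so that [x1] is an abscissa of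
   the grid. *)
pose m := Num.truncn (d0 / x1).
have /andP[m1 m2] : m%:R * x1 <= d0 < m.+1%:R * x1.
  rewrite -ler_pdivlMr// -ltr_pdivrMr//; apply: truncn_itv.
  by rewrite divr_ge0// ltW.
have m0 : (0 < m)%N.
  by rewrite /m truncn_gt0 ler_pdivlMr// mul1r; lra.
have mR : 1 <= m%:R :> R by rewrite ler1n.
have md : d0 <= 2 * (m%:R * x1).
  have : x1 <= m%:R * x1 by rewrite ler_peMl// ltW.
  by move: m2; rewrite -natr1 mulrDl mul1r; lra.
(* The four-point estimate is taken once, at [2 * p], and carried to each grid point by S(Pt - 2p);
   its step bound thus holds for the whole grid. *)
pose p := c / 8; have p0 : 0 < p by rewrite divr_gt0.
have p3 : 3 / 2 * (2 * p) < rho by rewrite /p; lra.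
have p2 : 0 < 2 * p by rewrite mulr_gt0.
(* With this accuracy the defect of harmonicity stays below the [2 * A / n ^+ 2] that the barrier
   provides. *)
have e0 : 0 < 1 / d0 ^+ 2 by rewrite divr_gt0// exprn_gt0.
have [r r0 hr] := four_point _ _ delta0 delta2 hS _ _ p0 e0.
have [N' hN'] := archi_gt (x1 / r).
pose N := N'.+1; have NR : 0 < N%:R :> R by rewrite ltr0n.
pose h := x1 / N%:R; have h0 : 0 < h by rewrite divr_gt0.
have hh : 0 < h <= r.
  rewrite h0 ler_pdivrMr// -ler_pdivrMl// mulrC (le_trans (ltW hN'))//.
  by rewrite ler_nat.
have [q1 q2 q3 q4 hq] := hr h hh.
pose n := (m * N)%N; have n0 : (0 < n)%N by rewrite muln_gt0 m0.
have nR : 0 < n%:R :> R by rewrite ltr0n.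
have nh : n%:R * h = m%:R * x1.
  by rewrite /n natrM /h; field; rewrite gt_eqF.
have nhd : n%:R * h <= d0 by rewrite nh.
pose Pt (s u : R) : R[i] := (c + s * h) +i* (u * h).
pose F s u := S (Pt s u) y.
have coord (s : R) : `|s| <= n%:R -> `|s * h| <= d0.
  by move=> hs; rewrite normrM (gtr0_norm h0) (le_trans _ nhd)// ler_wpM2r// ltW.
have inside (s u : R) : `|s| <= n%:R -> `|u| <= n%:R ->
    [/\ sector (delta / 2) (Pt s u), rnorm (Pt s u) < rho,
        sector (delta / 2) (Pt s u - (2 * p)%:C) & rnorm (Pt s u - (2 * p)%:C) < rho].
  move=> /coord hs /coord hu.
  have [a1 a2 a3 [a4 a5 a6]] := rectangle_bounds c _ rho c0 crho (le_trans hs d04).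
  have ha (a : R) : c <= 2 * a -> `|u * h| <= eta * (2 * a).
    by move=> ca; rewrite (le_trans hu)// /d0 ler_wpM2l ?(ltW eta0).
  have [g1 g2] := region (c + s * h) (u * h) a1 (ha _ a2) a3.
  have pE : Pt s u - (2 * p)%:C = (c + s * h - 2 * p) +i* (u * h).
    by apply/eqP; rewrite eq_complex/= oppr0 addr0 !eqxx.
  have [g3 g4] := region (c + s * h - 2 * p) (u * h) a4 (ha _ a5) a6.
  by rewrite pE.
have lap (s u : R) : `|s| <= n%:R -> `|u| <= n%:R ->
    rnorm (F (s + 1) u + F (s - 1) u + F s (u + 1) + F s (u - 1) - 4%:R *: F s u) <=
    M * (1 / d0 ^+ 2 * h ^+ 2 * rnorm y).
  move=> hs hu; have [g1 g2 g3 g4] := inside s u hs hu.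
  have l3 := holo_linear _ _ hS _ (sector_half _ delta0 _ g3).
  have st (w : R[i]) z : sector (delta / 2) ((2 * p)%:C + w) ->
      Pt s u + w = z -> S z y = S (Pt s u - (2 * p)%:C) (S ((2 * p)%:C + w) y).
    move=> hw <-; have := holo_D hS (sector_half _ delta0 _ g3) (sector_half _ delta0 _ hw).
    by rewrite addrA subrK => ->.
  have q0 : sector (delta / 2) ((2 * p)%:C + 0 : R[i]).
    rewrite addr0; have [] := region (2 * p) 0 p2 _ p3 => //.
    by rewrite normr0 !mulr_ge0 ?(ltW eta0)// ltW.
  have -> : F (s + 1) u + F (s - 1) u + F s (u + 1) + F s (u - 1) - 4%:R *: F s u =
    S (Pt s u - (2 * p)%:C) (S ((2 * p)%:C + h%:C) y + S ((2 * p)%:C - h%:C) y +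
      S ((2 * p)%:C + 'i * h%:C) y + S ((2 * p)%:C - 'i * h%:C) y
      - 4%:R *: S (2 * p)%:C y).
    rewrite (linear_subr l3) !(linear_add l3) (linear_scale l3) /F.
    rewrite (st _ (Pt (s + 1) u) q1); last first.
      by apply/eqP; rewrite eq_complex/= addr0 mulrDl mul1r addrA !eqxx.
    rewrite (st _ (Pt (s - 1) u) q2); last first.
      by apply/eqP; rewrite eq_complex/= oppr0 addr0 mulrBl mul1r addrA !eqxx.
    rewrite (st _ (Pt s (u + 1)) q3); last first.
      apply/eqP; rewrite eq_complex/= !(mul0r, mulr0, mul1r, addr0, subr0, add0r).
      by rewrite mulrDl mul1r !eqxx.
    rewrite (st _ (Pt s (u - 1)) q4); last first.
      apply/eqP; rewrite eq_complex/= !(mul0r, mulr0, mul1r, addr0, subr0, add0r, oppr0).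
      by rewrite mulrBl mul1r !eqxx.
    by rewrite (st 0 (Pt s u) q0) ?addr0.
  by rewrite (le_trans (hM _ g3 g4 _))// ler_wpM2l ?(ltW M0).
(* The index [j] runs up to [2 * n] with the real axis at [j = n]. *)
pose H (i j : nat) := F i%:R (j%:R - n%:R) - F (- i%:R) (j%:R - n%:R).
pose A := 2 * M * rnorm y; have A0 : 0 < A by rewrite !mulr_gt0.
pose b (i j : nat) := A * (((j%:R - n%:R) / n%:R) ^+ 2 + 4 * (i%:R / n%:R) - 2 * (i%:R / n%:R) ^+ 2).
pose V i j := rnorm (H i j) - b i j.
have iR (i : nat) : (i <= n)%N -> `|i%:R : R| <= n%:R by move=> hi; rewrite ger0_norm// ler_nat.
have jR (j : nat) : (j <= 2 * n)%N -> `|j%:R - n%:R : R| <= n%:R.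
  by rewrite -(ler_nat R) natrM; exact: (abs_sub_le _ _ (ler0n R j)).
have Vle : forall i j, (i <= n)%N -> (j <= 2 * n)%N -> V i j <= 0.
  apply: discrete_maximum_principle.
    move=> i j /andP[i0 iN] /andP[j0 jN].
    have hi := iR i (ltnW iN); have hj := jR j (ltnW jN).
    have lp := lap _ _ hi hj.
    have hi' : `|- (i%:R : R)| <= n%:R by rewrite normrN.
    have lm := lap _ _ hi' hj.
    set err := M * _ in lp lm.
    have eA : 2 * err < 2 * A / n%:R ^+ 2.
      rewrite ltr_pdivlMr ?exprn_gt0// /err.
      have -> : 2 * (M * (1 / d0 ^+ 2 * h ^+ 2 * rnorm y)) * n%:R ^+ 2 =
         A * ((n%:R * h) / d0) ^+ 2 by rewrite /A; field; rewrite gt_eqF.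
      rewrite (@le_lt_trans _ _ A)//; last by rewrite mulr_natl mulr2n ltrDl.
      rewrite ler_piMr ?(ltW A0)// expr_le1//; last by rewrite divr_ge0 ?(ltW d00)// mulr_ge0// ltW.
      by rewrite ler_pdivrMr// mul1r.
    have i1 : i.-1%:R = i%:R - 1 :> R by rewrite -[in RHS](prednK i0) -natr1 addrK.
    have j1 : j.-1%:R = j%:R - 1 :> R by rewrite -[in RHS](prednK j0) -natr1 addrK.
    have bE : b i.+1 j + b i.-1 j + b i j.+1 + b i j.-1 - 4 * b i j = - (2 * A / n%:R ^+ 2).
      rewrite /b i1 j1 -!natr1; field; rewrite gt_eqF//.
    have HE : 4 * rnorm (H i j) <= rnorm (H i.+1 j) + rnorm (H i.-1 j) +
        rnorm (H i j.+1) + rnorm (H i j.-1) + 2 * err.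
      have -> : 4 * rnorm (H i j) = rnorm (4%:R *: H i j) by rewrite rnormZ rnorm_nat.
      set L := F (i%:R + 1) _ + _ + _ + _ - _ in lp.
      set L' := F (- i%:R + 1) _ + _ + _ + _ - _ in lm.
      have -> : 4%:R *: H i j = H i.+1 j + H i.-1 j + H i j.+1 + H i j.-1 - (L - L').
        rewrite /H -(natr1 i) -(natr1 j) i1 j1 (opprD i%:R 1) (opprD i%:R (- 1)) (opprK 1) ![j%:R + _ - n%:R]addrAC.
        by rewrite scalerBr; exact: difference_regroup.
      rewrite (le_trans (rnormB _ _))// lerD//.
        rewrite (le_trans (rnormD _ _))// lerD// (le_trans (rnormD _ _))// lerD//.
        exact: rnormD.
      by rewrite (le_trans (rnormB _ _))// mulr_natl mulr2n lerD.
    exact: (superharmonic_gap _ _ _ _ _ _ _ _ _ _ _ _ HE bE eA).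
  move=> i j iN jN hb; rewrite /V subr_le0.
  have [g1 g2 _ _] := inside _ _ (iR i iN) (jR j jN).
  have hi' : `|- (i%:R : R)| <= n%:R by rewrite normrN; exact: iR.
  have [g3 g4 _ _] := inside _ _ hi' (jR j jN).
  have HA : rnorm (H i j) <= A.
    rewrite (le_trans (rnormB _ _))// [A](_ : _ = M * rnorm y + M * rnorm y); last first.
      by rewrite /A; ring.
    by rewrite lerD//; exact: hM.
  have is0 : 0 <= i%:R / n%:R :> R by rewrite divr_ge0.
  have is1 : i%:R / n%:R <= 1 :> R by rewrite ler_pdivrMr// mul1r ler_nat.
  move: hb is0 is1; rewrite /b; set s := i%:R / n%:R; set q := (j%:R - n%:R) / n%:R.
  move=> hb s0 s1; have q20 := sqr_ge0 q.
  (* At [i = 0] the difference vanishes; on the other sides the bracket of the barrier is at least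
     1, and [A] bounds the difference. *)
  case/orP: hb => [/orP[/orP[/eqP i0|/eqP ie]|/eqP j0]|/eqP je].
  - rewrite /H i0 oppr0 subrr rnorm0 mulr_ge0 ?(ltW A0)//.
    by rewrite /s i0 mul0r mulr0 expr0n mulr0 subr0 addr0.
  - rewrite (le_trans HA)// ler_peMr ?(ltW A0)//.
    have -> : s = 1 by rewrite /s ie divff ?gt_eqF.
    exact: barrier_end.
  - rewrite (le_trans HA)// ler_peMr ?(ltW A0)//.
    have -> : q = -1 by rewrite /q j0 sub0r mulNr divff ?gt_eqF.
    by rewrite sqrrN expr1n barrier_ge1.
  - rewrite (le_trans HA)// ler_peMr ?(ltW A0)//.
    have -> : q = 1 by rewrite /q je natrM; field; rewrite gt_eqF.
    by rewrite expr1n barrier_ge1.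
have Nn : (N <= n)%N by rewrite /n leq_pmull.
have nn : (n <= 2 * n)%N by rewrite leq_pmull.
have := Vle N n Nn nn; rewrite /V subr_le0 /H /b subrr.
have Nh : N%:R * h = x1 by rewrite /h mulrC divfK ?gt_eqF.
have PtE (s : R) : F s 0 = S (c + s * h)%:C y by rewrite /F /Pt mul0r.
rewrite !PtE mulNr Nh => /le_trans.
rewrite !hST ?subr_gt0 ?addr_gt0//; apply.
have Nn' : N%:R / n%:R = 1 / m%:R :> R.
  by rewrite /n natrM; field; rewrite !gt_eqF// ltr0n.
rewrite Nn' mul0r expr0n add0r.
have mp : 0 < m%:R :> R by rewrite ltr0n.
apply: (@le_trans _ _ (A * (4 * (1 / m%:R)))).
  by rewrite ler_wpM2l ?(ltW A0)// gerBl mulr_ge0// sqr_ge0.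
rewrite /A [leRHS](_ : _ = 2 * M * rnorm y * (8 * (x1 / d0))); last by rewrite /d0; ring.
rewrite ler_wpM2l ?(ltW A0)//.
by rewrite inv_le_aux.
Qed.

End SymmetricDifference.

(** * Powers of polynomials *)

Lemma orbit_lipschitz_of_holomorphic {R : realType} {X : completeNormedModType R[i]}
    {T : R -> X -> X} : C0_semigroup T -> extends_holomorphically T -> orbit_lipschitz T.
Proof.
move=> hT [delta [S [delta0 delta2 hS hST]]].
have [C [rho [C0 rho0 C1 [M M1 [hM hsym]]]]] := symmetric_difference _ _ delta0 delta2 hS hST.
have M0 : 0 < M by lra.
exists (16 * M / C), (rho / 4); split; [by rewrite divr_gt0// mulr_gt0|by rewrite divr_gt0|].
move=> t d x /andP[t0 tr] /andP[d0 dt]; have nx := rnorm_ge0 x.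
have [d00|d00] := eqVneq d 0.
  by rewrite d00 addr0 subrr rnorm0 mul0r mulr0 mul0r.
have dpos : 0 < d by rewrite lt_neqAle eq_sym d00.
have E : 16 * M / C * (d / t) * rnorm x = 16 * M * (d / (C * t)) * rnorm x.
  by field; rewrite !gt_eqF.
rewrite E; have Ct : 0 < C * t by rewrite mulr_gt0.
have c0 : 0 < t + d / 2 by lra.
(* The increment is centred at its midpoint [t + d / 2]. If it is too long for the symmetric
   estimate, [d / (C * t)] is at least 1 and boundedness is enough. *)
have [small|large] := leP d (C * (t + d / 2)).
  have := hsym (t + d / 2) (d / 2) x c0 ltac:(lra) ltac:(lra) ltac:(lra).
  have -> : t + d / 2 + d / 2 = t + d by field.
  have -> : t + d / 2 - d / 2 = t by field.
  move=> /le_trans; apply; rewrite ler_wpM2r// ler_wpM2l ?mulr_ge0 ?(ltW M0)//.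
  apply: ler_pM; [by lra|by rewrite invr_ge0 mulr_ge0// ltW|by lra|].
  by rewrite lef_pV2 ?posrE ?mulr_gt0// ler_pM2l//; lra.
have b1 : rnorm (T (t + d) x) <= M * rnorm x by apply: hM; apply/andP; split; lra.
have b2 : rnorm (T t x) <= M * rnorm x by apply: hM; apply/andP; split; lra.
rewrite (le_trans (rnormB _ _))// (le_trans (lerD b1 b2))// -mulrDl ler_wpM2r//.
have : 1 <= d / (C * t).
  rewrite ler_pdivlMr// mul1r; have : C * t <= C * (t + d / 2) by rewrite ler_pM2l//; lra.
  lra.
move=> h; have := ler_wpM2l (ltW M0) h; lra.
Qed.

Section PolynomialEstimate.
Context {R : realType} {X : completeNormedModType R[i]} {T : R -> X -> X}
  (hT : C0_semigroup T).

Lemma limsup_poly_power (f : {poly R[i]}) : orbit_lipschitz T -> C1poly f ->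
  exists N0 : nat, forall N : nat, (N0 <= N)%N ->
    exists K0 : R, 0 <= K0 /\ forall K : R, K0 <= K ->
      (limsup_at0 (fun t : R => opnorm (op_poly (f ^+ N) (T t) \o T (K * t)%R))
         < disc_norm (f ^+ N))%E.
Proof.
move=> [C [t1 [C0 t10 hL]]] hf.
have [_ [z /= z1 <-] fz] : exists2 r, [set (rnorm f.[z])%:E | z in [set z : R[i] | rnorm z <= 1]] r
    & ((rnorm f.[1%R])%:E < r)%E by apply/ereal_sup_gtP.
rewrite lte_fin in fz; set al := rnorm f.[1] in fz; set be := rnorm f.[z] in fz.
have al0 : 0 <= al by exact: rnorm_ge0.
have be0 : 0 < be by exact: le_lt_trans fz.
have [M M1 hM] := C0_bounded_on hT (Num.max 1 t1).
have M0 : 0 < M by lra.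
have ab : 0 <= al / be < 1 by rewrite divr_ge0 ?(ltW be0)//= ltr_pdivrMr// mul1r.
have e0 : 0 < 1 / (2 * M) by rewrite divr_gt0// mulr_gt0.
(* The power [N] must beat the bound [M] of the semigroup: [al ^+ N * M] falls below half of
   [be ^+ N]. *)
have [N0 hN0] := expr_lt_eps _ _ ab e0.
exists N0 => N NN; have {hN0} := hN0 N NN.
rewrite expr_div_n ltr_pdivrMr ?exprn_gt0// => hal.
have beN : 0 < be ^+ N by rewrite exprn_gt0.
have halM : al ^+ N * M < be ^+ N / 2.
  rewrite -ltr_pdivlMr// (lt_le_trans hal)// le_eqVlt; apply/orP; left; apply/eqP.
  by field; rewrite gt_eqF.
set g := f ^+ N.
set c := \sum_(k < size g) rnorm g`_k * (k%:R * M ^+ k).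
have c0 : 0 <= c.
  apply: sumr_ge0 => k _; rewrite mulr_ge0 ?rnorm_ge0// mulr_ge0// exprn_ge0//.
  exact: ltW.
have cC : 0 <= 4 * c * C / be ^+ N by rewrite divr_ge0 ?(ltW beN)// !mulr_ge0// ltW.
(* The 4 makes [t] at most a quarter of [K * t], as the Lipschitz estimate demands. The other
   summand brings [c * C / K] below a quarter of [be ^+ N], for a total of three quarters. *)
exists (4 + 4 * c * C / be ^+ N); split; first by rewrite addr_ge0.
move=> K hK.
have K4 : 4 <= K by lra.
have K0 : 0 < K by lra.
have cK : c * (C / K) <= be ^+ N / 4.
  have : 4 * c * C / be ^+ N <= K by lra.
  rewrite ler_pdivrMr// => h.
  by rewrite mulrA ler_pdivrMr//; lra.
apply: (@le_lt_trans _ _ (3 / 4 * be ^+ N)%:E); last first.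
  apply: (@lt_le_trans _ _ (be ^+ N)%:E); first by rewrite lte_fin; lra.
  apply: ereal_sup_ubound => /=; exists z => //.
  by rewrite horner_exp rnormX.
apply: (limsup_at0_le _ (t1 / K)); first by rewrite divr_gt0.
move=> t /andP[t0 tK].
have Kt1 : K * t <= t1 by move: tK; rewrite ltr_pdivlMr// => h; lra.
have Kt0 : 0 < K * t by rewrite mulr_gt0.
have t4 : t <= K * t / 4 by have := ler_wpM2r (ltW t0) K4; lra.
have bd s : 0 <= s <= t1 -> op_bound (T s) M.
  by move=> /andP[s0 s1]; apply: hM; rewrite s0 le_max s1 orbT.
have tt1 : 0 <= t <= t1 by rewrite (ltW t0); lra.
have lT := C0_linear hT _ (ltW t0).
apply: op_bound_opnorm; first by rewrite mulr_ge0 ?(ltW beN)//; lra.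
move=> x /=; set y := T (K * t) x; have nx := rnorm_ge0 x.
have r1 : rnorm (1 : R[i]) <= 1 by rewrite rnorm1.
have := op_poly_diff_bound g (T t) 1 M lT r1 M1 (bd t tt1) y.
rewrite -/c scale1r => h1.
have h2 : rnorm (y - T t y) <= C * (t / (K * t)) * rnorm x.
  rewrite rnormBC /y -C0_add ?(ltW t0) ?(ltW Kt0)// [t + _]addrC; apply: hL.
    by rewrite Kt0.
  by rewrite (ltW t0).
have h3 : rnorm (g.[1] *: y) <= al ^+ N * (M * rnorm x).
  rewrite rnormZ /g horner_exp rnormX ler_wpM2l ?exprn_ge0//; apply: bd.
  by rewrite (ltW Kt0).
rewrite (le_trans (rnorm_le_sub _ (g.[1] *: y)))// rnormBC.
rewrite (le_trans (lerD (le_trans h1 (ler_wpM2l c0 h2)) h3))//.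
have -> : C * (t / (K * t)) = C / K by field; rewrite !gt_eqF.
rewrite !mulrA -mulrDl ler_wpM2r//.
by move: cK halM; rewrite mulrA; lra.
Qed.

End PolynomialEstimate.

Theorem theorem2p2 (R : realType) (X : completeNormedModType R[i])
    (T : R -> X -> X) (hT : C0_semigroup T) :
  ((exists f : {poly R[i]},
      (limsup_at0 (fun t : R => opnorm (op_poly f (T t))) < disc_norm f)%E) ->
    extends_holomorphically T)
  /\
  (extends_holomorphically T ->
    forall f : {poly R[i]}, C1poly f ->
    exists N0 : nat, forall N : nat, (N0 <= N)%N ->
    exists K0 : R, 0 <= K0 /\ forall K : R, K0 <= K ->
      (limsup_at0 (fun t : R => opnorm (op_poly (f ^+ N) (T t) \o T (K * t)%R))
         < disc_norm (f ^+ N))%E).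
Proof.
split.
  move=> [f /(orbit_lipschitz_of_poly hT)[C [t1 [C0 t10 hL]]]].
  exact: (extends_of_orbit_lipschitz hT C t1 C0 t10 hL).
by move=> /(orbit_lipschitz_of_holomorphic hT) hL f; exact: (limsup_poly_power hT).
Qed.
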